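(* Let $1\le r\le\infty$ and $m\ge2$. (1) If $r=\infty$, then $\mathrm{mon}\,\mathcal P(^m\ell_\infty)=\ell_{\frac{2m}{m-1},\infty}$. (2) If $r=1$, then $\mathrm{mon}\,\mathcal P(^m\ell_1)=\ell_1$. (3) If $2\le r<\infty$, then $$\ell_{\frac{2m}{m-1},\infty}\cdot\ell_r\subset\mathrm{mon}\,\mathcal P(^m\ell_r)\subset\ell_{\left(\frac{m-1}{2m}+\frac1r\right)^{-1},\infty}.$$ (4) If $1<r<2$, then for any $\varepsilon>0$, $$\ell_{(mr')'-\varepsilon}\subset\mathrm{mon}\,\mathcal P(^m\ell_r)\subset\ell_{(mr')',\infty}.$$
   Context: For $1\le s\le\infty$, $s'$ denotes the conjugate exponent, $\frac1s+\frac1{s'}=1$; so $(mr')'$ is given by $\frac1{(mr')'}=1-\frac1{mr'}$. In (4) the space $\ell_{(mr')'-\varepsilon}$ is understood for $\varepsilon$ such that the exponent is positive. $\ell_{s,\infty}$ is the weak-$\ell_s$ (Marcinkiewicz/Lorentz) space of complex null sequences $u$ whose decreasing rearrangement $u^*$ satisfies $\sup_n n^{1/s}u^*_n<\infty$. For sets of sequences, $A\cdot B=\{(a_kb_k)_k:a\in A,b\in B\}$. $\mathcal P(^m\ell_r)$ is the space of bounded $m$-homogeneous polynomials on complex $\ell_r$ (restrictions of bounded $m$-linear forms to the diagonal). $\mathcal J(m)=\{\mathbf j=(j_1,\dots,j_m)\in\mathbb N^m:j_1\le\dots\le j_m\}$, $z_{\mathbf j}=z_{j_1}\cdots z_{j_m}$,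 and $c_{\mathbf j}(P)$ are the unique scalars with $P(z)=\sum_{\mathbf j\in\mathcal J(m)}c_{\mathbf j}(P)z_{\mathbf j}$ for finitely supported $z$. The set of monomial convergence is $\mathrm{mon}\,\mathcal P(^m\ell_r)=\{z\in\ell_r:\sum_{\mathbf j\in\mathcal J(m)}|c_{\mathbf j}(P)z_{\mathbf j}|<\infty\text{ for all }P\in\mathcal P(^m\ell_r)\}$. *)

(* Defs.v *)
From HB Require Import structures.
From mathcomp Require Import all_boot all_order all_algebra finmap.
From mathcomp Require Import all_classical all_reals all_analysis.
From mathcomp.real_closed Require Export complex.

Set Implicit Arguments.
Unset Strict Implicit.
Unset Printing Implicit Defensive.

Import Order.TTheory GRing.Theory Num.Theory.
Import numFieldNormedType.Exports.
Import ComplexField.Normc.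

Local Open Scope classical_set_scope.
Local Open Scope ring_scope.
Local Open Scope complex_scope.

Section Definitions.
Context {R : realType}.
Local Notation C := R[i].

(* The norm of l_p, also for 0 < p < 1, where it is only a quasi-norm. *)
Definition lnorm (p : \bar R) (z : nat -> C) : \bar R :=
  Lnorm counting p (fun k => (normc (z k))%:E).

Definition lspace (p : \bar R) : set (nat -> C) :=
  [set z | (lnorm p z < +oo)%E].

(* Since n starts at 0, [rearrangement u n] is u^*_{n+1}: the infimum over the
   sets J of at most n indices of the supremum of |u_k| over k outside J. *)
Definition rearrangement (u : nat -> C) (n : nat) : \bar R :=
  ereal_inf [set ereal_sup [set (normc (u k))%:E | k in ~` [set` J]]
            | J in [set J : {fset nat} | (#|` J| <= n)%N]].

Definition weak_lspace (s : \bar R) : set (nat -> C) :=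
  [set u | (normc (u k) @[k --> \oo] --> (0 : R)) /\
    (ereal_sup (range (fun n : nat =>
       (n.+1%:R `^ fine s^-1)%:E * rearrangement u n)) < +oo)%E].

Definition seq_mul (A B : set (nat -> C)) : set (nat -> C) :=
  [set (fun k => a k * b k) | a in A & b in B].

(* Only the values of L at m-tuples of elements of l_r matter. *)
Definition multilinear_on (m : nat) (r : \bar R)
    (L : ('I_m -> nat -> C) -> C) : Prop :=
  forall (x : 'I_m -> nat -> C) (i : 'I_m) (a : C) (u v : nat -> C),
    (forall j, lspace r (x j)) -> lspace r u -> lspace r v ->
    L [eta x with i |-> (fun k => a * u k + v k)] =
    a * L [eta x with i |-> u] + L [eta x with i |-> v].

Definition bounded_on (m : nat) (r : \bar R)
    (L : ('I_m -> nat -> C) -> C) : Prop :=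
  exists M : R, forall x : 'I_m -> nat -> C, (forall j, lspace r (x j)) ->
    normc (L x) <= M * \prod_(j < m) fine (lnorm r (x j)).

(* The bounded m-homogeneous polynomials on l_r; the values of P outside l_r
   are irrelevant. *)
Definition hpoly (m : nat) (r : \bar R) : set ((nat -> C) -> C) :=
  [set P | exists L : ('I_m -> nat -> C) -> C,
    [/\ multilinear_on r L, bounded_on r L &
        forall z, lspace r z -> P z = L (fun=> z)]].

Definition Jset (m : nat) : set (m.-tuple nat) :=
  [set j : m.-tuple nat | sorted leq j].
Arguments Jset m : clear implicits.

Definition monomial (m : nat) (z : nat -> C) (j : m.-tuple nat) : C :=
  \prod_(i < m) z (tnth j i).

(* The relation c = (c_j(P))_{j in J(m)}.  It determines c on [Jset m] only.
   For finitely supported z all but finitely many terms of the sum vanish. *)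
Definition is_coef (m : nat) (P : (nat -> C) -> C)
    (c : m.-tuple nat -> C) : Prop :=
  forall z : nat -> C, finite_set [set k | z k != 0] ->
    P z = \sum_(j \in Jset m) c j * monomial z j.

Definition mon (m : nat) (r : \bar R) : set (nat -> C) :=
  [set z | lspace r z /\
    forall P, hpoly m r P -> forall c : m.-tuple nat -> C, is_coef P c ->
      (\esum_(j in Jset m) (normc (c j * monomial z j))%:E < +oo)%E].

End Definitions.

(* Main.v *)
(* Write a_i = L(e_{i_1}, ..., e_{i_m}).  For the lower inclusions it is enough to
   bound the sum of |a_i z_{i_1} ... z_{i_m}| over i in [N]^m, uniformly in N and
   with |z_k| decreasing; split it according to the position p of the largest index.
   In (1) and (3), Cauchy-Schwarz on each fibre i_p = k reduces the bound to the
   inequality sum_k (sum_{i_p = k} |a_i|^2)^(1/2) <= C ||L|| on l_oo, that is, to the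
   equivalence of the L^1 and L^2 norms of a Rademacher chaos (Bonami).  In (4)
   one uses that each slice k |-> a_i, i_p = k, has norm at most ||L|| in l_{r'}.

   For the upper inclusions, random signs give m-linear forms on (C^n)^m with
   unimodular coefficients and norm at most C n^((m+1)/2 - m/r) on l_r if r >= 2, and
   C n^(1/r') if 1 < r < 2.  If n^beta z*_n were unbounded, sums of such forms over
   disjoint blocks of coordinates would define a polynomial whose monomial series
   diverges at z.  Each form takes its variables from m consecutive pieces of its block,
   so that its coefficients are those of the polynomial. *)

Require Import Defs.
From HB Require Import structures.
From mathcomp Require Import all_boot all_order all_algebra fingroup perm finmap.
From mathcomp Require Import all_classical all_reals all_analysis.
From mathcomp.real_closed Require Import complex.
From mathcomp Require Import ess_sup_inf ring lra zify.

Set Implicit Arguments.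
Unset Strict Implicit.
Unset Printing Implicit Defensive.

Import Order.TTheory GRing.Theory Num.Theory.
Import numFieldNormedType.Exports.
Import ComplexField.Normc.

Local Open Scope classical_set_scope.
Local Open Scope ring_scope.

(** * Kahane-Salem-Zygmund tensors *)

(** The weak-type spaces are endpoints, so the random forms must satisfy their norm bounds without
    the logarithm that an epsilon-net of the ball would cost. Here the union bound runs over integer
    vectors: one of squared length k is allowed a deviation governed by [psi n k], which is k
    ln(32n/k) and dominates the logarithm of the number of such vectors. A general nonnegative
    vector is then a sum of binary digit vectors with weights 2^-l. Sparse digit vectors are charged
    little, and this produces the exponent 1/r' when r < 2.

    The upper inclusions share one relation, kappa = m - m beta: a block of n^m unimodular
    coefficients divided by n^kappa contributes (n^beta rho)^m at entries of modulus at least rho.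
    The bad polynomial is written down explicitly, so no closed graph or Baire argument occurs.

    The coefficients c_j are specified only through values of P at finitely supported points. They
    are recovered as sums of L(e_i) over the rearrangements i of j by comparing two polynomials in
    one variable, and the triangle inequality then reduces the lower inclusions to estimates on
    L. *)

Lemma cosh_le_expR_sqr (R : realType) (x : R) :
  expR x + expR (- x) <= 2 * expR (2 * x ^+ 2).
Proof.
(* For large x, |x| <= 2 x^2 suffices. For small x, exp x <= 1/(1-x) and exp(-x) <= 1/(1+x), and
   2/(1-x^2) <= 2(1 + 2x^2) when x^2 <= 1/2. The sharp constant in the exponent would be 1/2. *)
have [x2|x2] := leP (2^-1) (x ^+ 2).
  have {}x2 : `|x| <= 2 * x ^+ 2.
    rewrite -real_normK ?num_real//; have : 0 <= `|x| by [].
    rewrite -real_normK ?num_real// in x2.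
    by move: x2; set y := `|x| => *; nra.
  have h1 : expR x <= expR (2 * x ^+ 2).
    by rewrite ler_expR (le_trans _ x2)// ler_norm.
  have h2 : expR (- x) <= expR (2 * x ^+ 2).
    by rewrite ler_expR (le_trans _ x2)// -normrN ler_norm.
  lra.
have hx1 : 0 < 1 - x by nra.
have hx2 : 0 < 1 + x by nra.
have e1 : expR x * (1 - x) <= 1.
  have := expR_ge1Dx (- x); rewrite -(ler_pM2l (expR_gt0 x)) -expRD subrr expR0.
  exact.
have e2 : expR (- x) * (1 + x) <= 1.
  have := expR_ge1Dx x; rewrite -(ler_pM2l (expR_gt0 (- x))) -expRD addNr expR0.
  exact.
have e3 := expR_ge1Dx (2 * x ^+ 2).
suff : expR x + expR (- x) <= 2 * (1 + 2 * x ^+ 2) by move=> h; lra.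
have p0 : 0 < (1 - x) * (1 + x) by rewrite mulr_gt0.
rewrite -(ler_pM2r p0).
have a1 : expR x * (1 - x) * (1 + x) <= 1 + x by rewrite -[leRHS]mul1r ler_pM2r.
have a2 : expR (- x) * (1 + x) * (1 - x) <= 1 - x by rewrite -[leRHS]mul1r ler_pM2r.
apply: (@le_trans _ _ 2); first by nra.
nra.
Qed.

(** * Deviation of Rademacher sums *)

Section Signs.
Context {R : realType}.
Implicit Types I U : finType.

Definition sgn (b : bool) : R := (-1) ^+ b.

Lemma sgn_norm b : `|sgn b| = 1.
Proof. by rewrite /sgn normrX normrN1 expr1n. Qed.

Lemma sum_expR_signs I (a : I -> R) :
  \sum_(e : {ffun I -> bool}) expR (\sum_i sgn (e i) * a i)
  <= 2 ^+ #|I| * expR (2 * \sum_i a i ^+ 2).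
Proof.
under eq_bigr do rewrite expR_sum.
rewrite -(bigA_distr_bigA (fun i b => expR (sgn b * a i))) /=.
rewrite mulr_sumr expR_sum -prodr_const -big_split /=.
apply: ler_prod => i _; rewrite big_bool /sgn/= expr1 expr0 mul1r mulN1r.
by rewrite addr_ge0 ?expR_ge0//= addrC cosh_le_expR_sqr.
Qed.

(* Union bound for Rademacher sums, with the failure probability of the [u]-th
   sum weighted by [expR (- psi u)]. *)
Lemma exists_signs I U (D : pred U) (a : U -> I -> R) (psi : U -> R) :
  \sum_(u | D u) expR (- psi u) <= 1 -> (forall u, D u -> 1 <= psi u) ->
  exists e : {ffun I -> bool}, forall u, D u ->
    `|\sum_i sgn (e i) * a u i|
      <= 4 * Num.sqrt (\sum_i a u i ^+ 2) * Num.sqrt (psi u).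
Proof.
move=> psi1 psige1.
pose S (e : {ffun I -> bool}) u := \sum_i sgn (e i) * a u i.
pose s2 u := \sum_i a u i ^+ 2.
(* Chernoff parameter, chosen so that [lam u ^+ 2 * s2 u = psi u]. Each of the two exponentials in
   [F] has mean at most 1, so the mean over all signs of the weighted sum of [F] is at most 2. *)
pose lam u := Num.sqrt (psi u) / Num.sqrt (s2 u).
pose F e u := expR (- psi u) *
  (expR (lam u * S e u - 2 * lam u ^+ 2 * s2 u)
   + expR (- lam u * S e u - 2 * lam u ^+ 2 * s2 u)).
have s20 u : 0 <= s2 u by apply: sumr_ge0 => i _; rewrite sqr_ge0.
have Sle u c :
    \sum_(e : {ffun I -> bool}) expR (c * S e u) <= 2 ^+ #|I| * expR (2 * c ^+ 2 * s2 u).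
  have := sum_expR_signs (fun i => c * a u i).
  under eq_bigr do (under eq_bigr do rewrite mulrCA; rewrite -mulr_sumr -/(S _ _)).
  by under [in leRHS]eq_bigr do rewrite exprMn; rewrite -mulr_sumr -/(s2 u) mulrA.
have tot : \sum_(e : {ffun I -> bool}) \sum_(u | D u) F e u <= \sum_(e : {ffun I -> bool}) 2.
  rewrite exchange_big /=.
  have -> : \sum_(e : {ffun I -> bool}) (2 : R) = 2 * 2 ^+ #|I|.
    by rewrite sumr_const card_ffun card_bool -[LHS]mulr_natr natrX.
  apply: (@le_trans _ _ (\sum_(u | D u) expR (- psi u) * (2 * 2 ^+ #|I|))).
    apply: ler_sum => u Du; rewrite -mulr_sumr ler_pM2l ?expR_gt0//.
    rewrite big_split /=.
    under eq_bigr do rewrite expRD.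
    under [X in _ + X <= _]eq_bigr do rewrite expRD.
    rewrite -!mulr_suml.
    have h1 := Sle u (lam u).
    have h2 := Sle u (- lam u).
    rewrite sqrrN in h2.
    rewrite -mulrDl -[leRHS]mulr1 -[X in _ <= _ * X]expR0.
    rewrite -[X in _ <= _ * expR X](subrr (2 * lam u ^+ 2 * s2 u)) expRD mulrA.
    rewrite ler_pM2r ?expR_gt0//.
    by apply: le_trans (lerD h1 h2) _; set E := expR _; nra.
  rewrite -mulr_suml -[leRHS]mul1r ler_pM2r// ?mulr_gt0 ?exprn_gt0//.
have [e He] : exists e : {ffun I -> bool}, \sum_(u | D u) F e u <= 2.
  apply/not_existsP => h.
  have : \sum_(e : {ffun I -> bool}) 2 < \sum_(e : {ffun I -> bool}) \sum_(u | D u) F e u.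
    apply: ltr_sum => [|e _]; last by rewrite ltNge; apply/negP/h.
    by apply/hasP; exists [ffun=> true] => //; rewrite mem_index_enum.
  by rewrite ltNge tot.
exists e => u Du; rewrite -/(S e u) -/(s2 u).
have Fu : F e u <= 2.
  apply: le_trans He; rewrite (bigD1 u)//= lerDl sumr_ge0// => v _.
  by rewrite mulr_ge0 ?expR_ge0// addr_ge0 ?expR_ge0.
have [s0|s0] := eqVneq (s2 u) 0.
  have -> : S e u = 0.
    rewrite /S big1// => i _; have /eqP := s0; rewrite psumr_eq0; last first.
      by move=> j _; rewrite sqr_ge0.
    by move=> /allP/(_ i); rewrite mem_index_enum sqrf_eq0 => /(_ erefl)/eqP->; rewrite mulr0.
  by rewrite normr0 mulr_ge0 ?sqrtr_ge0// mulr_ge0 ?sqrtr_ge0.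
have sp : 0 < Num.sqrt (s2 u) by rewrite sqrtr_gt0 lt_neqAle eq_sym s0 s20.
have pp : 0 < psi u by rewrite (lt_le_trans _ (psige1 u Du)).
have lp : 0 < lam u by rewrite divr_gt0// sqrtr_gt0.
have ls : lam u ^+ 2 * s2 u = psi u.
  by rewrite expr_div_n !sqr_sqrtr ?(ltW pp)// divfK.
(* From F <= 2 <= e one gets c lam S <= 1 + 3 psi, and psi >= 1 absorbs the 1: hence the constant
   4. *)
have key (c : R) : c ^+ 2 = 1 -> c * lam u * S e u <= 4 * psi u.
  move=> c1; have : expR (- psi u + (c * lam u * S e u - 2 * lam u ^+ 2 * s2 u)) <= expR 1.
    rewrite (le_trans _ (expR_ge1Dx 1))// expRD (le_trans _ Fu)// /F.
    rewrite ler_pM2l ?expR_gt0//; move/eqP: c1; rewrite sqrf_eq1 => /orP[]/eqP->.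
      by rewrite mul1r lerDl expR_ge0.
    by rewrite mulN1r lerDr expR_ge0.
  by rewrite ler_expR -(mulrA 2) ls; have := psige1 u Du; lra.
have k1 := key 1 (expr1n _ _).
have k2 : -1 * lam u * S e u <= 4 * psi u by apply: key; rewrite sqrrN expr1n.
have : lam u * `|S e u| <= 4 * psi u.
  rewrite -(ger0_norm (ltW lp)) -normrM ler_norml; apply/andP; split; lra.
rewrite -ler_pdivlMl// => /le_trans; apply.
rewrite /lam invf_div -{2}(sqr_sqrtr (ltW pp)).
rewrite le_eqVlt; apply/orP; left; apply/eqP.
have : Num.sqrt (psi u) != 0 by rewrite gt_eqF// sqrtr_gt0.
by move=> ?; field.
Qed.

End Signs.

(** * Counting lattice points by their length *)

Section LatticeCount.
Context {R : realType}.

Lemma sum_geom_le (x : R) n : 0 <= x < 1 -> \sum_(i < n) x ^+ i <= (1 - x)^-1.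
Proof.
move=> /andP[x0 x1]; have h : 0 < 1 - x by rewrite subr_gt0.
rewrite -[leRHS]div1r ler_pdivlMr// mulrC.
by have := subrX1 x n; have := exprn_ge0 n x0; lra.
Qed.

Lemma theta_le (x : R) n : 0 <= x -> x <= 2^-1 ->
  \sum_(t < n.+1) x ^+ (t ^ 2) <= 1 + 2 * x.
Proof.
move=> x0 x1; rewrite big_ord_recl expr0 lerD2l.
apply: (@le_trans _ _ (x * \sum_(i < n) x ^+ i)).
  rewrite mulr_sumr; apply: ler_sum => i _; rewrite -exprS.
  apply: ler_wiXn2l; rewrite ?x0 ?(le_trans x1)//; first lra.
  by rewrite lift0; nia.
rewrite mulrC ler_wpM2r// (le_trans (sum_geom_le _ _))//; first by apply/andP; split; lra.
by rewrite -[leRHS]invrK lef_pV2 ?posrE ?invr_gt0//; lra.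
Qed.

(** Values in ['I_n.+1] make the type finite without loss: squared length at most n forces every
    entry to be at most n. *)
Definition sqn n (u : {ffun 'I_n -> 'I_n.+1}) : nat := (\sum_j u j ^ 2)%N.

Definition psi n (k : nat) : R := k%:R * ln (32 * n%:R / k%:R).

Lemma psi_ge0 n k : (k <= n)%N -> 0 <= psi n k.
Proof.
case: k => [|k] kn; first by rewrite /psi mul0r.
rewrite mulr_ge0// ln_ge0// ler_pdivlMr ?ltr0n// mul1r.
have : k.+1%:R <= n%:R :> R by rewrite ler_nat.
have : 0 <= n%:R :> R by []. lra.
Qed.

Lemma psi_ge1 n k : (0 < k <= n)%N -> 1 <= psi n k.
Proof.
move=> /andP[k0 kn]; rewrite /psi.
have k0' : 0 < k%:R :> R by rewrite ltr0n.
have kn' : k%:R <= n%:R :> R by rewrite ler_nat.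
apply: (@le_trans _ _ (k%:R * 1)); first by rewrite mulr1 ler1n.
rewrite ler_pM2l// -[leLHS]expRK ler_ln ?posrE ?expR_gt0//; last first.
  by rewrite divr_gt0// mulr_gt0// (lt_le_trans k0').
apply: (@le_trans _ _ 32); last first.
  by rewrite ler_pdivlMr// ler_pM2l.
(* This yields e <= 4, from exp(-1/2) >= 1/2. *)
have : expR (- 2^-1) * expR (- 2^-1) * expR 1 = 1 :> R.
  by rewrite -!expRD -[RHS]expR0; congr expR; lra.
have := expR_ge1Dx (- 2^-1 : R); have := expR_gt0 (1 : R).
move: (expR 1) (expR (- 2^-1)) => b a b0 a2 ab.
have : 4^-1 <= a * a by nra.
by rewrite -(ler_pM2r b0) ab; lra.
Qed.

Lemma expR_half_le2 : expR 2^-1 <= 2 :> R.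
Proof.
have : expR (- 2^-1) * expR 2^-1 = 1 :> R by rewrite -expRD addNr expR0.
have := expR_ge1Dx (- 2^-1 : R); have := expR_gt0 (2^-1 : R).
move: (expR 2^-1) (expR (- 2^-1)) => b a b0 a2 ab.
have : 2^-1 * b <= a * b by rewrite ler_pM2r//; lra.
by rewrite ab; lra.
Qed.

(** Rankin's trick: for x > 0 the count times x^k is at most the n-th power of the truncated theta
    series, sum of x^(t^2), which is at most exp(2nx). *)
Lemma card_sqn_le n k : (0 < k <= n)%N ->
  #|[pred u : {ffun 'I_n -> 'I_n.+1} | sqn u == k]|%:R * expR (- psi n k)
    <= 2^-1 ^+ k :> R.
Proof.
move=> /andP[k0 kn].
have k0' : 0 < k%:R :> R by rewrite ltr0n.
have kn' : k%:R <= n%:R :> R by rewrite ler_nat.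
have n0' : 0 < n%:R :> R by exact: lt_le_trans kn'.
(* With this x, exp(2nx) = exp(k/4) <= 2^k. The 32 in [psi] is 8 * 4: the 8 sits in x, and the 4
   leaves (2/4)^k after the factor 2^k. *)
pose x : R := k%:R / (8 * n%:R).
have x0 : 0 < x by rewrite divr_gt0// mulr_gt0.
have xh : x <= 2^-1 by rewrite ler_pdivrMr ?mulr_gt0//; lra.
have -> : expR (- psi n k) = x ^+ k * 4^-1 ^+ k.
  rewrite -exprMn /psi -mulrN expRM_natl -lnV ?posrE; last first.
    by rewrite divr_gt0// mulr_gt0.
  congr (_ ^+ k); rewrite lnK ?posrE ?invr_gt0 ?divr_gt0 ?mulr_gt0//.
  by rewrite /x; field; rewrite !gt_eqF.
rewrite mulrA -[2^-1 ^+ k](_ : 2 ^+ k * 4^-1 ^+ k = _); last first.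
  by rewrite -exprMn; congr (_ ^+ _); lra.
rewrite ler_pM2r ?exprn_gt0 ?invr_gt0//.
apply: (@le_trans _ _ (\prod_(j < n) \sum_(t < n.+1) x ^+ (t ^ 2))).
  rewrite bigA_distr_bigA /=.
  rewrite mulrC mulr_natr -sumr_const.
  rewrite [leRHS](bigID [pred u : {ffun 'I_n -> 'I_n.+1} | sqn u == k]) /=.
  rewrite -[leLHS]addr0 lerD//.
    by apply: ler_sum => u; rewrite inE => /eqP uk; rewrite prodrXr -uk.
  by apply: sumr_ge0 => u _; apply: prodr_ge0 => i _; rewrite exprn_ge0// ltW.
apply: (@le_trans _ _ (\prod_(j < n) expR (2 * x))).
  apply: ler_prod => j _; apply/andP; split.
    by apply: sumr_ge0 => i _; rewrite exprn_ge0// ltW.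
  by rewrite (le_trans (theta_le _ (ltW x0) xh))// expR_ge1Dx.
rewrite prodr_const card_ord -expRM_natl.
have -> : n%:R * (2 * x) = k%:R * 4^-1 by rewrite /x; field; rewrite gt_eqF.
rewrite expRM_natl lerXn2r ?nnegrE ?expR_ge0//.
by rewrite (le_trans _ expR_half_le2)// ler_expR; lra.
Qed.

(** The shells of squared length k contribute at most 2^-k each. The zero vector has [psi] equal to
    0, hence weight 1, and has to stay out. *)
Lemma sum_expR_psi_le1 n :
  \sum_(u : {ffun 'I_n -> 'I_n.+1} | (0 < sqn u <= n)%N) expR (- psi n (sqn u))
    <= 1 :> R.
Proof.
rewrite (partition_big (fun u : {ffun 'I_n -> 'I_n.+1} => inord (sqn u) : 'I_n.+1)
  (fun k => 0 < k)%N) /=; last by move=> u /andP[u0 un]; rewrite inordK.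
apply: (@le_trans _ _ (\sum_(k < n.+1 | (0 < k)%N) 2^-1 ^+ k)).
  apply: ler_sum => k k0.
  have kn : (0 < k <= n)%N by rewrite k0 -ltnS ltn_ord.
  apply: le_trans (card_sqn_le kn).
  rewrite mulr_natl -sumr_const (eq_bigl (fun u : {ffun 'I_n -> 'I_n.+1} => sqn u == k)).
    by apply: ler_sum => u /eqP->.
  move=> u /=; apply/andP/eqP => [[/andP[u0 un] /eqP<-]|uk].
    by rewrite inordK.
  by rewrite uk kn; split=> //; apply/eqP/val_inj; rewrite /= inordK.
rewrite big_mkcond big_ord_recl /= add0r.
under eq_bigr => i _ do rewrite /bump add1n exprS.
rewrite -mulr_sumr.
have := @sum_geom_le 2^-1 n; set s := \sum_(i < n) _ => h.
have {}h : s <= (1 - 2^-1)^-1 by apply: h; lra.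
have e : (1 - 2^-1)^-1 = 2 :> R by field.
by rewrite e in h; lra.
Qed.

Lemma sqrtr_sum_le (I : finType) (f : I -> R) : (forall i, 0 <= f i) ->
  Num.sqrt (\sum_i f i) <= \sum_i Num.sqrt (f i).
Proof.
move=> f0; have [s0 s1] : 0 <= \sum_i Num.sqrt (f i) /\
    \sum_i f i <= (\sum_i Num.sqrt (f i)) ^+ 2.
  elim/big_rec2 : _ => [|i a b _ [a0 ab]]; first by rewrite expr0n.
  have := sqrtr_ge0 (f i); have := sqr_sqrtr (f0 i).
  by move: (Num.sqrt _) => c *; split; [lra|nra].
by rewrite -[leRHS](ger0_norm s0) -sqrtr_sqr ler_sqrt// sqr_ge0.
Qed.

(* The Kahane-Salem-Zygmund signs: the bound has no logarithm because [psi]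
   is the logarithm of the number of lattice points of given length. *)
Lemma exists_tensor_signs m n : (0 < m)%N ->
  exists e : {ffun {ffun 'I_m -> 'I_n} -> bool},
  forall u : 'I_m -> {ffun 'I_n -> 'I_n.+1}, (forall q, sqn (u q) <= n)%N ->
  `|\sum_i sgn (e i) * \prod_q (u q (i q))%:R|
    <= 4 * (\prod_q Num.sqrt (sqn (u q))%:R)
         * \sum_q Num.sqrt (psi n (sqn (u q))) :> R.
Proof.
move=> m0.
pose U := {ffun 'I_m -> {ffun 'I_n -> 'I_n.+1}}.
pose Q := [pred u : {ffun 'I_n -> 'I_n.+1} | (0 < sqn u <= n)%N].
have [|u /ffun_onP uQ|e He] := @exists_signs R {ffun 'I_m -> 'I_n} U
  [pred u | u \in ffun_on Q] (fun u i => \prod_q (u q (i q))%:R)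
  (fun u => \sum_q psi n (sqn (u q))).
(* The weight of an m-tuple of lattice vectors is the product of the weights, so the total factors
   into m sums that are at most 1. *)
- under eq_bigr do rewrite -sumrN expR_sum.
  rewrite -(bigA_distr_big Q (fun _ u => expR (- psi n (sqn u)))) /=.
  rewrite -[leRHS](expr1n _ #|'I_m|) -prodr_const.
  apply: ler_prod => q _; rewrite sum_expR_psi_le1 andbT.
  by apply: sumr_ge0 => u _; rewrite expR_ge0.
- rewrite (bigD1 (Ordinal m0))//= -[leLHS]addr0 lerD//; first exact: psi_ge1 (uQ _).
  by apply: sumr_ge0 => q _; have /andP[_ ?] := uQ q; rewrite psi_ge0.
exists e => u un.
(* A tuple containing the zero vector was left out of the union bound, but there every product
   vanishes. *)
have [|] := boolP [forall q, 0 < sqn (u q)]%N => [/forallP u0|/forallPn[q]]; last first.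
  rewrite -leqNgt leqn0 sum_nat_eq0 => /forallP uq0.
  rewrite big1 ?normr0 => [|i _].
    by rewrite !mulr_ge0 ?prodr_ge0 ?sumr_ge0// => *; rewrite ?prodr_ge0 ?sqrtr_ge0// => *; rewrite sqrtr_ge0.
  rewrite (bigD1 q)//=; have := uq0 (i q); rewrite /= expn_eq0 => /andP[/eqP-> _].
  by rewrite mul0r mulr0.
have := He [ffun q => u q]; rewrite inE => /(_ _)/le_trans.
rewrite [X in `|X|](eq_bigr (fun i => sgn (e i) * \prod_q (u q (i q))%:R)); last first.
  by move=> i _; congr (_ * _); apply: eq_bigr => q _; rewrite ffunE.
apply; first by apply/ffun_onP => q; rewrite ffunE inE u0 un.
have -> : \sum_(i : {ffun 'I_m -> 'I_n}) (\prod_q ([ffun q0 => u q0] q (i q))%:R) ^+ 2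
   = \prod_q (sqn (u q))%:R :> R.
  transitivity (\sum_(i : {ffun 'I_m -> 'I_n}) \prod_q ((u q (i q))%:R ^+ 2) : R).
    by apply: eq_bigr => i _; rewrite -prodrXl; apply: eq_bigr => q _; rewrite ffunE.
  rewrite -(bigA_distr_bigA (fun q j => (u q j)%:R ^+ 2)) /=.
  by apply: eq_bigr => q _; rewrite natr_sum; apply: eq_bigr => j _; rewrite natrX.
have prs : Num.sqrt (\prod_q (sqn (u q))%:R) = \prod_q Num.sqrt (sqn (u q))%:R :> R.
  elim/big_rec2 : _ => [|q a b _ <-]; first by rewrite sqrtr1.
  by rewrite sqrtrM.
rewrite prs -!mulrA ler_pM2l// ler_wpM2l ?prodr_ge0//.
under eq_bigr do rewrite ffunE.
by apply: sqrtr_sum_le => q; rewrite psi_ge0.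
Qed.

End LatticeCount.

(** * Binary digit vectors *)

Section Digits.
Context {R : realType}.

(** Level 0 holds the whole integer part and may exceed 1; the levels above it are true binary
    digits, equal to 0 or 1 for x >= 0. *)
Definition digit (l : nat) (x : R) : nat :=
  if l is l'.+1 then (Num.truncn (2 ^+ l * x) - 2 * Num.truncn (2 ^+ l' * x))%N
  else Num.truncn x.

Lemma truncn_double (x : R) : 0 <= x ->
  (2 * Num.truncn x <= Num.truncn (2 * x) <= 2 * Num.truncn x + 1)%N.
Proof.
move=> x0; have /andP[h1 h2] := truncn_itv x0.
rewrite -natr1 in h2; apply/andP; split.
  by rewrite truncn_ge_nat ?mulr_ge0// natrM ler_pM2l.
rewrite truncn_le_nat; set k := Num.truncn x in h1 h2 *.
have -> : (2 * k + 1).+1%:R = 2 * (k%:R + 1) :> R.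
  by rewrite -natr1 natrD natrM; lra.
by rewrite ltr_pM2l.
Qed.

Lemma digitS_le1 l (x : R) : 0 <= x -> (digit l.+1 x <= 1)%N.
Proof.
move=> x0; rewrite /digit exprS -mulrA.
have /truncn_double : 0 <= 2 ^+ l * x by rewrite mulr_ge0// exprn_ge0.
by move=> /andP[_ h]; lia.
Qed.

Lemma digit_eq0 l (x : R) : 2 ^+ l * x < 1 -> digit l x = 0%N.
Proof.
move=> h; have t0 y : y < 1 -> Num.truncn y = 0%N :> nat.
  by move=> y1; apply/truncn0Pn; rewrite lt_geF.
case: l h => [|l]; first by rewrite mul1r => /t0.
by move=> /t0 /= ->; rewrite sub0n.
Qed.

Lemma sum_digit K (x : R) : 0 <= x ->
  \sum_(l < K.+1) (2^-1 : R) ^+ l * (digit l x)%:R = 2^-1 ^+ K * (Num.truncn (2 ^+ K * x))%:R.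
Proof.
move=> x0; elim: K => [|K IH]; first by rewrite big_ord1 !expr0 !mul1r.
rewrite big_ord_recr /= IH.
have /truncn_double : 0 <= 2 ^+ K * x by rewrite mulr_ge0// exprn_ge0.
rewrite mulrA -exprS => /andP[h _].
by rewrite natrB// natrM exprS; lra.
Qed.

Lemma digit_rem K (x : R) : 0 <= x ->
  0 <= x - (2^-1 : R) ^+ K * (Num.truncn (2 ^+ K * x))%:R <= 2^-1 ^+ K.
Proof.
move=> x0; have k0 : 0 < 2 ^+ K :> R by rewrite exprn_gt0.
have /truncn_itv/andP[h1 h2] : 0 <= 2 ^+ K * x by rewrite mulr_ge0// ltW.
rewrite -natr1 in h2.
have e1 : 2 ^+ K * (2^-1 : R) ^+ K = 1 by rewrite -exprMn divff// expr1n.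
rewrite -(pmulr_rge0 _ k0) mulrBr mulrA e1 mul1r subr_ge0 h1/=.
by rewrite -(ler_pM2l k0) mulrBr mulrA e1 mul1r; lra.
Qed.

Definition digsq n l (y : 'I_n -> R) : nat := (\sum_j digit l (y j) ^ 2)%N.

Let digv n l (y : 'I_n -> R) : {ffun 'I_n -> 'I_n.+1} := [ffun j => inord (digit l (y j))].

Let digvE n l (y : 'I_n -> R) j : (digsq l y <= n)%N -> digv l y j = digit l (y j) :> nat.
Proof.
move=> yn; rewrite ffunE inordK// ltnS (leq_trans _ yn)//.
rewrite /digsq (bigD1 j)//= (leq_trans _ (leq_addr _ _))//.
by case: digit => // d; rewrite expnS expn1; nia.
Qed.

Let sqn_digv n l (y : 'I_n -> R) : (digsq l y <= n)%N -> sqn (digv l y) = digsq l y.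
Proof. by move=> yn; apply: eq_bigr => j _; rewrite digvE. Qed.

(* Each vector is expanded exactly as a combination of its binary digit vectors,
   truncated at a high level, and of the unit vectors. *)
Lemma tensor_signs_real_bound m n (e : {ffun {ffun 'I_m -> 'I_n} -> bool})
    (y : 'I_m -> 'I_n -> R) (F G : R) : (0 < n)%N ->
  (forall u : 'I_m -> {ffun 'I_n -> 'I_n.+1}, (forall q, sqn (u q) <= n)%N ->
  `|\sum_i sgn (e i) * \prod_q (u q (i q))%:R|
    <= 4 * (\prod_q Num.sqrt (sqn (u q))%:R)
         * \sum_q Num.sqrt (psi n (sqn (u q))) :> R) ->
  (forall q j, 0 <= y q j) ->
  (forall q l, (digsq l (y q) <= n)%N) ->
  (forall q K, \sum_(l < K) (2^-1 : R) ^+ l * Num.sqrt (digsq l (y q))%:R <= F) ->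
  (forall q K, \sum_(l < K) (2^-1 : R) ^+ l * Num.sqrt (digsq l (y q))%:R *
     Num.sqrt (psi n (digsq l (y q))) <= G) ->
  `|\sum_i sgn (e i) * \prod_q y q (i q)|
    <= 4 * m%:R * ((G + 1) * (F + 1) ^+ m.-1).
Proof.
move=> n0 He y0 yn yF yG.
(* Since 2^K > K = 32 n^2, the remainders after K binary places add up to at most 1/(32n). Even
   multiplied by the square root of [psi n 1] they stay below 1, which is the source of the terms +
   1 in the bound. *)
pose K := (32 * n * n)%N.
pose T := ('I_K.+1 + 'I_n)%type.
pose lam q (t : T) : R := match t with
  | inl l => 2^-1 ^+ l
  | inr j => y q j - 2^-1 ^+ K * (Num.truncn (2 ^+ K * y q j))%:R end.
pose u q (t : T) : {ffun 'I_n -> 'I_n.+1} := match t with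
  | inl l => digv l (y q)
  | inr j => [ffun k => inord (k == j)] end.
have lam0 q t : 0 <= lam q t.
  by case: t => [l|j] /=; [rewrite exprn_ge0|have /andP[] := digit_rem K (y0 q j)].
have deltaE j k : ([ffun k => inord (k == j)] : {ffun 'I_n -> 'I_n.+1}) k = (k == j) :> nat.
  by rewrite ffunE inordK// ltnS; case: (_ == _).
have yE q j : y q j = \sum_t lam q t * (u q t j)%:R.
  rewrite big_sumType /=.
  under eq_bigr do rewrite digvE//.
  rewrite sum_digit// (bigD1 j)//= deltaE eqxx mulr1 big1 ?addr0; first by lra.
  by move=> k kj; rewrite deltaE eq_sym (negbTE kj) mulr0.
have usq q t : sqn (u q t) = match t with inl l => digsq l (y q) | inr j => 1%N end.
  case: t => [l|j] /=; first by rewrite sqn_digv.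
  rewrite /sqn (bigD1 j)//= deltaE eqxx big1 ?addn0// => k kj.
  by rewrite deltaE (negbTE kj).
have un q t : (sqn (u q t) <= n)%N by rewrite usq; case: t.
(* The square roots of [psi] occur as a sum over the arguments, so exactly one argument p carries
   such a factor. For fixed p the sum over all choices of pieces factors: G + 1 from p and F + 1
   from each other argument. *)
pose g p q t := lam q t * Num.sqrt (sqn (u q t))%:R *
  (if q == p then Num.sqrt (psi n (sqn (u q t))) else 1).
have g0 p q t : 0 <= g p q t.
  by rewrite !mulr_ge0 ?sqrtr_ge0//; case: ifP; rewrite ?sqrtr_ge0.
have -> : \sum_i sgn (e i) * \prod_q y q (i q) =
    \sum_(f : {ffun 'I_m -> T}) (\prod_q lam q (f q)) *
      \sum_i sgn (e i) * \prod_q (u q (f q) (i q))%:R.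
  under [RHS]eq_bigr do rewrite mulr_sumr.
  rewrite exchange_big /=; apply: eq_bigr => i _.
  under eq_bigr do rewrite yE.
  rewrite bigA_distr_bigA mulr_sumr; apply: eq_bigr => f _.
  by rewrite big_split /= mulrCA.
apply: le_trans (ler_norm_sum _ _ _) _.
apply: (@le_trans _ _ (\sum_(f : {ffun 'I_m -> T}) 4 * \sum_p \prod_q g p q (f q))).
  apply: ler_sum => f _; rewrite normrM ger0_norm ?prodr_ge0//.
  apply: le_trans (ler_wpM2l _ (He (fun q => u q (f q)) _)) _ => //.
    by rewrite prodr_ge0.
  rewrite le_eqVlt; apply/orP; left; apply/eqP.
  rewrite -(mulrA 4) mulrCA; congr (4 * _); rewrite !mulr_sumr.
  apply: eq_bigr => p _; rewrite /g !big_split /= -mulrA; congr (_ * (_ * _)).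
  by rewrite (bigD1 p)//= eqxx big1 ?mulr1// => q /negbTE->.
rewrite -mulr_sumr exchange_big -mulrA ler_pM2l// mulr_natl.
have sum_rem q : \sum_j (y q j - 2^-1 ^+ K * (Num.truncn (2 ^+ K * y q j))%:R) <= n%:R * 2^-1 ^+ K.
  rewrite mulr_natl -[in leRHS](card_ord n) -sumr_const; apply: ler_sum => j _.
  by have /andP[] := digit_rem K (y0 q j).
have n1 : 1 <= n%:R :> R by rewrite ler1n.
have K1 : n%:R * 2^-1 ^+ K * (32 * n%:R) <= 1 :> R.
  rewrite exprVn mulrAC ler_pdivrMr ?exprn_gt0// mul1r.
  apply: (@le_trans _ _ K%:R); first by rewrite /K !natrM; lra.
  by rewrite -natrX ler_nat ltnW// ltn_expl.
have K0 : 0 <= n%:R * 2^-1 ^+ K :> R by rewrite mulr_ge0// exprn_ge0.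
have F0 q t : q != t -> \sum_s g t q s <= F + 1.
  move=> /negbTE qt; rewrite big_sumType lerD//= /g qt.
    by under eq_bigr do rewrite mulr1 usq; exact: yF.
  under eq_bigr do rewrite mulr1 usq sqrtr1 mulr1.
  by rewrite (le_trans (sum_rem q))//; nra.
have G0 q : \sum_s g q q s <= G + 1.
  rewrite big_sumType lerD//= /g eqxx.
    by under eq_bigr do rewrite usq; exact: yG.
  under eq_bigr do rewrite usq sqrtr1 mulr1.
  rewrite -mulr_suml (le_trans (ler_wpM2r (sqrtr_ge0 _) (sum_rem q)))//.
  apply: le_trans K1; rewrite ler_wpM2l//.
  rewrite -[leRHS]ger0_norm ?mulr_ge0// -sqrtr_sqr ler_sqrt ?sqr_ge0//.
  rewrite /psi mul1r divr1 (le_trans (ltW (ln_sublinear _)))//; first lra.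
  by rewrite expr2 ler_peMl//; lra.
rewrite -[in leRHS](card_ord m) -[leRHS]sumr_const; apply: ler_sum => p _.
rewrite -(bigA_distr_bigA (fun q t => g p q t)) /= (bigD1 p)//=.
apply: ler_pM => //; first by rewrite sumr_ge0.
  by rewrite prodr_ge0// => q _; rewrite sumr_ge0.
apply: (@le_trans _ _ (\prod_(q | q != p) (F + 1))).
  by apply: ler_prod => q h; apply/andP; split; [rewrite sumr_ge0|exact: F0].
by rewrite prodr_const cardC1 card_ord.
Qed.

End Digits.

(** * From nonnegative real vectors to complex ones *)

Section TensorBounds.
Context {R : realType}.
Local Notation C := R[i].

Lemma normcR (a : R) : normc (a%:C)%C = `|a|.
Proof. by rewrite /normc /= expr0n addr0 sqrtr_sqr. Qed.

Lemma normc_ge0 (z : C) : 0 <= normc z.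
Proof. by case: z => a b; rewrite sqrtr_ge0. Qed.

Lemma normc_sum (I : Type) (s : seq I) (P : pred I) (F : I -> C) :
  normc (\sum_(i <- s | P i) F i) <= \sum_(i <- s | P i) normc (F i).
Proof.
elim/big_rec2: _ => [|i a b _ h]; first by rewrite normc0.
by rewrite (le_trans (le_normcD _ _))// lerD2l.
Qed.

Lemma normc_prod (I : Type) (s : seq I) (P : pred I) (F : I -> C) :
  normc (\prod_(i <- s | P i) F i) = \prod_(i <- s | P i) normc (F i).
Proof. by elim/big_rec2: _ => [|i a b _ <-]; rewrite ?normc1// normcM. Qed.

Lemma normc_geRe (z : C) : `|complex.Re z| <= normc z.
Proof.
case: z => a b /=; rewrite -sqrtr_sqr ler_sqrt ?lerDl ?sqr_ge0//.
by rewrite addr_ge0 ?sqr_ge0.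
Qed.

Lemma normc_geIm (z : C) : `|complex.Im z| <= normc z.
Proof.
case: z => a b /=; rewrite -sqrtr_sqr ler_sqrt ?lerDr ?sqr_ge0//.
by rewrite addr_ge0 ?sqr_ge0.
Qed.

Definition tform m n (e : {ffun {ffun 'I_m -> 'I_n} -> bool}) (x : 'I_m -> 'I_n -> C) : C :=
  \sum_i (sgn (e i))%:C%C * \prod_q x q (i q).

Definition tformR m n (e : {ffun {ffun 'I_m -> 'I_n} -> bool}) (y : 'I_m -> 'I_n -> R) : R :=
  \sum_i sgn (e i) * \prod_q y q (i q).

(** The fourth roots of unity. Together with [cpart] they write z as a combination of four
    nonnegative numbers, none larger than the modulus of z. *)
Definition cunit (b : bool * bool) : C := (if b.1 then 'i else 1)%C * (-1) ^+ b.2.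

Definition cpart (b : bool * bool) (z : C) : R :=
  Num.max 0 ((-1) ^+ b.2 * (if b.1 then complex.Im z else complex.Re z)).

Lemma cpart_ge0 b z : 0 <= cpart b z.
Proof. by rewrite /cpart le_max lexx. Qed.

Lemma cpart_le b z : cpart b z <= normc z.
Proof.
rewrite /cpart ge_max normc_ge0 /=.
apply: le_trans (ler_norm _) _; rewrite normrM normrX normrN1 expr1n mul1r.
by case: ifP => _; rewrite ?normc_geRe ?normc_geIm.
Qed.

Lemma cpartE z : z = \sum_b cunit b * ((cpart b z)%:C)%C.
Proof.
rewrite -(pair_bigA _ (fun b1 b2 => cunit (b1, b2) * (cpart (b1, b2) z)%:C%C)) /=.
rewrite !big_bool /cunit /cpart /= !expr0 !expr1 !mul1r !mulr1 !mulN1r.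
have maxE (x : R) : x = Num.max 0 x - Num.max 0 (- x).
  by rewrite /Num.max oppr_gt0; case: ltgtP => ?; lra.
rewrite [LHS]complexE {1}[complex.Re z]maxE {1}[complex.Im z]maxE.
by rewrite !rmorphB /=; ring.
Qed.

Lemma normc_cunit b : normc (cunit b) = 1.
Proof.
rewrite normcM; have -> : normc ((-1) ^+ b.2 : C) = 1.
  by case: b.2; rewrite ?expr0 ?expr1 ?normcN normc1.
by case: b.1; rewrite mulr1 ?normc1// /normc /= expr0n expr1n add0r sqrtr1.
Qed.

(** [S] stands for a unit ball described by moduli; being closed under decrease, it contains the
    four nonnegative parts of each argument. The factor 4^m counts the choices of one part per
    argument. *)
Lemma tform_complexify m n (e : {ffun {ffun 'I_m -> 'I_n} -> bool})
    (S : ('I_n -> R) -> Prop) (B : R) : 0 <= B ->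
  (forall y y' : 'I_n -> R, (forall j, 0 <= y j <= y' j) -> S y' -> S y) ->
  (forall y : 'I_m -> 'I_n -> R, (forall q j, 0 <= y q j) -> (forall q, S (y q)) ->
     `|tformR e y| <= B) ->
  forall (x : 'I_m -> 'I_n -> C) (t : 'I_m -> R), (forall q, 0 < t q) ->
    (forall q, S (fun j => normc (x q j) / t q)) ->
    normc (tform e x) <= 4 ^+ m * B * \prod_q t q.
Proof.
move=> B0 Smon SB x t t0 Sx.
pose y q b j : R := cpart b (x q j) / t q.
have xE q j : x q j = (t q)%:C%C * \sum_b cunit b * ((y q b j)%:C)%C.
  rewrite {1}[x q j]cpartE mulr_sumr; apply: eq_bigr => b _.
  by rewrite mulrCA -rmorphM /= /y mulrCA divff ?gt_eqF// mulr1.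
have -> : tform e x = (\prod_q t q)%:C%C *
    \sum_(f : {ffun 'I_m -> bool * bool}) (\prod_q cunit (f q)) *
       (tformR e (fun q j => y q (f q) j))%:C%C.
  under [X in _ = _ * X]eq_bigr do rewrite /tformR rmorph_sum mulr_sumr.
  rewrite exchange_big mulr_sumr; apply: eq_bigr => i _.
  under eq_bigr do rewrite xE.
  rewrite big_split /= bigA_distr_bigA mulrCA rmorph_prod; congr (_ * _).
  rewrite mulr_sumr; apply: eq_bigr => f _.
  by rewrite rmorphM rmorph_prod big_split /= mulrCA.
rewrite normcM normcR ger0_norm ?prodr_ge0//; last by move=> q _; exact: ltW.
rewrite mulrC ler_wpM2r ?prodr_ge0//; first by move=> q _; exact: ltW.
apply: le_trans (normc_sum _ _ _) _.
apply: (@le_trans _ _ (\sum_(f : {ffun 'I_m -> bool * bool}) B)).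
  apply: ler_sum => f _; rewrite normcM normc_prod big1 ?mul1r; last first.
    by move=> q _; rewrite normc_cunit.
  rewrite normcR; apply: SB => [q j|q]; first by rewrite divr_ge0 ?cpart_ge0// ltW.
  apply: Smon (Sx q) => j; rewrite /y; apply/andP; split.
    by rewrite divr_ge0 ?cpart_ge0// ltW.
  by rewrite ler_pM2r ?invr_gt0// cpart_le.
rewrite sumr_const card_ffun card_prod card_bool card_ord -[leLHS]mulr_natl.
by rewrite natrX.
Qed.

Definition nrm_le (r : \bar R) n (x : 'I_n -> C) (t : R) : Prop :=
  if r is p%:E%E then \sum_j normc (x j) `^ p <= t `^ p
  else forall j, normc (x j) <= t.

(** The form in which random tensors enter [mon_upper]. The constant is uniform in n, and the bounds
    t are left free so that no argument has to be normalised before use. *)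
Definition ksz (r : \bar R) m (kappa : R) : Prop :=
  exists2 K : R, 0 < K & forall n, (0 < n)%N ->
  exists e : {ffun {ffun 'I_m -> 'I_n} -> bool}, forall x (t : 'I_m -> R),
    (forall q, 0 <= t q) -> (forall q, nrm_le r (x q) (t q)) ->
    normc (tform e x) <= K * n%:R `^ kappa * \prod_q t q.

Lemma tformR_scale m n (e : {ffun {ffun 'I_m -> 'I_n} -> bool}) y (a : R) :
  tformR e (fun q j => a * y q j) = a ^+ m * tformR e y.
Proof.
rewrite mulr_sumr; apply: eq_bigr => i _.
by rewrite big_split /= prodr_const card_ord mulrCA.
Qed.

Lemma ksz_real (r : \bar R) m (kappa K : R) : (0 < m)%N -> (0 < r)%E -> 0 < K ->
  (forall n, (0 < n)%N -> exists e : {ffun {ffun 'I_m -> 'I_n} -> bool},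
    forall y : 'I_m -> 'I_n -> R, (forall q j, 0 <= y q j) ->
     (forall q, nrm_le r (fun j => (y q j)%:C%C) 1) -> `|tformR e y| <= K * n%:R `^ kappa) ->
  ksz r m kappa.
Proof.
move=> m0 r0 K0 H; exists (4 ^+ m * K); first by rewrite mulr_gt0// exprn_gt0.
move=> n n0; have [e He] := H n n0; exists e => x t t0 xt.
(* Normalisation divides by t q; if some t q is 0, then x q = 0 and the form vanishes. *)
have [/existsP[q /eqP tq]|/existsPn tn0] := boolP [exists q, t q == 0].
  have xq j : x q j = 0.
    apply: eq0_normc; apply/eqP; rewrite eq_le normc_ge0 andbT.
    have := xt q; rewrite tq; case: r r0 {H He xt} => [p p0|_|//] /=; last exact.
    rewrite lte_fin in p0; rewrite powR0 ?gt_eqF// => s0.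
    have : normc (x q j) `^ p <= 0.
      by rewrite (le_trans _ s0)// (bigD1 j)//= lerDl sumr_ge0// => k _; rewrite powR_ge0.
    move=> h; have /eqP : normc (x q j) `^ p = 0.
      by apply/eqP; rewrite eq_le h powR_ge0.
    by rewrite powR_eq0 => /andP[/eqP-> _].
  rewrite /tform big1 ?normc0 => [|i _].
    by rewrite !mulr_ge0 ?powR_ge0 ?prodr_ge0 ?exprn_ge0// ltW.
  by rewrite (bigD1 q)//= xq mul0r mulr0.
rewrite -(mulrA _ K).
apply: (@tform_complexify _ _ e (fun y => nrm_le r (fun j => (y j)%:C%C) 1)) => //.
- by rewrite mulr_ge0 ?powR_ge0// ltW.
- move=> y y' yy'; case: r r0 {H He xt} => [p p0|_|//]; rewrite /nrm_le.
    rewrite lte_fin in p0.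
    apply: le_trans; apply: ler_sum => j _; rewrite !normcR.
    have /andP[h1 h2] := yy' j.
    by rewrite ge0_ler_powR ?nnegrE ?normr_ge0 ?(ltW p0)// !ger0_norm// (le_trans h1).
  move=> h j; apply: le_trans (h j); rewrite !normcR.
  by have /andP[h1 h2] := yy' j; rewrite !ger0_norm// (le_trans h1).
- by move=> q; rewrite lt_neqAle eq_sym tn0 t0.
move=> q; have tq : 0 < t q by rewrite lt_neqAle eq_sym tn0 t0.
have := xt q; case: r r0 {H He xt} => [p p0|_|//]; rewrite /nrm_le.
  rewrite powR1 => h.
  under eq_bigr do rewrite normcR ger0_norm ?divr_ge0 ?normc_ge0 ?(ltW tq)//
    powRM ?normc_ge0 ?invr_ge0 ?(ltW tq)// -(powR_inv1 (ltW tq)) -powRrM mulN1r powRN.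
  by rewrite -mulr_suml ler_pdivrMr ?powR_gt0// mul1r.
move=> h j; rewrite normcR ger0_norm ?divr_ge0 ?normc_ge0 ?(ltW tq)//.
by rewrite ler_pdivrMr ?mul1r.
Qed.

End TensorBounds.

(** * Growth exponents of the sign tensors *)

Section KSZ.
Context {R : realType}.

Lemma psi_le n k : (k <= n)%N -> psi n k <= 32 * n%:R :> R.
Proof.
case: k => [|k] kn; first by rewrite /psi mul0r mulr_ge0.
have k0 : 0 < k.+1%:R :> R by rewrite ltr0n.
have n0 : 0 < n%:R :> R by rewrite ltr0n (leq_trans _ kn).
rewrite /psi mulrC -ler_pdivlMr// ltW// ln_sublinear// divr_gt0// mulr_gt0//.
Qed.

Lemma sum_half_le2 K : \sum_(l < K) (2^-1 : R) ^+ l <= 2.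
Proof.
have h : 0 <= (2^-1 : R) < 1 by apply/andP; split; lra.
by apply: le_trans (sum_geom_le K h) _; rewrite [leLHS](_ : _ = 2)//; field.
Qed.

(** On the Euclidean ball of radius sqrt n all digit vectors have squared length at most n, so the
    crude bound [psi] <= 32n costs only a constant and the weights 2^-l make the sums over levels
    converge. *)
Lemma tensor_signs_l2 m : (0 < m)%N -> exists2 K : R, 0 < K &
  forall n, (0 < n)%N -> exists e : {ffun {ffun 'I_m -> 'I_n} -> bool},
    forall y : 'I_m -> 'I_n -> R, (forall q j, 0 <= y q j) ->
    (forall q, \sum_j y q j ^+ 2 <= n%:R) ->
    `|tformR e y| <= K * (n%:R * Num.sqrt n%:R ^+ m.-1).
Proof.
move=> m0; exists (4 * m%:R * (13 * 3 ^+ m.-1)).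
  by rewrite !mulr_gt0 ?exprn_gt0 ?ltr0n.
move=> n n0; have [e He] := @exists_tensor_signs R m n m0.
exists e => y y0 yn.
have n1 : 1 <= n%:R :> R by rewrite ler1n.
pose s : R := Num.sqrt n%:R.
have s2 : s ^+ 2 = n%:R by rewrite sqr_sqrtr.
have s0 : 0 <= s by rewrite sqrtr_ge0.
have s1 : 1 <= s by rewrite -sqrtr1 ler_sqrt.
have dn q l : (digsq l (y q) <= n)%N.
  case: l => [|l]; last first.
    rewrite -[leqRHS](card_ord n) -[leqRHS]muln1 -sum_nat_const leq_sum// => j _.
    by have := digitS_le1 l (y0 q j); case: digit => [|[|]].
  rewrite -(ler_nat R) (le_trans _ (yn q))// natr_sum; apply: ler_sum => j _.
  rewrite natrX lerXn2r ?nnegrE//.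
  by have /truncn_itv/andP[] := y0 q j.
have dsq q l : Num.sqrt (digsq l (y q))%:R <= s by rewrite ler_sqrt// ler_nat.
have h0 l : 0 <= (2^-1 : R) ^+ l by rewrite exprn_ge0.
have := @tensor_signs_real_bound R m n e y (2 * s) (12 * n%:R) n0 He y0 dn.
move=> /(_ _ _)/le_trans; apply.
- move=> q K; apply: (@le_trans _ _ (\sum_(l < K) (2^-1 : R) ^+ l * s)).
    by apply: ler_sum => l _; rewrite ler_wpM2l.
  by rewrite -mulr_suml ler_wpM2r// sum_half_le2.
- move=> q K; apply: (@le_trans _ _ (\sum_(l < K) (2^-1 : R) ^+ l * (6 * n%:R))).
    apply: ler_sum => l _; rewrite -mulrA ler_wpM2l//.
    apply: (@le_trans _ _ (s * (6 * s))); last by rewrite mulrCA -expr2 s2.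
    apply: ler_pM; rewrite ?sqrtr_ge0//.
    rewrite -[leRHS]ger0_norm ?mulr_ge0// -sqrtr_sqr ler_sqrt ?sqr_ge0//.
    by apply: le_trans (psi_le (dn q l)) _; rewrite exprMn s2 ler_wpM2r// -natrX ler_nat.
  rewrite -mulr_suml; have -> : 12 * n%:R = 2 * (6 * n%:R) :> R by lra.
  by rewrite ler_wpM2r ?mulr_ge0// sum_half_le2.
rewrite -(mulrA _ _ (n%:R * _)) ler_wpM2l ?mulr_ge0//.
rewrite mulrACA -exprMn; apply: ler_pM.
- by lra.
- by rewrite exprn_ge0//; lra.
- by lra.
by apply: lerXn2r; rewrite ?nnegrE -/s; lra.
Qed.

Lemma natr_sqrt_powR n m : (0 < m)%N ->
  n%:R * Num.sqrt n%:R ^+ m.-1 = n%:R `^ ((m%:R + 1) / 2) :> R.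
Proof.
case: m => // m _; case: n => [|n].
  by rewrite mul0r powR0// mulf_neq0// ?invr_neq0// gt_eqF// ltr_wpDl.
rewrite -powR12_sqrt// -powR_mulrn ?powR_ge0// -powRrM -{1}[n.+1%:R]powRr1//.
rewrite -powRD; last by rewrite pnatr_eq0 implybT.
by congr (_ `^ _); rewrite /= -[m.+1%:R]natr1; lra.
Qed.

Lemma ksz_infty m : (0 < m)%N -> @ksz R +oo%E m ((m%:R + 1) / 2).
Proof.
move=> m0; have [K K0 HK] := tensor_signs_l2 m0.
apply: (@ksz_real _ _ _ _ K) => // n n0; have [e He] := HK n n0.
exists e => y y0 y1; rewrite -natr_sqrt_powR//; apply: He => // q.
rewrite -[in leRHS](card_ord n) -sumr_const; apply: ler_sum => j _.
have := y1 q j; rewrite normcR ger0_norm// => h.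
by rewrite expr_le1.
Qed.

Lemma ksz_ge2 m (p : R) : (0 < m)%N -> 2 <= p ->
  ksz p%:E m ((m%:R + 1) / 2 - m%:R / p).
Proof.
move=> m0 p2; have [K K0 HK] := tensor_signs_l2 m0.
have p0 : 0 < p by lra.
apply: (@ksz_real _ _ _ _ (2 ^+ m * K)) => //; first by rewrite mulr_gt0// exprn_gt0.
move=> n n0; have [e He] := HK n n0.
exists e => y y0 y1.
have n0' : 0 < n%:R :> R by rewrite ltr0n.
(* Scaling by a maps the unit ball of l_p into the Euclidean ball of radius sqrt n. Instead of
   Hoelder's inequality, Y^2 <= 1 + Y^p is summed for Y = n^(1/p) y; this is where p >= 2 enters. *)
pose a : R := n%:R `^ p^-1 / 2.
have a0 : 0 < a by rewrite divr_gt0// powR_gt0.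
have := He (fun q j => a * y q j) (fun q j => mulr_ge0 (ltW a0) (y0 q j)).
rewrite tformR_scale normrM ger0_norm ?exprn_ge0 ?(ltW a0)// => /(_ _).
rewrite natr_sqrt_powR// powRB; last by rewrite (gt_eqF n0') implybT.
have e1 : n%:R `^ (m%:R / p) = 2 ^+ m * a ^+ m :> R.
  have -> : 2 ^+ m * a ^+ m = (n%:R `^ p^-1) ^+ m by rewrite -exprMn; congr (_ ^+ _); rewrite /a; field.
  by rewrite -powR_mulrn ?powR_ge0// -powRrM mulrC.
rewrite e1 => h.
rewrite -mulrA -(ler_pM2l (exprn_gt0 m a0)).
apply: le_trans (h _) _ => [q|]; last first.
  rewrite le_eqVlt; apply/orP; left; apply/eqP; field.
  by rewrite !expf_neq0// gt_eqF.
apply: (@le_trans _ _ (\sum_j (1 + n%:R * y q j `^ p) / 4)).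
  apply: ler_sum => j _; rewrite exprMn /a expr_div_n mulrAC.
  rewrite ler_pM ?mulr_ge0 ?sqr_ge0//; last by lra.
  rewrite -exprMn; set Y := _ * y q j.
  have Y0 : 0 <= Y by rewrite mulr_ge0 ?powR_ge0.
  have -> : n%:R * y q j `^ p = Y `^ p.
    by rewrite powRM ?powR_ge0// -powRrM mulVf ?gt_eqF// powRr1// ltW.
  have [Y1|Y1] := leP Y 1.
    by rewrite (@le_trans _ _ 1) ?expr_le1// lerDl powR_ge0.
  rewrite (@le_trans _ _ (Y `^ p)) ?lerDr// -powR_mulrn//.
  by rewrite ler_powR// ltW.
rewrite -mulr_suml big_split /= sumr_const card_ord -mulr_sumr.
have := y1 q; rewrite /nrm_le powR1.
under eq_bigr do rewrite normcR ger0_norm//.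
set S := \sum_j _ => S1; have : n%:R * S <= n%:R by rewrite ler_piMr// ltW.
lra.
Qed.

(** The terms form a geometric progression that rises to 1 and then falls, wherever t places the
    peak; hence a bound uniform in t. *)
Lemma sum_two_sided (rho t : R) K : 1 < rho -> 0 < t ->
  \sum_(l < K) Num.min (t * rho ^+ l) (t * rho ^+ l)^-1 <= 2 * rho / (rho - 1).
Proof.
move=> r1 t0; have r0 : 0 < rho - 1 by lra.
have rp : 0 < rho by lra.
have big u k : 1 <= u -> \sum_(l < k) Num.min (u * rho ^+ l) (u * rho ^+ l)^-1
    <= rho / (rho - 1).
  move=> u1; apply: (@le_trans _ _ (\sum_(l < k) (rho^-1) ^+ l)).
    apply: ler_sum => l _; rewrite ge_min; apply/orP; right.
    rewrite exprVn lef_pV2 ?posrE ?mulr_gt0 ?exprn_gt0//; last by lra.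
    by rewrite ler_peMl ?exprn_ge0// ltW.
  have h : 0 <= rho^-1 < 1 by rewrite invr_ge0 (ltW rp) invf_lt1.
  apply: le_trans (sum_geom_le _ h) _.
  by rewrite le_eqVlt; apply/orP; left; apply/eqP; field; rewrite !gt_eqF.
have [tr|tr] := leP rho t.
  apply: le_trans (big _ _ _) _; first by lra.
  by rewrite ler_pM2r ?invr_gt0//; lra.
(* The subtracted t makes the induction close: for t < 1, adding the first term t to the bound at t
   rho gives exactly the bound at t. *)
suff : \sum_(l < K) Num.min (t * rho ^+ l) (t * rho ^+ l)^-1
    <= (2 * rho - t) / (rho - 1).
  by move=> /le_trans; apply; rewrite ler_pM2r ?invr_gt0//; lra.
elim: K t t0 tr => [|K IH] t t0 tr.
  by rewrite big_ord0 divr_ge0//; lra.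
have [t1|t1] := leP 1 t.
  apply: le_trans (big _ _ t1) _.
  by rewrite ler_pM2r ?invr_gt0//; lra.
rewrite big_ord_recl expr0 mulr1.
apply: (@le_trans _ _ (t + (2 * rho - t * rho) / (rho - 1))).
  apply: lerD; first by rewrite ge_min lexx.
  under eq_bigr do rewrite exprS mulrA.
  by apply: IH; rewrite ?mulr_gt0// gtr_pMl.
by rewrite le_eqVlt; apply/orP; left; apply/eqP; field; rewrite gt_eqF.
Qed.

Lemma sqrt_ln_le (eta z : R) : 0 < eta -> 1 <= z ->
  Num.sqrt (ln z) <= z `^ eta / Num.sqrt (2 * eta).
Proof.
move=> eta0 z1; have z0 : 0 < z by lra.
have e0 : 0 < 2 * eta by rewrite mulr_gt0.
have -> : z `^ eta = Num.sqrt (z `^ (2 * eta)).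
  by rewrite -powR12_sqrt ?powR_ge0// -powRrM mulrAC divff ?mul1r.
rewrite -sqrtrV ?(ltW e0)// -sqrtrM ?powR_ge0// ler_sqrt ?mulr_ge0 ?powR_ge0 ?invr_ge0 ?(ltW e0)//.
by rewrite ler_pdivlMr// mulrC -ln_powR ltW// ln_sublinear// powR_gt0.
Qed.

Lemma sqrt_psi_le n k (eta : R) : 0 < eta <= 1 -> (k <= n)%N ->
  Num.sqrt k%:R * Num.sqrt (psi n k) <=
    32 / Num.sqrt (2 * eta) * (k%:R `^ (1 - eta) * n%:R `^ eta) :> R.
Proof.
move=> /andP[eta0 eta1]; case: k => [|k] kn.
  by rewrite sqrtr0 mul0r !mulr_ge0 ?powR_ge0 ?invr_ge0 ?sqrtr_ge0.
have k0 : 0 < k.+1%:R :> R by rewrite ltr0n.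
have kn' : k.+1%:R <= n%:R :> R by rewrite ler_nat.
set d : R := k.+1%:R in k0 kn' *.
have n0' : 0 < n%:R :> R by lra.
have d1 : 1 <= 32 * n%:R / d by rewrite ler_pdivlMr//; lra.
rewrite /psi sqrtrM ?(ltW k0)// mulrA -expr2 sqr_sqrtr ?(ltW k0)//.
apply: le_trans (ler_wpM2l (ltW k0) (sqrt_ln_le eta0 d1)) _.
rewrite powRM ?invr_ge0 ?(ltW k0) ?mulr_ge0// powRM//.
rewrite -(powR_inv1 (ltW k0)) -powRrM mulN1r powRB; last by rewrite (gt_eqF k0) implybT.
rewrite powRr1 ?(ltW k0)// powRN.
have h32 : 32 `^ eta <= 32 :> R by apply: ler1_powR; lra.
set N := n%:R `^ eta; set D := d `^ eta; set s := Num.sqrt _.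
have -> : d * (32 `^ eta * N / D / s) = 32 `^ eta * (d / D * N / s).
  rewrite !mulrA; ring.
have -> : 32 / s * (d / D * N) = 32 * (d / D * N / s) by ring.
by rewrite ler_wpM2r// !mulr_ge0 ?invr_ge0 ?powR_ge0 ?sqrtr_ge0 ?(ltW k0).
Qed.

End KSZ.

Lemma powR_exprn (R : realType) (x a : R) l : 0 <= x -> (x `^ a) ^+ l = (x ^+ l) `^ a.
Proof.
move=> x0; rewrite -[LHS]powR_mulrn ?powR_ge0// -[x ^+ l]powR_mulrn//.
by rewrite -!powRrM mulrC.
Qed.

(** [s l] will be the squared length of the l-th digit vector. The bounds n and 2^(lp) cross at 2^l
    = n^(1/p), and the terms decay geometrically away from that level. The exponent (1 - 1/p)/2 is
    positive, to absorb the logarithm, and below 1 - 1/p, to keep the terms growing before the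
    crossing. *)
Lemma sum_truncated_powers (R : realType) (p : R) : 1 < p < 2 -> exists2 c : R, 0 < c &
  forall n (s : nat -> nat) K, (0 < n)%N ->
    (forall l, (s l <= n)%N) -> (forall l, (s l)%:R <= (2 ^+ l) `^ p) ->
    \sum_(l < K) (2^-1) ^+ l *
       ((s l)%:R `^ (1 - (1 - p^-1) / 2) * n%:R `^ ((1 - p^-1) / 2))
    <= c * n%:R `^ (1 - p^-1) :> R.
Proof.
move=> /andP[p1 p2]; pose a := (p - 1) / 2; pose rho : R := 2 `^ a.
have p0 : 0 < p by lra.
have ip : p^-1 < 1 by rewrite invf_lt1.
have ip0 : 0 < p^-1 by rewrite invr_gt0.
have pv : p * p^-1 = 1 by rewrite divff// gt_eqF.
have a0 : 0 < a by rewrite /a; lra.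
have rho1 : 1 < rho.
  by rewrite -(powRr0 2) /rho /powR pnatr_eq0 ltr_expR ltr_pM2r// ln_gt0//; lra.
exists (2 * rho / (rho - 1)); first by rewrite !mulr_gt0 ?invr_gt0//; lra.
move=> n s K n0 sn sl.
have n0' : 0 < n%:R :> R by rewrite ltr0n.
have n1 : 1 <= n%:R :> R by rewrite ler1n.
have nn0 : n%:R != 0 :> R by rewrite gt_eqF.
pose N : R := n%:R `^ (1 - p^-1).
pose t : R := n%:R `^ (- (a / p)).
have t0 : 0 < t by rewrite powR_gt0.
apply: (@le_trans _ _ (\sum_(l < K) N * Num.min (t * rho ^+ l) (t * rho ^+ l)^-1)); last first.
  by rewrite -mulr_sumr mulrC ler_wpM2r ?powR_ge0// sum_two_sided.
apply: ler_sum => l _.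
have l0 : 0 < 2 ^+ l :> R by rewrite exprn_gt0.
have s0 : 0 <= (s l)%:R :> R by [].
have eta0 : 0 <= 1 - (1 - p^-1) / 2 by lra.
have rhol : rho ^+ l = (2 ^+ l) `^ a.
  by rewrite powR_exprn.
have two_inv : (2^-1 : R) ^+ l = (2 ^+ l) `^ (-1) by rewrite powR_inv1 ?exprVn ?(ltW l0).
have [sl1 sl2] : (2^-1) ^+ l * ((s l)%:R `^ (1 - (1 - p^-1) / 2) * n%:R `^ ((1 - p^-1) / 2))
   <= N * (t * rho ^+ l) /\
   (2^-1) ^+ l * ((s l)%:R `^ (1 - (1 - p^-1) / 2) * n%:R `^ ((1 - p^-1) / 2))
   <= N * (n%:R `^ p^-1 / 2 ^+ l).
  split.
    have -> : N * (t * rho ^+ l) =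
        2^-1 ^+ l * (((2 ^+ l) `^ p) `^ (1 - (1 - p^-1) / 2) * n%:R `^ ((1 - p^-1) / 2)).
      rewrite two_inv rhol -powRrM mulrA mulrA /N /t -!powRD ?nn0 ?(gt_eqF l0) ?implybT// mulrC.
      congr (_ `^ _ * _ `^ _); first by rewrite /a; lra.
      by rewrite /a mulrAC mulrBl pv; lra.
    rewrite ler_wpM2l ?exprn_ge0// ler_wpM2r ?powR_ge0//.
    by rewrite ge0_ler_powR ?nnegrE ?powR_ge0.
  have -> : N * (n%:R `^ p^-1 / 2 ^+ l) =
      2^-1 ^+ l * (n%:R `^ (1 - (1 - p^-1) / 2) * n%:R `^ ((1 - p^-1) / 2)).
    rewrite -powRD ?nn0 ?implybT// mulrA /N -powRD ?nn0 ?implybT// exprVn mulrC.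
    by congr (_ * _ `^ _); lra.
  rewrite ler_wpM2l ?exprn_ge0// ler_wpM2r ?powR_ge0//.
  by rewrite ge0_ler_powR ?nnegrE// ler_nat.
rewrite /Num.min; case: ltP => // trho; apply: le_trans sl2 _.
rewrite ler_wpM2l ?powR_ge0//.
have tr0 : 0 < t * rho ^+ l by rewrite mulr_gt0// exprn_gt0// (lt_trans _ rho1).
have tau : t * rho ^+ l = (2 ^+ l / n%:R `^ p^-1) `^ a.
  rewrite powRM ?invr_ge0 ?powR_ge0 ?(ltW l0)// rhol mulrC; congr (_ * _).
  by rewrite /t -powRN -powRrM; congr (_ `^ _); lra.
set u := 2 ^+ l / n%:R `^ p^-1 in tau.
have u0 : 0 < u by rewrite divr_gt0// powR_gt0.
have -> : n%:R `^ p^-1 / 2 ^+ l = u^-1 by rewrite invf_div.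
rewrite lef_pV2 ?posrE// tau.
(* Past the crossing u >= 1, and there 1/u <= u^-a because a <= 1. *)
have u1 : 1 <= u.
  rewrite leNgt; apply/negP => u1.
  have : (t * rho ^+ l) < 1.
    by rewrite tau -(powRr0 u) /powR (gt_eqF u0) ltr_expR ltr_nM2r// ln_lt0// u0.
  move=> h; have : 1 < (t * rho ^+ l)^-1 by rewrite invf_gt1.
  by move: trho h; lra.
by apply: ler1_powR => //; rewrite /a; lra.
Qed.

Lemma ksz_lt2 (R : realType) m (p : R) : (0 < m)%N -> 1 < p < 2 ->
  ksz p%:E m (1 - p^-1).
Proof.
move=> m0 p12; have /andP[p1 p2] := p12.
have p0 : 0 < p by lra.
have ip : p^-1 < 1 by rewrite invf_lt1.
have ip0 : 0 < p^-1 by rewrite invr_gt0.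
have [c c0 Hc] := sum_truncated_powers p12.
pose eta := (1 - p^-1) / 2.
have eta01 : 0 < eta <= 1 by rewrite /eta; apply/andP; split; lra.
(* theta < 1 because p < 2. So [F] is bounded independently of n, and only the argument carrying
   [psi] produces a power of n. *)
pose theta : R := 2^-1 * 2 `^ (p / 2).
have theta1 : 0 <= theta < 1.
  rewrite mulr_ge0 ?powR_ge0// /theta /=.
  suff : 2 `^ (p / 2) < 2 `^ 1 :> R by rewrite powRr1//; lra.
  by rewrite /powR pnatr_eq0 ltr_expR ltr_pM2r ?ln_gt0//; lra.
pose F := (1 - theta)^-1.
have F0 : 0 < F by rewrite invr_gt0; lra.
pose c' := 32 / Num.sqrt (2 * eta) * c.
have sq0 : 0 < Num.sqrt (2 * eta) by rewrite sqrtr_gt0 mulr_gt0//; lra.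
have c'0 : 0 < c' by rewrite !mulr_gt0// invr_gt0.
apply: (@ksz_real _ _ _ _ (4 * m%:R * ((c' + 1) * (F + 1) ^+ m.-1))) => //.
  by rewrite !mulr_gt0 ?exprn_gt0 ?ltr0n//; lra.
move=> n n0; have [e He] := @exists_tensor_signs R m n m0.
exists e => y y0; rewrite /nrm_le => y1.
have {}y1 q : \sum_j y q j `^ p <= 1.
  by have := y1 q; rewrite powR1; under eq_bigr do rewrite normcR ger0_norm//.
have yle1 q j : y q j <= 1.
  rewrite leNgt; apply/negP => h.
  have : y q j `^ p <= 1.
    by rewrite (le_trans _ (y1 q))// (bigD1 j)//= lerDl sumr_ge0// => k _; rewrite powR_ge0.
  by have := @le1r_powR _ (y q j) p (ltW h) (ltW p1); lra.
have dig1 q l j : (digit l (y q j) <= 1)%N.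
  case: l => [|l]; last exact: digitS_le1.
  by rewrite /= truncn_le_nat; have := yle1 q j; lra.
have dn q l : (digsq l (y q) <= n)%N.
  rewrite -[leqRHS](card_ord n) -[leqRHS]muln1 -sum_nat_const leq_sum// => j _.
  by have := dig1 q l j; case: digit => [|[|]].
(* Chebyshev's inequality: a nonzero digit at level l forces 2^l y >= 1. *)
have dl q l : (digsq l (y q))%:R <= (2 ^+ l) `^ p.
  have l0 : 0 < 2 ^+ l :> R by rewrite exprn_gt0.
  rewrite -[leRHS]mulr1 (le_trans _ (ler_wpM2l (powR_ge0 _ _) (y1 q)))//.
  rewrite natr_sum mulr_sumr; apply: ler_sum => j _.
  rewrite -powRM ?(ltW l0)//.
  have [h|h] := ltP (2 ^+ l * y q j) 1; first by rewrite digit_eq0// exp0n// powR_ge0.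
  apply: (@le_trans _ _ 1); first by rewrite (ler_nat R _ 1); have := dig1 q l j; case: digit => [|[|]].
  by rewrite (le_trans h)//; exact: le1r_powR h (ltW p1).
have h0 l : 0 <= (2^-1 : R) ^+ l by rewrite exprn_ge0.
have N1 : 1 <= n%:R `^ (1 - p^-1) :> R.
  by rewrite -[leLHS](powRr0 n%:R) ler_powR ?ler1n//; lra.
have := @tensor_signs_real_bound R m n e y F (c' * n%:R `^ (1 - p^-1)) n0 He y0 dn.
move=> /(_ _ _)/le_trans; apply.
- move=> q K; apply: le_trans (sum_geom_le K theta1); apply: ler_sum => l _.
  rewrite /theta exprMn ler_wpM2l//.
  have -> : (2 `^ (p / 2)) ^+ l = Num.sqrt ((2 ^+ l) `^ p) :> R.
    by rewrite powR_exprn// -powR12_sqrt ?powR_ge0// -powRrM.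
  by rewrite ler_sqrt ?powR_ge0.
- move=> q K; rewrite /c' -mulrA.
  apply: le_trans (ler_wpM2l _ (Hc n (fun l => digsq l (y q)) K n0 (dn q) (dl q))); last first.
    by rewrite divr_ge0// ltW.
  rewrite mulr_sumr; apply: ler_sum => l _.
  by rewrite -[leLHS]mulrA [leRHS]mulrCA ler_wpM2l// sqrt_psi_le.
have X0 : 0 <= (F + 1) ^+ m.-1 by rewrite exprn_ge0//; lra.
move: N1 X0 c'0; move: (n%:R `^ _) ((F + 1) ^+ _) c' => N X b N1 X0 b0.
rewrite -(mulrA (4 * _)) ler_wpM2l ?mulr_ge0// mulrAC ler_wpM2r//.
by rewrite mulrDl mul1r lerD2l.
Qed.

(** * The mixed (l1, l2) inequality *)

Lemma sum_cauchy (R : realType) (I : finType) (P : pred I) (f g : I -> R) :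
  (\sum_(i | P i) f i * g i) ^+ 2 <=
  (\sum_(i | P i) f i ^+ 2) * (\sum_(i | P i) g i ^+ 2).
Proof.
set A := \sum_(i | P i) f i ^+ 2; set B := \sum_(i | P i) g i ^+ 2.
set c := \sum_(i | P i) f i * g i.
have h (s t : R) : 0 <= s ^+ 2 * A - 2 * s * t * c + t ^+ 2 * B.
  have : 0 <= \sum_(i | P i) (s * f i - t * g i) ^+ 2.
    by apply: sumr_ge0 => i _; rewrite sqr_ge0.
  rewrite (eq_bigr (fun i => s ^+ 2 * f i ^+ 2 + ((- (2 * s * t)) * (f i * g i) + t ^+ 2 * g i ^+ 2))).
    by rewrite !big_split /= -!mulr_sumr -/A -/B -/c; lra.
  by move=> i _; ring.
have A0 : 0 <= A by apply: sumr_ge0 => i _; rewrite sqr_ge0.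
have B0 : 0 <= B by apply: sumr_ge0 => i _; rewrite sqr_ge0.
have [A0'|Ap] := eqVneq A 0; last first.
  have := h c A; have {}Ap : 0 < A by rewrite lt_neqAle eq_sym Ap.
  have -> : c ^+ 2 * A - 2 * c * A * c + A ^+ 2 * B = A * (A * B - c ^+ 2) by ring.
  by rewrite pmulr_rge0// subr_ge0.
have [c0|c0] := eqVneq c 0; first by rewrite c0 expr0n mulr_ge0.
(* For A = 0 the form is linear in s, and this s gives it the value -1. *)
have := h ((B + 1) / (2 * c)) 1; rewrite A0' mulr0 add0r !expr1n mul1r mulr1.
have -> : 2 * ((B + 1) / (2 * c)) * c = B + 1 by field.
by lra.
Qed.

(** * Moments of Rademacher chaoses *)

Section Chaos.
Context {R : realType} {V : finType}.
Implicit Types (w : {ffun V -> bool}) (S D : {set V}).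

Definition avg (f : {ffun V -> bool} -> R) : R := (2 ^+ #|V|)^-1 * \sum_w f w.

Definition walsh S w : R := \prod_(v in S) sgn (w v).

Definition flip (v : V) w : {ffun V -> bool} := [ffun x => if x == v then ~~ w x else w x].

Lemma flipK v : involutive (flip v).
Proof. by move=> w; apply/ffunP => x; rewrite !ffunE; case: eqP => // _; rewrite negbK. Qed.

Lemma avgD f g : avg (fun w => f w + g w) = avg f + avg g.
Proof. by rewrite /avg big_split mulrDr. Qed.

Lemma avgZ a f : avg (fun w => a * f w) = a * avg f.
Proof. by rewrite /avg -mulr_sumr mulrCA. Qed.

Lemma eq_avg f g : f =1 g -> avg f = avg g.
Proof. by move=> fg; rewrite /avg; congr (_ * _); apply: eq_bigr. Qed.

Lemma avg_cst c : avg (fun=> c) = c.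
Proof.
rewrite /avg sumr_const card_ffun card_bool -[c *+ _]mulr_natl natrX mulrA.
by rewrite mulVf ?mul1r// expf_neq0.
Qed.

Lemma ler_avg f g : (forall w, f w <= g w) -> avg f <= avg g.
Proof.
by move=> fg; rewrite ler_wpM2l ?invr_ge0 ?exprn_ge0//; apply: ler_sum => w _.
Qed.

Lemma avg_ge0 f : (forall w, 0 <= f w) -> 0 <= avg f.
Proof. by move=> f0; rewrite -(avg_cst 0) ler_avg. Qed.

Lemma avg_sum (J : finType) (F : J -> {ffun V -> bool} -> R) :
  avg (fun w => \sum_j F j w) = \sum_j avg (F j).
Proof. by rewrite /avg exchange_big mulr_sumr. Qed.

Lemma avg_cauchy f g : avg (fun w => f w * g w) ^+ 2 <=
  avg (fun w => f w ^+ 2) * avg (fun w => g w ^+ 2).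
Proof.
rewrite /avg exprMn [X in X * _ <= _]expr2 [leRHS]mulrACA.
by rewrite ler_wpM2l ?sum_cauchy// mulr_ge0// invr_ge0 exprn_ge0.
Qed.

Lemma avg_flip v f : avg (fun w => f (flip v w)) = avg f.
Proof.
rewrite /avg; congr (_ * _); rewrite [RHS](reindex_inj (inv_inj (flipK v))).
by [].
Qed.

Lemma avg_sgn0 v f : (forall w, f (flip v w) = f w) ->
  avg (fun w => sgn (w v) * f w) = 0.
Proof.
move=> fv; have : avg (fun w => sgn (w v) * f w) = - avg (fun w => sgn (w v) * f w).
  rewrite -{1}(avg_flip v) -mulN1r -avgZ; apply: eq_avg => w.
  by rewrite fv ffunE eqxx /sgn; case: (w v) => /=; rewrite ?expr0 ?expr1; lra.
lra.
Qed.

Lemma walsh_flip v S w : v \notin S -> walsh S (flip v w) = walsh S w.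
Proof.
move=> vS; apply: eq_bigr => x xS; rewrite ffunE; case: eqP => // xv.
by rewrite -xv xS in vS.
Qed.

Lemma walshD1 v S w : v \in S -> walsh S w = sgn (w v) * walsh (S :\ v) w.
Proof. by move=> vS; rewrite /walsh (big_setD1 v). Qed.

(** Induction on the number of signs. Write f = g + eps h with eps the sign at v; g and h do not
    involve eps, and h has degree at most d - 1. Odd powers of eps average to 0, so only g^4, 6 g^2
    h^2 and h^4 remain. *)
Lemma bonami (I : finType) (a : I -> R) k : forall D, #|D| = k ->
  forall d (P : pred I) (S : I -> {set V}), {in P &, injective S} ->
  (forall i, P i -> S i \subset D /\ (#|S i| <= d)%N) ->
  let f := fun w => \sum_(i | P i) a i * walsh (S i) w in
  avg (fun w => f w ^+ 2) = \sum_(i | P i) a i ^+ 2 /\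
  avg (fun w => f w ^+ 4) <= 9 ^+ d * (\sum_(i | P i) a i ^+ 2) ^+ 2.
Proof.
elim: k => [|k IH] D Dk d P S Sinj SD f.
  have D0 : D = finset.set0 by apply/eqP; rewrite -cards_eq0 Dk.
  have S0 i : P i -> S i = finset.set0.
    by move=> /SD[+ _]; rewrite D0 finset.subset0 => /eqP.
  have [i Pi|P0] := pickP P; last first.
    have f0 w : f w = 0 by rewrite /f big_pred0.
    rewrite big_pred0//; under eq_avg do rewrite f0 expr0n.
    by under [in X in _ /\ X]eq_avg do rewrite f0 expr0n; rewrite avg_cst expr0n mulr0.
  have Pi1 : P =1 pred1 i.
    move=> j; apply/idP/eqP => [Pj|->//]; apply: Sinj => //; by rewrite !S0.
  have f1 w : f w = a i.
    by rewrite /f (eq_bigl _ _ Pi1) big_pred1_eq S0// /walsh big_set0 mulr1.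
  rewrite (eq_bigl _ _ Pi1) big_pred1_eq.
  under eq_avg do rewrite f1; under [in X in _ /\ X]eq_avg do rewrite f1.
  rewrite !avg_cst; split=> //; rewrite -exprM ler_peMl ?exprn_even_ge0//.
  by rewrite exprn_ege1// ler1n.
have [v vD] : exists v, v \in D by apply/card_gt0P; rewrite Dk.
pose P1 i := P i && (v \notin S i); pose P2 i := P i && (v \in S i).
pose g w := \sum_(i | P1 i) a i * walsh (S i) w.
pose h w := \sum_(i | P2 i) a i * walsh (S i :\ v) w.
have fE w : f w = g w + sgn (w v) * h w.
  rewrite /f (bigID (fun i => v \in S i)) /= addrC; congr (_ + _).
  rewrite mulr_sumr; apply: eq_bigr => i /andP[_ vi].
  by rewrite (walshD1 _ vi) mulrCA.
have gv w : g (flip v w) = g w.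
  by apply: eq_bigr => i /andP[_ vi]; rewrite walsh_flip.
have hv w : h (flip v w) = h w.
  by apply: eq_bigr => i /andP[_ vi]; rewrite walsh_flip// !inE eqxx.
have Dk' : #|D :\ v| = k by have := cardsD1 v D; rewrite vD Dk => -[].
have [g2 g4] : avg (fun w => g w ^+ 2) = \sum_(i | P1 i) a i ^+ 2 /\
  avg (fun w => g w ^+ 4) <= 9 ^+ d * (\sum_(i | P1 i) a i ^+ 2) ^+ 2.
  apply: (IH _ Dk') => [i j /andP[Pi _] /andP[Pj _]|i /andP[/SD[iD id] vi]].
    exact: Sinj.
  by rewrite finset.subsetD1 iD vi.
have [h2 h4] : avg (fun w => h w ^+ 2) = \sum_(i | P2 i) a i ^+ 2 /\
  9 * avg (fun w => h w ^+ 4) <= 9 ^+ d * (\sum_(i | P2 i) a i ^+ 2) ^+ 2.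
  have inj2 : {in P2 &, injective (fun i => S i :\ v)}.
    move=> i j /andP[Pi vi] /andP[Pj vj] e; apply: Sinj => //.
    by rewrite -(finset.setD1K vi) e finset.setD1K.
  have sub2 i : P2 i -> S i :\ v \subset D :\ v /\ (#|S i :\ v| <= d.-1)%N.
    move=> /andP[/SD[iD id] vi]; rewrite finset.setSD//; split=> //.
    by have := cardsD1 v (S i); rewrite vi; lia.
  have [-> e4] := IH _ Dk' d.-1 P2 _ inj2 sub2; split=> //.
  (* For d = 0 lowering the degree gains no factor 9, but then no set contains v and h = 0. *)
  case: d SD {g4} e4 sub2 => [|d] SD e4 sub2; last by rewrite exprS; lra.
  have P20 : P2 =1 pred0.
    move=> i; apply/negP => /andP[/SD[_]]; rewrite leqn0 cards_eq0 => /eqP->.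
    by rewrite inE.
  have e4' : avg (fun w => h w ^+ 4) <= 9 ^+ 0.-1 * (\sum_(i | P2 i) a i ^+ 2) ^+ 2 := e4.
  rewrite big_pred0 // expr0n mulr0 in e4' *.
  by rewrite -[leRHS](mulr0 9) ler_pM2l.
have split2 : \sum_(i | P i) a i ^+ 2 = \sum_(i | P1 i) a i ^+ 2 + \sum_(i | P2 i) a i ^+ 2.
  by rewrite (bigID (fun i => v \in S i)) /= addrC.
rewrite split2.
have sg2 w : sgn (w v) ^+ 2 = 1 :> R by rewrite -real_normK ?num_real// sgn_norm expr1n.
split.
  rewrite (@eq_avg _ (fun w => g w ^+ 2 + (2 * (sgn (w v) * (g w * h w)) + h w ^+ 2))).
    rewrite !avgD avgZ avg_sgn0 ?mulr0 ?add0r ?g2 ?h2// => w.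
    by rewrite gv hv.
  move=> w; rewrite fE.
  have -> : (g w + sgn (w v) * h w) ^+ 2 = g w ^+ 2 + (2 * (sgn (w v) * (g w * h w))
    + sgn (w v) ^+ 2 * h w ^+ 2) by ring.
  by rewrite sg2 mul1r.
(* Cauchy-Schwarz gives the geometric mean of 9^d and 9^(d-1), that is 9^d/3. Multiplied by 6 it is
   the cross term 2AB of (A + B)^2, which is why the base is 9. *)
have gh : avg (fun w => g w ^+ 2 * h w ^+ 2) <=
    9 ^+ d * ((\sum_(i | P1 i) a i ^+ 2) * (\sum_(i | P2 i) a i ^+ 2)) / 3.
  set A := \sum_(i | P1 i) _ in g4 *; set B := \sum_(i | P2 i) _ in h4 *.
  have A0 : 0 <= A by rewrite sumr_ge0// => i _; rewrite sqr_ge0.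
  have B0 : 0 <= B by rewrite sumr_ge0// => i _; rewrite sqr_ge0.
  have N0 : 0 <= 9 ^+ d :> R by rewrite exprn_ge0.
  have c0 : 0 <= 9 ^+ d * (A * B) / 3 by rewrite !mulr_ge0.
  rewrite -(@ler_pXn2r _ 2) ?nnegrE//; last first.
    by apply: avg_ge0 => w; rewrite mulr_ge0 ?sqr_ge0.
  apply: le_trans (avg_cauchy _ _) _.
  rewrite (@eq_avg (fun w => (g w ^+ 2) ^+ 2) (fun w => g w ^+ 4)); last first.
    by move=> w; rewrite -exprM.
  rewrite (@eq_avg (fun w => (h w ^+ 2) ^+ 2) (fun w => h w ^+ 4)); last first.
    by move=> w; rewrite -exprM.
  have {}h4 : avg (fun w => h w ^+ 4) <= 9 ^+ d * B ^+ 2 / 9 by lra.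
  apply: le_trans (ler_pM _ _ g4 h4) _.
  - by apply: avg_ge0 => w; rewrite exprn_even_ge0.
  - by apply: avg_ge0 => w; rewrite exprn_even_ge0.
  by rewrite le_eqVlt; apply/orP; left; apply/eqP; field.
rewrite (@eq_avg _ (fun w => g w ^+ 4 + (6 * (g w ^+ 2 * h w ^+ 2) +
  (sgn (w v) * (4 * (g w ^+ 3 * h w + g w * h w ^+ 3)) + h w ^+ 4)))).
  rewrite !avgD avgZ avg_sgn0; last by move=> w; rewrite gv hv.
  rewrite add0r; have : 0 <= 9 ^+ d * (\sum_(i | P2 i) a i ^+ 2) ^+ 2 by rewrite mulr_ge0 ?sqr_ge0 ?exprn_ge0.
  by lra.
move=> w; rewrite fE.
have -> : (g w + sgn (w v) * h w) ^+ 4 = g w ^+ 4 + (6 * (g w ^+ 2 * ((sgn (w v)) ^+ 2 * h w ^+ 2))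
  + (sgn (w v) * (4 * (g w ^+ 3 * h w + (sgn (w v)) ^+ 2 * (g w * h w ^+ 3))) + (sgn (w v)) ^+ 2 * (sgn (w v)) ^+ 2 * h w ^+ 4)) by ring.
by rewrite sg2 !mul1r.
Qed.

(** A pointwise substitute for interpolating L^2 between L^1 and L^4. *)
Lemma quartic_le (s y : R) : 0 < s -> 0 <= y ->
  s ^+ 2 * y ^+ 2 - y ^+ 4 / 4 <= s ^+ 3 * y.
Proof.
move=> s0 y0; have s0' := ltW s0.
suff : 0 <= y * (s ^+ 3 - s ^+ 2 * y + y ^+ 3 / 4) by lra.
(* The cubic has its minimum in y at 2s/sqrt 3; the square is centred at the nearby rational point
   6s/5, and what is left has positive coefficients. *)
have -> : s ^+ 3 - s ^+ 2 * y + y ^+ 3 / 4 =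
    (y + 12 / 5 * s) * (y - 6 / 5 * s) ^+ 2 / 4 + 2 / 25 * (s ^+ 2 * y)
    + 17 / 125 * s ^+ 3 by field.
have h1 : 0 <= (y + 12 / 5 * s) * (y - 6 / 5 * s) ^+ 2.
  by rewrite mulr_ge0 ?sqr_ge0//; lra.
have h2 : 0 <= s ^+ 2 * y by rewrite mulr_ge0 ?sqr_ge0.
have h3 : 0 <= s ^+ 3 by rewrite exprn_ge0.
by rewrite mulr_ge0//; lra.
Qed.

(** [quartic_le] is averaged at y = |f| with s = 3^d ||f||_2. By [bonami] the quartic term removes
    at most a quarter of s^2 ||f||_2^2; the resulting constant 4/3 is rounded up to 2. *)
Lemma chaos_l1_l2 (I : finType) (a : I -> R) d (P : pred I) (S : I -> {set V}) :
  {in P &, injective S} -> (forall i, P i -> (#|S i| <= d)%N) ->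
  Num.sqrt (\sum_(i | P i) a i ^+ 2) <=
    2 * 3 ^+ d * avg (fun w => `|\sum_(i | P i) a i * walsh (S i) w|).
Proof.
move=> Sinj Sd; pose f w := \sum_(i | P i) a i * walsh (S i) w.
rewrite -[avg _]/(avg (fun w => `|f w|)).
have [f2 f4] := @bonami I a #|[set: V]%SET| [set: V]%SET erefl d P S Sinj
  (fun i Pi => conj (finset.subsetT _) (Sd i Pi)).
rewrite -/f in f2 f4; set A := \sum_(i | P i) _ in f2 f4 *.
have A0 : 0 <= A by rewrite sumr_ge0// => i _; rewrite sqr_ge0.
have af0 : 0 <= avg (fun w => `|f w|) by apply: avg_ge0 => w.
have [->|An] := eqVneq A 0; first by rewrite sqrtr0 mulr_ge0// mulr_ge0// exprn_ge0.
have Ap : 0 < A by rewrite lt_neqAle eq_sym An.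
pose u : R := 3 ^+ d; pose t := Num.sqrt A.
have u0 : 0 < u by rewrite exprn_gt0.
have t0 : 0 < t by rewrite sqrtr_gt0.
have tA : t ^+ 2 = A by rewrite sqr_sqrtr.
have u9 : 9 ^+ d = u ^+ 2 :> R by rewrite -exprM mulnC exprM; congr (_ ^+ _); lra.
rewrite -/t -/u; rewrite u9 -tA in f4; rewrite -tA in f2.
pose s := u * t; have s0 : 0 < s by rewrite mulr_gt0.
have pt y := @quartic_le s y s0.
have := @ler_avg (fun w => s ^+ 2 * f w ^+ 2 + (- 4^-1) * f w ^+ 4) (fun w => s ^+ 3 * `|f w|) _.
rewrite avgD !avgZ f2 => /(_ _) h.
have {}h : s ^+ 2 * t ^+ 2 + (- 4^-1) * avg (fun w => f w ^+ 4) <= s ^+ 3 * avg (fun w => `|f w|).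
  apply: h => w; have := pt `|f w| (normr_ge0 _).
  by rewrite -[f w ^+ 4]ger0_norm ?exprn_even_ge0// normrX real_normK ?num_real//; lra.
have : 3 / 4 * (u ^+ 2 * t ^+ 4) <= s ^+ 3 * avg (fun w => `|f w|).
  apply: le_trans h; rewrite /s; move: f4; move: (avg _) => X hX; lra.
have -> : 3 / 4 * (u ^+ 2 * t ^+ 4) = (u ^+ 2 * t ^+ 3) * (3 / 4 * t) by ring.
have -> : s ^+ 3 * avg (fun w => `|f w|) = (u ^+ 2 * t ^+ 3) * (u * avg (fun w => `|f w|)).
  by rewrite /s; ring.
by rewrite ler_pM2l ?mulr_gt0 ?exprn_gt0//; lra.
Qed.

End Chaos.

(** * The finite estimate for forms on l_oo *)

Section LowerFinite.
Context {R : realType}.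
Local Notation C := R[i].

Lemma sum_cauchy_sqrt (I : finType) (P : pred I) (f g : I -> R) :
  \sum_(i | P i) f i * g i <=
  Num.sqrt (\sum_(i | P i) f i ^+ 2) * Num.sqrt (\sum_(i | P i) g i ^+ 2).
Proof.
rewrite -sqrtrM; last by apply: sumr_ge0 => i _; rewrite sqr_ge0.
apply: le_trans (ler_norm _) _; rewrite -sqrtr_sqr ler_sqrt ?sum_cauchy//.
by rewrite mulr_ge0// sumr_ge0// => i _; rewrite sqr_ge0.
Qed.

Lemma sqrtr_add_sqr_le (a b : R) : 0 <= a -> 0 <= b ->
  Num.sqrt (a + b) <= Num.sqrt a + Num.sqrt b.
Proof.
move=> a0 b0; have := @sqrtr_sum_le R bool (fun x => if x then a else b).
by rewrite !big_bool; apply; case.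
Qed.

Lemma normc_phase (z : C) : exists2 u : C, normc u <= 1 & u * z = ((normc z)%:C)%C.
Proof.
have [->|z0] := eqVneq z 0.
  by exists 0; [rewrite normc0|rewrite normc0 mulr0].
exists ((normc z)%:C%C / z); last by rewrite divfK.
rewrite normcM normcR normcV ger0_norm ?normc_ge0// divff//.
by apply/eqP => /eq0_normc/eqP; rewrite (negbTE z0).
Qed.

Lemma Re_sum (I : Type) (s : seq I) (P : pred I) (F : I -> C) :
  complex.Re (\sum_(i <- s | P i) F i) = \sum_(i <- s | P i) complex.Re (F i).
Proof. by elim/big_rec2: _ => // i a b _ <-; case: (F i) => ? ?; case: b. Qed.

Lemma Im_sum (I : Type) (s : seq I) (P : pred I) (F : I -> C) :
  complex.Im (\sum_(i <- s | P i) F i) = \sum_(i <- s | P i) complex.Im (F i).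
Proof. by elim/big_rec2: _ => // i a b _ <-; case: (F i) => ? ?; case: b. Qed.

Lemma mixed_l1_l2 m N (a : {ffun 'I_m -> 'I_N} -> C) (M : R) (p : 'I_m) :
  (forall x : 'I_m -> 'I_N -> C, (forall q j, normc (x q j) <= 1) ->
     normc (\sum_i a i * \prod_q x q (i q)) <= M) ->
  \sum_k Num.sqrt (\sum_(i : {ffun 'I_m -> 'I_N} | i p == k) normc (a i) ^+ 2) <= 4 * 3 ^+ m * M.
Proof.
move=> aM; pose V := ('I_m * 'I_N)%type.
(* One sign for each pair (argument, coordinate). On a fibre of i p, the set of pairs with q != p
   determines i, so distinct indices give distinct Walsh functions. *)
pose S (i : {ffun 'I_m -> 'I_N}) : {set V} := [set (q, i q) | q in [pred q | q != p]]%SET.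
have Sinj k : {in (fun i : {ffun 'I_m -> 'I_N} => i p == k) &, injective S}.
  move=> i j /eqP ik /eqP jk Sij; apply/ffunP => q.
  have [->|qp] := eqVneq q p; first by rewrite ik jk.
  have : (q, i q) \in S j by rewrite -Sij; apply/imsetP; exists q.
  by move=> /imsetP[q' _ [-> ->]].
have Sm i : (#|S i| <= m)%N.
  by rewrite (leq_trans (leq_imset_card _ _))// (leq_trans (max_card _))// card_ord.
pose f k (w : {ffun V -> bool}) : C :=
  \sum_(i : {ffun 'I_m -> 'I_N} | i p == k) a i * ((walsh (S i) w)%:C)%C.
have key k : Num.sqrt (\sum_(i : {ffun 'I_m -> 'I_N} | i p == k) normc (a i) ^+ 2)
    <= 4 * 3 ^+ m * avg (fun w => normc (f k w)).
  have -> : \sum_(i : {ffun 'I_m -> 'I_N} | i p == k) normc (a i) ^+ 2 =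
      \sum_(i : {ffun 'I_m -> 'I_N} | i p == k) complex.Re (a i) ^+ 2 +
      \sum_(i : {ffun 'I_m -> 'I_N} | i p == k) complex.Im (a i) ^+ 2.
    rewrite -big_split; apply: eq_bigr => i _; case: (a i) => u v /=.
    by rewrite sqr_sqrtr// addr_ge0 ?sqr_ge0.
  apply: le_trans (sqrtr_add_sqr_le _ _) _.
  - by apply: sumr_ge0 => i _; rewrite sqr_ge0.
  - by apply: sumr_ge0 => i _; rewrite sqr_ge0.
  have h1 := @chaos_l1_l2 R V _ (fun i => complex.Re (a i)) m _ S (Sinj k) (fun i _ => Sm i).
  have h2 := @chaos_l1_l2 R V _ (fun i => complex.Im (a i)) m _ S (Sinj k) (fun i _ => Sm i).
  apply: le_trans (lerD h1 h2) _; rewrite -mulrDr.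
  have -> : 4 * 3 ^+ m = 2 * 3 ^+ m * 2 :> R by lra.
  rewrite -[leRHS]mulrA ler_wpM2l ?mulr_ge0 ?exprn_ge0// mulr_natl mulr2n.
  apply: lerD; apply: ler_avg => w.
    apply: le_trans (normc_geRe _); rewrite Re_sum le_eqVlt; apply/orP; left.
    by apply/eqP; congr `|_|; apply: eq_bigr => i _; case: (a i) => u v /=; ring.
  apply: le_trans (normc_geIm _); rewrite Im_sum le_eqVlt; apply/orP; left.
  by apply/eqP; congr `|_|; apply: eq_bigr => i _; case: (a i) => u v /=; ring.
apply: le_trans (ler_sum _ (fun k _ => key k)) _.
rewrite -mulr_sumr ler_wpM2l ?mulr_ge0 ?exprn_ge0// -avg_sum -[leRHS](@avg_cst R V).
apply: ler_avg => w.
(* With the signs inserted in the other arguments, argument p receives the phases of the [f k w], so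
   that the form takes the value sum_k |f_k(w)|. *)
pose u k := projT1 (cid2 (normc_phase (f k w))).
have [u1 uf] : (forall k, normc (u k) <= 1) /\ (forall k, u k * f k w = ((normc (f k w))%:C)%C).
  by split=> k; rewrite /u; case: cid2.
pose x q j : C := if q == p then u j else ((sgn (w (q, j)))%:C)%C.
have x1 q j : normc (x q j) <= 1.
  by rewrite /x; case: ifP => // _; rewrite normcR sgn_norm.
apply: le_trans (aM x x1).
rewrite (partition_big (fun i : {ffun 'I_m -> 'I_N} => i p) xpredT)//=.
have fE k : \sum_(i : {ffun 'I_m -> 'I_N} | i p == k) a i * \prod_q x q (i q) = u k * f k w.
  rewrite mulr_sumr; apply: eq_bigr => i /eqP ik.
  rewrite mulrCA; congr (_ * _); rewrite (bigD1 p)//= {1}/x eqxx ik; congr (_ * _).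
  rewrite rmorph_prod /= big_imset /=; last by move=> q q' _ _ [].
  by apply: eq_bigr => q /negbTE qp; rewrite /x qp.
rewrite [X in _ <= normc X](eq_bigr _ (fun k _ => etrans (fE k) (uf k))).
rewrite -rmorph_sum normcR ger0_norm//.
by apply: sumr_ge0 => k _; rewrite normc_ge0.
Qed.

Lemma sum_max_split m N (F : {ffun 'I_m -> 'I_N} -> R) : (0 < m)%N ->
  (forall i, 0 <= F i) ->
  \sum_i F i <= \sum_(p < m) \sum_(i : {ffun 'I_m -> 'I_N} | [forall q, i q <= i p]%N) F i.
Proof.
move=> m0 F0; under [leRHS]eq_bigr do rewrite big_mkcond.
rewrite exchange_big; apply: ler_sum => i _.
have [p _ pmax] := @arg_maxnP _ (Ordinal m0) xpredT (fun q => i q : nat) erefl.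
rewrite (bigD1 p)//= ifT; last by apply/forallP => q; exact: pmax.
by rewrite lerDl sumr_ge0// => q _; case: ifP.
Qed.

(** Bernoulli: (1-x)^s (1 + sx) <= 1 at x = 1/(j+1). The 1/2 comes from 1/(1+y) <= 1 - y/2 for y in
    [0,1]. Telescoping then bounds sums of j^(s-1). *)
Lemma powR_diff_lower (j : nat) (s : R) : 0 < s <= 1 ->
  s / 2 * j.+1%:R `^ (s - 1) <= j.+1%:R `^ s - j%:R `^ s.
Proof.
move=> /andP[s0 s1].
have j0 : 0 < j.+1%:R :> R by rewrite ltr0n.
have e1 : j.+1%:R `^ (s - 1) = j.+1%:R `^ s / j.+1%:R :> R.
  by rewrite powRB ?powRr1 ?(ltW j0)// (gt_eqF j0) implybT.
have P0 : 0 < j.+1%:R `^ s :> R by rewrite powR_gt0.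
case: j j0 e1 P0 => [|j] j0 e1 P0.
  by rewrite !mulr1n mulr0n !powR1 powR0 ?gt_eqF//; lra.
have j0' : 0 < j.+1%:R :> R by rewrite ltr0n.
set x : R := j.+2%:R^-1.
have x0 : 0 < x by rewrite invr_gt0.
have jx : j.+1%:R = j.+2%:R * (1 - x) :> R.
  by rewrite /x mulrBr mulr1 divff ?gt_eqF// -[j.+2%:R]natr1 addrK.
have x1 : x <= 2^-1 by rewrite lef_pV2 ?posrE// ler_nat.
have e2 : j.+1%:R `^ s = j.+2%:R `^ s * (1 - x) `^ s :> R.
  by rewrite jx powRM ?(ltW j0)//; lra.
have h : (1 - x) `^ s * (1 + s * x) <= 1.
  have l : ln (1 - x) <= - x by apply: le_ln1Dx; lra.
  rewrite /powR gt_eqF; last by lra.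
  have g := expR_ge1Dx (- (s * ln (1 - x))).
  have := expR_gt0 (s * ln (1 - x)).
  have e : expR (s * ln (1 - x)) * expR (- (s * ln (1 - x))) = 1 by rewrite -expRD subrr expR0.
  move: (expR _) (expR (- _)) e g => X Y e g X0.
  by rewrite -e ler_pM2l// (le_trans _ g)//; nra.
rewrite e1 e2 -/x.
have X0 : 0 <= (1 - x) `^ s by rewrite powR_ge0.
move: ((1 - x) `^ s) h X0 => X h X0.
have hX : X <= 1 - s / 2 * x.
  have sx : 0 < s * x by rewrite mulr_gt0.
  have sx1 : s * x <= 1 by nra.
  have sx2 : 0 < 1 + s * x by lra.
  by rewrite -(ler_pM2r sx2) (le_trans h)//; nra.
have {}hX := ler_wpM2l (ltW P0) hX.
by move: (_ `^ s) hX => P hX; lra.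
Qed.

Lemma sum_powR_le K (s : R) : 0 < s <= 1 ->
  \sum_(j < K) j.+1%:R `^ (s - 1) <= 2 / s * K%:R `^ s.
Proof.
move=> s01; have /andP[s0 _] := s01.
rewrite mulrAC ler_pdivlMr// mulr_suml.
elim: K => [|K IH]; first by rewrite big_ord0 mulr_ge0 ?powR_ge0.
by rewrite big_ord_recr /=; have := powR_diff_lower K s01; lra.
Qed.

Lemma zeta_le (g : R) : 1 < g -> exists2 c : R, 0 < c &
  forall N, \sum_(j < N) j.+1%:R `^ (- g) <= c.
Proof.
move=> g1; pose s := g - 1; have s0 : 0 < s by rewrite subr_gt0.
have i0 : 0 < s^-1 by rewrite invr_gt0.
exists (1 + s^-1); first lra.
suff h N : \sum_(j < N.+1) j.+1%:R `^ (- g) <= 1 + s^-1 - s^-1 * N.+1%:R `^ (- s).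
  case=> [|N]; first by rewrite big_ord0; lra.
  by apply: le_trans (h N) _; rewrite gerBl mulr_ge0 ?powR_ge0// ltW.
elim: N => [|N IH].
  by rewrite big_ord1 !mulr1n !powR1; lra.
rewrite big_ord_recr /=.
suff : N.+2%:R `^ (- g) <= s^-1 * N.+1%:R `^ (- s) - s^-1 * N.+2%:R `^ (- s) by lra.
have n1 : 0 < N.+1%:R :> R by rewrite ltr0n.
have n2 : 0 < N.+2%:R :> R by rewrite ltr0n.
have -> : - g = - s - 1 by rewrite /s; lra.
rewrite powRB; last by rewrite (gt_eqF n2) implybT.
rewrite powRr1 ?(ltW n2)//.
set x : R := N.+2%:R^-1.
have x0 : 0 < x by rewrite invr_gt0.
have jx : N.+1%:R = N.+2%:R * (1 - x) :> R.
  by rewrite /x mulrBr mulr1 divff ?gt_eqF// -[N.+2%:R]natr1 addrK.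
have x1 : x <= 2^-1 by rewrite lef_pV2 ?posrE// ler_nat.
rewrite jx powRM ?(ltW n2)//; last by lra.
have h : 1 + s * x <= (1 - x) `^ (- s).
  have l : ln (1 - x) <= - x by apply: le_ln1Dx; lra.
  rewrite /powR gt_eqF; last by lra.
  by apply: le_trans (expR_ge1Dx _); nra.
have P0 : 0 < N.+2%:R `^ (- s) :> R by rewrite powR_gt0.
move: (_ `^ (- s)) ((1 - x) `^ (- s)) P0 h => P X P0 h.
rewrite -(ler_pM2l s0) mulrBr !mulrA divff ?gt_eqF// !mul1r; nra.
Qed.

(** The exponent (m-1)/(2m) is critical: after Cauchy-Schwarz on a fibre, the weight factor is
    bounded uniformly in k, with no decay to spare. *)
Lemma lower_infty_finite m : (1 < m)%N -> exists2 c : R, 0 < c &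
  forall N (a : {ffun 'I_m -> 'I_N} -> C) (M W : R) (w : 'I_N -> R), 0 <= W ->
  (forall x : 'I_m -> 'I_N -> C, (forall q j, normc (x q j) <= 1) ->
     normc (\sum_i a i * \prod_q x q (i q)) <= M) ->
  (forall k, 0 <= w k <= W * k.+1%:R `^ (- (m.-1%:R / (2 * m)%:R))) ->
  \sum_i normc (a i) * \prod_q w (i q) <= c * M * W ^+ m.
Proof.
move=> m1; have m0 : (0 < m)%N by exact: ltnW.
have m0' : 0 < m%:R :> R by rewrite ltr0n.
pose s : R := m%:R^-1.
have s01 : 0 < s <= 1 by rewrite invr_gt0 m0' invf_le1// ler1n.
have bs : - (m.-1%:R / (2 * m)%:R) + - (m.-1%:R / (2 * m)%:R) = s - 1 :> R.
  have -> : m.-1%:R = m%:R - 1 :> R by rewrite -{2}(prednK m0) -natr1 addrK.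
  by rewrite /s natrM; field; rewrite gt_eqF.
pose B : R := (2 / s) ^+ m.-1.
have B0 : 0 <= B by rewrite exprn_ge0// divr_ge0//; case/andP: s01 => /ltW.
exists (m%:R * (4 * 3 ^+ m) * (1 + Num.sqrt B)).
  by rewrite !mulr_gt0 ?exprn_gt0// ltr_pwDl ?sqrtr_ge0.
move=> N a M W w W0 aM wW.
have w0 k : 0 <= w k by have /andP[] := wW k.
have M0 : 0 <= M.
  by apply: le_trans (aM (fun _ _ => 0) _); rewrite ?normc_ge0// => *; rewrite normc0.
apply: le_trans (sum_max_split m0 _) _ => [i|].
  by rewrite mulr_ge0 ?normc_ge0// prodr_ge0.
have -> : m%:R * (4 * 3 ^+ m) * (1 + Num.sqrt B) * M * W ^+ m =
    \sum_(p < m) 4 * 3 ^+ m * M * ((1 + Num.sqrt B) * W ^+ m).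
  by rewrite sumr_const card_ord -[RHS]mulr_natl; ring.
apply: ler_sum => p _.
rewrite (partition_big (fun i : {ffun 'I_m -> 'I_N} => i p) xpredT)//=.
have BW : 0 <= (1 + Num.sqrt B) * W ^+ m.
  by rewrite mulr_ge0 ?exprn_ge0// addr_ge0 ?sqrtr_ge0.
apply: le_trans (ler_wpM2r BW (mixed_l1_l2 p aM)).
rewrite mulr_suml; apply: ler_sum => k _.
apply: le_trans (sum_cauchy_sqrt _ _ _) _.
apply: ler_pM; rewrite ?sqrtr_ge0//.
  rewrite ler_sqrt; last by apply: sumr_ge0 => i _; rewrite sqr_ge0.
  rewrite [leRHS](bigID (fun i : {ffun 'I_m -> 'I_N} => [forall q, i q <= i p]%N)) /=.
  rewrite [X in X + _](eq_bigl (fun i : {ffun 'I_m -> 'I_N} => [forall q, (i q <= i p)%N] && (i p == k))); last first.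
    by move=> i; rewrite andbC.
  by rewrite lerDl sumr_ge0// => i _; rewrite sqr_ge0.
(* The index p is pinned to k and the others range up to k, so the sum of squared weights over the
   fibre is a product of one-variable sums. *)
pose Q q (j : 'I_N) := if q == p then j == k else (j <= k)%N.
have sQ : \sum_(i : {ffun 'I_m -> 'I_N} | [forall q, (i q <= i p)%N] && (i p == k))
    (\prod_q w (i q)) ^+ 2 = \prod_q \sum_(j | Q q j) w j ^+ 2.
  rewrite bigA_distr_big_dep; apply: eq_big => [i|i _]; last by rewrite prodrXl.
  apply/andP/familyP => [[/forallP h /eqP ik] q|h].
    by rewrite unfold_in /Q; case: ifP => [/eqP->|_]; rewrite ?ik// -ik h.
  have ik : i p = k by have := h p; rewrite unfold_in /Q eqxx => /eqP.
  split; last exact/eqP.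
  apply/forallP => q; have := h q; rewrite unfold_in /Q ik; case: ifP => // _ /eqP->.
  exact: leqnn.
have wk : w k ^+ 2 <= W ^+ 2 * k.+1%:R `^ (s - 1).
  have /andP[_ h] := wW k.
  apply: le_trans (lerXn2r 2 _ _ h) _; rewrite ?nnegrE ?mulr_ge0 ?powR_ge0//.
  by rewrite exprMn [X in _ * X]expr2 -powRD ?bs// (gt_eqF (ltr0Sn _ _)) implybT.
rewrite sQ (bigD1 p)//= /Q eqxx big_pred1_eq.
have kk : 0 < k.+1%:R :> R by rewrite ltr0n.
have sk : \sum_(j : 'I_N | (j <= k)%N) w j ^+ 2 <= W ^+ 2 * (2 / s * k.+1%:R `^ s).
  apply: (@le_trans _ _ (\sum_(j : 'I_N | (j <= k)%N) W ^+ 2 * j.+1%:R `^ (s - 1))).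
    apply: ler_sum => j _; have /andP[_ h] := wW j.
    apply: le_trans (lerXn2r 2 _ _ h) _; rewrite ?nnegrE ?mulr_ge0 ?powR_ge0//.
    by rewrite exprMn [X in _ * X]expr2 -powRD ?bs// (gt_eqF (ltr0Sn _ _)) implybT.
  rewrite -mulr_sumr ler_wpM2l ?sqr_ge0//.
  apply: le_trans (sum_powR_le _ s01).
  by rewrite -(big_ord_widen N (fun j => j.+1%:R `^ (s - 1)) (ltn_ord k)) /=.
have pq : \prod_(q | q != p) \sum_(j | if q == p then j == k else (j <= k)%N) w j ^+ 2
    <= (W ^+ 2 * (2 / s * k.+1%:R `^ s)) ^+ m.-1.
  apply: (@le_trans _ _ (\prod_(q < m | q != p) (W ^+ 2 * (2 / s * k.+1%:R `^ s)))).
    apply: ler_prod => q /negbTE ->; rewrite sk andbT.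
    by apply: sumr_ge0 => j _; rewrite sqr_ge0.
  by rewrite prodr_const cardC1 card_ord.
apply: (@le_trans _ _ (Num.sqrt (B * (W ^+ m) ^+ 2))); last first.
  rewrite sqrtrM// sqrtr_sqr ger0_norm ?exprn_ge0// ler_wpM2r ?exprn_ge0//.
  by rewrite lerDr.
rewrite ler_sqrt ?mulr_ge0 ?exprn_ge0//.
apply: le_trans (ler_pM (sqr_ge0 _) _ wk pq) _.
  by rewrite prodr_ge0// => q _; apply: sumr_ge0 => j _; rewrite sqr_ge0.
rewrite le_eqVlt; apply/orP; left; apply/eqP.
(* As s = 1/m, the pinned index contributes k^(s-1) = k^(-s(m-1)), which cancels the growth k^s of
   the m - 1 free sums. *)
have -> : k.+1%:R `^ (s - 1) = (k.+1%:R `^ (- s)) ^+ m.-1 :> R.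
  rewrite -[RHS]powR_mulrn ?powR_ge0// -powRrM; congr (_ `^ _).
  have -> : m.-1%:R = m%:R - 1 :> R by rewrite -{2}(prednK m0) -natr1 addrK.
  by rewrite /s; field; rewrite gt_eqF.
rewrite [(W ^+ 2 * _) ^+ _]exprMn [(2 / s * _) ^+ _]exprMn -/B.
have -> : (W ^+ m) ^+ 2 = W ^+ 2 * (W ^+ 2) ^+ m.-1.
  by rewrite -exprS prednK// -!exprM mulnC.
have e1 : (k.+1%:R `^ (- s)) ^+ m.-1 * (k.+1%:R `^ s) ^+ m.-1 = 1 :> R.
  by rewrite -exprMn -powRD ?addNr ?powRr0 ?expr1n// (gt_eqF kk) implybT.
transitivity (B * (W ^+ 2 * (W ^+ 2) ^+ m.-1) *
  ((k.+1%:R `^ (- s)) ^+ m.-1 * (k.+1%:R `^ s) ^+ m.-1)); first by ring.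
by rewrite e1 mulr1.
by rewrite divr_ge0//; case/andP: s01 => /ltW.
Qed.

End LowerFinite.

(** * The finite estimate for forms on l_r, from their slices *)

Section LowerGeneral.
Context {R : realType}.
Local Notation C := R[i].

Definition upd m N (i : {ffun 'I_m -> 'I_N}) (p : 'I_m) (k : 'I_N) : {ffun 'I_m -> 'I_N} :=
  [ffun q => if q == p then k else i q].

(** Sums over one coordinate with the others fixed are handled without a type of (m-1)-tuples:
    coordinate p is overwritten by k, and its own N values are counted by the factor N. *)
Lemma sum_upd (A : pzRingType) m N (p : 'I_m) (F : {ffun 'I_m -> 'I_N} -> A) :
  \sum_i \sum_k F (upd i p k) = N%:R * \sum_i F i.
Proof.
rewrite exchange_big /= [in RHS](partition_big (fun i : {ffun 'I_m -> 'I_N} => i p) xpredT)//= mulr_sumr.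
apply: eq_bigr => k _.
rewrite (partition_big (fun i : {ffun 'I_m -> 'I_N} => i p) xpredT)//=.
have -> : N%:R * \sum_(i : {ffun 'I_m -> 'I_N} | i p == k) F i =
    \sum_(j < N) \sum_(i : {ffun 'I_m -> 'I_N} | i p == k) F i.
  by rewrite sumr_const card_ord mulr_natl.
apply: eq_bigr => j _.
rewrite (reindex_onto (fun i => upd i p j) (fun i => upd i p k)) /=; last first.
  move=> i /eqP ij; apply/ffunP => q; rewrite !ffunE; case: eqP => // ->.
  by rewrite ij.
apply: eq_big => [i|i /andP[_ /eqP ij]].
  rewrite ffunE eqxx eqxx /=; apply/eqP/eqP => [<-|ik]; first by rewrite ffunE eqxx.
  by apply/ffunP => q; rewrite !ffunE; case: eqP => // ->.
by rewrite ij.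
Qed.

(* [tau] pays for the summation over the largest index [i p], and [sigma]
   redistributes the rest of its decay to the other indices. *)
Lemma lower_finite m (r beta tau sigma : R) : (1 < m)%N -> 0 < r ->
  0 < tau -> 0 <= sigma -> beta = r^-1 + tau + m.-1%:R * sigma -> 1 < beta + sigma ->
  exists2 c : R, 0 < c &
  forall N (a : {ffun 'I_m -> 'I_N} -> R) (M W : R) (w : 'I_N -> R),
  0 <= W -> 0 <= M -> (forall i, 0 <= a i) ->
  (forall (p : 'I_m) (i : {ffun 'I_m -> 'I_N}) (v : 'I_N -> R), (forall k, 0 <= v k) ->
     \sum_k a (upd i p k) * v k <= M * (\sum_k v k `^ r) `^ r^-1) ->
  (forall k, 0 <= w k <= W * k.+1%:R `^ (- beta)) ->
  \sum_i a i * \prod_q w (i q) <= c * M * W ^+ m.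
Proof.
move=> m1 r0 tau0 sigma0 betaE bs1; have m0 : (0 < m)%N by exact: ltnW.
have [c1 c10 Hc1] : exists2 c : R, 0 < c &
    forall N, \sum_(j < N) j.+1%:R `^ (- (r * (r^-1 + tau))) <= c.
  by apply: zeta_le; rewrite mulrDr divff ?gt_eqF// ltrDl mulr_gt0.
have [c2 c20 Hc2] := zeta_le bs1.
have m0' : 0 < m%:R :> R by rewrite ltr0n.
exists (m%:R * (c1 `^ r^-1 * c2 ^+ m.-1)).
  by rewrite !mulr_gt0 ?exprn_gt0 ?powR_gt0.
move=> N a M W w W0 M0 a0 aM wW.
have w0 k : 0 <= w k by have /andP[] := wW k.
have [N0|N0] := posnP N.
  rewrite big1 ?mulr_ge0 ?exprn_ge0 ?powR_ge0 ?(ltW c20)// => i _.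
  by case: (i (Ordinal m0)) => k kN; exfalso; rewrite N0 ltn0 in kN.
have N0' : 0 < N%:R :> R by rewrite ltr0n.
apply: le_trans (sum_max_split m0 _) _ => [i|]; first by rewrite mulr_ge0// prodr_ge0.
have -> : m%:R * (c1 `^ r^-1 * c2 ^+ m.-1) * M * W ^+ m =
    \sum_(p < m) c1 `^ r^-1 * c2 ^+ m.-1 * M * W ^+ m.
  by rewrite sumr_const card_ord -[RHS]mulr_natl; ring.
apply: ler_sum => p _.
pose v (k : 'I_N) : R := k.+1%:R `^ (- (r^-1 + tau)).
pose g (k : 'I_N) : R := k.+1%:R `^ (- (beta + sigma)).
pose G (i : {ffun 'I_m -> 'I_N}) := \prod_(q | q != p) g (i q).
have G0 i : 0 <= G i by rewrite prodr_ge0// => q _; rewrite powR_ge0.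
apply: (@le_trans _ _ (\sum_(i : {ffun 'I_m -> 'I_N}) a i * (v (i p) * G i) * W ^+ m)).
  rewrite [leRHS](bigID (fun i : {ffun 'I_m -> 'I_N} => [forall q, i q <= i p]%N)) /=.
  rewrite -[leLHS]addr0; apply: lerD; last first.
    by apply: sumr_ge0 => i _; rewrite !mulr_ge0 ?exprn_ge0 ?powR_ge0 ?G0.
  apply: ler_sum => i /forallP imax; rewrite -mulrA ler_wpM2l//.
  apply: (@le_trans _ _ (\prod_q (W * (i q).+1%:R `^ (- beta)))).
    by apply: ler_prod => q _; exact: wW.
  rewrite big_split /= prodr_const card_ord mulrC ler_wpM2r ?exprn_ge0//.
  rewrite (bigD1 p)//=.
  have ip : 0 < (i p).+1%:R :> R by rewrite ltr0n.
  have -> : (i p).+1%:R `^ (- beta) = v (i p) * \prod_(q < m | q != p) (i p).+1%:R `^ (- sigma) :> R.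
    rewrite prodr_const cardC1 card_ord -[X in _ = _ * X]powR_mulrn ?powR_ge0// -powRrM.
    rewrite /v -powRD; last by rewrite (gt_eqF ip) implybT.
    by congr (_ `^ _); rewrite betaE; ring.
  rewrite -mulrA ler_wpM2l ?powR_ge0// -big_split /=.
  apply: ler_prod => q _; rewrite mulr_ge0 ?powR_ge0//=.
  have iq : 0 < (i q).+1%:R :> R by rewrite ltr0n.
  rewrite /g opprD powRD; last by rewrite (gt_eqF iq) implybT.
  rewrite mulrC ler_wpM2l ?powR_ge0// !powRN lef_pV2 ?posrE ?powR_gt0//.
  by rewrite ge0_ler_powR ?nnegrE// ler_nat ltnS imax.
rewrite -mulr_suml ler_wpM2r ?exprn_ge0//.
(* With the restriction to the maximal index gone, the p-th coordinate can be summed freely; this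
   inner sum is bounded by the slice hypothesis. *)
rewrite -(ler_pM2l N0') -(@sum_upd R m N p).
have GU i k : G (upd i p k) = G i.
  by apply: eq_bigr => q /negbTE qp; rewrite ffunE qp.
have vE : (\sum_k v k `^ r) `^ r^-1 <= c1 `^ r^-1.
  have s0 : 0 <= \sum_k v k `^ r by apply: sumr_ge0 => k _; rewrite powR_ge0.
  rewrite ge0_ler_powR ?nnegrE ?invr_ge0 ?(ltW r0) ?(ltW c10)//.
  apply: le_trans (Hc1 N); apply: ler_sum => k _.
  by rewrite -powRrM mulNr mulrC.
apply: (@le_trans _ _ (\sum_(i : {ffun 'I_m -> 'I_N}) M * c1 `^ r^-1 * G i)).
  apply: ler_sum => i _.
  under eq_bigr do rewrite GU ffunE eqxx mulrA.
  rewrite -mulr_suml ler_wpM2r//.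
  apply: le_trans (aM p i v _) _ => [k|]; first by rewrite powR_ge0.
  by rewrite ler_wpM2l.
rewrite -mulr_sumr.
have -> : \sum_i G i = \prod_q \sum_k (if q == p then 1 else g k).
  rewrite bigA_distr_bigA; apply: eq_bigr => i _.
  rewrite [RHS](bigD1 p)//= eqxx mul1r; apply: eq_bigr => q /negbTE->.
  by [].
rewrite (bigD1 p)//= eqxx sumr_const card_ord.
have : \prod_(q < m | q != p) \sum_k (if q == p then 1 else g k) <= c2 ^+ m.-1.
  apply: (@le_trans _ _ (\prod_(q < m | q != p) c2)).
    apply: ler_prod => q /negbTE->; rewrite Hc2 andbT.
    by apply: sumr_ge0 => k _; rewrite powR_ge0.
  by rewrite prodr_const cardC1 card_ord.
have P0 : 0 <= M * c1 `^ r^-1 by rewrite mulr_ge0 ?powR_ge0.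
set X := \prod_(q < m | _) _ => hX.
rewrite mulrCA ler_pM2l//.
have -> : c1 `^ r^-1 * c2 ^+ m.-1 * M = M * c1 `^ r^-1 * c2 ^+ m.-1 by ring.
by rewrite ler_wpM2l.
Qed.

End LowerGeneral.

(** * Sequence spaces and coefficients *)

Section SequenceNorm.
Context {R : realType}.
Local Notation C := R[i].

(** Partial sums of p-th powers stay in R and avoid roots, which suits finite estimates; [lnormP]
    relates this to [lnorm]. *)
Definition nle (r : \bar R) (x : nat -> C) (t : R) : Prop :=
  if r is p%:E%E then forall N, \sum_(k < N) normc (x k) `^ p <= t `^ p
  else forall k, normc (x k) <= t.

Lemma lnormP (r : \bar R) (x : nat -> C) (t : R) : (0 < r)%E -> 0 <= t ->
  (lnorm r x <= t%:E)%E <-> nle r x t.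
Proof.
move=> r0 t0; case: r r0 => [p p0|_|//]; rewrite /lnorm /nle.
  rewrite lte_fin in p0; have pn0 : p != 0 by rewrite gt_eqF.
  rewrite Lnorm_counting//.
  under eq_eseriesr do rewrite abse_EFin ger0_norm ?normc_ge0// poweR_EFin.
  set S := (\sum_(k <oo) _)%E.
  have S0 : (0 <= S)%E by apply: nneseries_ge0 => k _ _; rewrite lee_fin powR_ge0.
  have St : (S `^ p^-1 <= t%:E)%E <-> (S <= (t `^ p)%:E)%E.
    have tE : (t%:E = (t `^ p)%:E `^ p^-1)%E.
      by rewrite poweR_EFin -powRrM divff// powRr1.
    have p'0 : 0 <= p^-1 by rewrite invr_ge0 ltW.
    split=> h; last first.
      rewrite tE; apply: gt0_ler_poweR => //; rewrite in_itv/= leey andbT//.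
      by rewrite lee_fin powR_ge0.
    have -> : S = ((S `^ p^-1) `^ p)%E by rewrite -poweRrM mulVf// poweRe1.
    rewrite -poweR_EFin; apply: gt0_ler_poweR => //; rewrite ?(ltW p0)// in_itv/= leey andbT//.
    exact: poweR_ge0.
  apply: (iff_trans St); split=> [h N|h].
    rewrite -lee_fin -sumEFin (le_trans _ h)//.
    rewrite -(big_mkord xpredT (fun k => (normc (x k) `^ p)%:E)).
    by apply: nneseries_lim_ge => k _ _; rewrite lee_fin powR_ge0.
  apply: lime_le.
    by apply: is_cvg_nneseries => k _ _; rewrite lee_fin powR_ge0.
  near=> N; rewrite big_mkord sumEFin lee_fin; exact: h.
rewrite unlock /= ifT; last first.
  by rewrite /counting; case: asboolP => // /infinite_nat.
split=> [/ess_supP h k|h]; last first.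
  apply/ess_supP/aeW => k /=; rewrite lee_fin ger0_norm ?normc_ge0//; exact: h.
(* Only the empty set is null for the counting measure, so the essential bound holds at every
   index. *)
case: h => A [_ A0 hA].
rewrite leNgt; apply/negP => tk.
have : A k.
  apply: (hA k) => /= hk; move: tk; rewrite ltNge => /negP h; apply: h.
  by move: hk; rewrite lee_fin ger0_norm ?normc_ge0.
have Afin : finite_set A.
  by apply: contrapT => nf; move: A0; rewrite /= /counting asboolF.
move: A0; rewrite /= /counting asboolT// => A0; have /= /eqP := congr1 fine A0.
rewrite pnatr_eq0 size_eq0 => /eqP {}A0 Ak.
have : k \in fset_set A by rewrite in_fset_set// inE.
by rewrite -[_ \in _]/(k \in finmap.enum_fset (fset_set A)) A0.
Unshelve. all: by end_near.
Qed.

Lemma lspaceP (r : \bar R) (x : nat -> C) : (0 < r)%E ->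
  lspace r x <-> exists2 t : R, 0 <= t & nle r x t.
Proof.
move=> r0; have l0 : (0 <= lnorm r x)%E by exact: Lnorm_ge0.
split=> [xr|[t t0 /(lnormP x r0 t0) h]]; last exact: le_lt_trans h (ltry _).
exists (fine (lnorm r x)); first exact: fine_ge0.
apply/lnormP => //; first exact: fine_ge0.
by rewrite fineK// ge0_fin_numE.
Qed.

Lemma nle_lnorm (r : \bar R) (x : nat -> C) : (0 < r)%E -> lspace r x ->
  0 <= fine (lnorm r x) /\ nle r x (fine (lnorm r x)).
Proof.
move=> r0 xr; have l0 : (0 <= lnorm r x)%E by exact: Lnorm_ge0.
split; first exact: fine_ge0.
by apply/lnormP; rewrite ?fine_ge0// fineK// ge0_fin_numE.
Qed.

Lemma lnorm_le (r : \bar R) (x : nat -> C) (t : R) : (0 < r)%E -> 0 <= t ->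
  nle r x t -> lspace r x /\ fine (lnorm r x) <= t.
Proof.
move=> r0 t0 h; have xr : lspace r x by apply/lspaceP => //; exists t.
split=> //; have l0 : (0 <= lnorm r x)%E by exact: Lnorm_ge0.
by rewrite -lee_fin fineK ?ge0_fin_numE//; apply/lnormP.
Qed.

Lemma nle_mul (r : \bar R) (x y : nat -> C) (s t : R) : (0 < r)%E -> 0 <= s -> 0 <= t ->
  (forall k, normc (x k) <= s) -> nle r y t -> nle r (fun k => x k * y k) (s * t).
Proof.
move=> r0 s0 t0 xs; case: r r0 => [p p0|_|//]; rewrite /nle => yt; last first.
  by move=> k; rewrite normcM ler_pM ?normc_ge0.
rewrite lte_fin in p0.
move=> N; rewrite powRM//; apply: le_trans (ler_wpM2l (powR_ge0 _ _) (yt N)).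
rewrite mulr_sumr; apply: ler_sum => k _.
by rewrite -powRM ?normc_ge0// ge0_ler_powR ?nnegrE ?normc_ge0 ?mulr_ge0 ?normc_ge0 ?(ltW p0)// normcM ler_wpM2r ?normc_ge0.
Qed.

Lemma nle_restrict (r : \bar R) (x : nat -> C) (t : R) n (e : 'I_n -> nat) :
  (0 < r)%E -> injective e -> nle r x t -> nrm_le r (fun j => x (e j)) t.
Proof.
move=> r0 einj; case: r r0 => [p p0|_|//]; rewrite /nle /nrm_le; last by move=> h j.
move=> h; pose N := (\max_j e j).+1; apply: le_trans (h N).
have eN j : (e j < N)%N by rewrite ltnS; exact: leq_bigmax.
pose e' j := Ordinal (eN j).
have e'inj : injective e' by move=> i j [] /einj.
rewrite -(big_imset (fun k : 'I_N => normc (x k) `^ p) (h := e') (A := predT)) /=; last by move=> ? ? _ _ /e'inj.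
rewrite [leRHS](bigID [in [set e' x | x in predT]%SET]) /= lerDl.
by apply: sumr_ge0 => k _; rewrite powR_ge0.
Qed.

Definition fins N (x : nat -> C) : nat -> C := fun k => if (k < N)%N then x k else 0.

Lemma nle_fins (r : \bar R) N (x : nat -> C) (t : R) : (0 < r)%E -> 0 <= t ->
  nrm_le r (fun j : 'I_N => x j) t -> nle r (fins N x) t.
Proof.
move=> r0 t0; case: r r0 => [p p0|_|//]; rewrite /nle /nrm_le; last first.
  move=> h k; rewrite /fins; case: ifP => kN; last by rewrite normc0.
  exact: (h (Ordinal kN)).
rewrite lte_fin in p0; move=> h M; apply: le_trans h.
have [NM|NM] := leqP N M.
  rewrite [leRHS](big_ord_widen M (fun j => normc (x j) `^ p) NM) [leRHS]big_mkcond /=.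
  apply: ler_sum => k _; rewrite /fins; case: ifP => // _.
  by rewrite normc0 powR0// gt_eqF.
rewrite [leLHS](big_ord_widen N (fun j => normc (fins N x j) `^ p) (ltnW NM)) [leLHS]big_mkcond /=.
apply: ler_sum => k _; rewrite /fins ltn_ord; case: ifP => // _.
exact: powR_ge0.
Qed.

Lemma fins_lspace (r : \bar R) N (x : nat -> C) : (0 < r)%E -> lspace r (fins N x).
Proof.
move=> r0; apply/lspaceP => //; case: r r0 => [p p0|_|//].
  rewrite lte_fin in p0; pose S := \sum_(j < N) normc (x j) `^ p.
  have S0 : 0 <= S by apply: sumr_ge0 => j _; rewrite powR_ge0.
  exists (S `^ p^-1); first exact: powR_ge0.
  apply: nle_fins; rewrite ?lte_fin ?powR_ge0// /nrm_le.
  by rewrite -powRrM mulVf ?gt_eqF// powRr1.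
exists (\sum_(j < N) normc (x j)).
  by apply: sumr_ge0 => j _; rewrite normc_ge0.
apply: nle_fins => //; first by apply: sumr_ge0 => j _; rewrite normc_ge0.
by move=> j; rewrite (bigD1 j)//= lerDl sumr_ge0// => k _; rewrite normc_ge0.
Qed.

End SequenceNorm.

(** * Multilinear expansion and monomial coefficients *)

Section Multilinear.
Context {R : realType}.
Local Notation C := R[i].

Definition ebase (k : nat) : nat -> C := fun j => (j == k)%:R.

Definition setarg m (x : 'I_m -> nat -> C) (p : 'I_m) (u : nat -> C) : 'I_m -> nat -> C :=
  fun q => if q == p then u else x q.

Section Expansion.
Context (m : nat) (r : \bar R) (L : ('I_m -> nat -> C) -> C).
Context (r0 : (0 < r)%E) (Lm : multilinear_on r L).

Lemma ebase_lspace k : lspace r (ebase k).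
Proof.
have -> : ebase k = fins k.+1 (ebase k); last exact: fins_lspace.
apply/funext => j; rewrite /fins /ebase; case: ltnP => // kj.
by rewrite gtn_eqF.
Qed.

Lemma mlinE x p (a : C) u v : (forall q, lspace r (x q)) -> lspace r u -> lspace r v ->
  L (setarg x p (fun k => a * u k + v k)) = a * L (setarg x p u) + L (setarg x p v).
Proof. exact: Lm. Qed.

Lemma mlin0 x p : (forall q, lspace r (x q)) -> L (setarg x p (fun=> 0)) = 0.
Proof.
move=> xr; have z0 : lspace r (fun=> 0 : C).
  have -> : (fun=> 0 : C) = fins 0 (fun=> 0) by apply/funext => j.
  exact: fins_lspace.
have := @mlinE x p (-1) _ _ xr z0 z0.
have -> : (fun k : nat => -1 * (0 : C) + 0) = (fun=> 0) by apply/funext => j; rewrite mulr0 addr0.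
by rewrite mulN1r addNr.
Qed.

Lemma mlin_sum x p N y : (forall q, lspace r (x q)) ->
  L (setarg x p (fins N y)) = \sum_(k < N) y k * L (setarg x p (ebase k)).
Proof.
move=> xr; elim: N => [|N IH].
  rewrite big_ord0; have -> : fins 0 y = (fun=> 0) by apply/funext => j.
  exact: mlin0.
rewrite big_ord_recr /= -IH addrC -mlinE//; try exact: ebase_lspace; try exact: fins_lspace.
congr (L (setarg x p _)); apply/funext => j; rewrite /fins /ebase ltnS leq_eqVlt.
by case: eqP => [->|_]; rewrite ?ltnn ?mulr1 ?mulr0 ?addr0 ?add0r.
Qed.

Lemma expansion N (X : 'I_m -> nat -> C) : (0 < N)%N ->
  L (fun q => fins N (X q)) =
  \sum_(i : {ffun 'I_m -> 'I_N}) L (fun q => ebase (i q)) * \prod_q X q (i q).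
Proof.
move=> N0; pose Y (s : seq 'I_m) (i : {ffun 'I_m -> 'I_N}) : 'I_m -> nat -> C :=
  fun q => if q \in s then ebase (i q) else fins N (X q).
have NC : (N%:R : C) != 0 by rewrite pnatr_eq0 -lt0n.
(* The arguments in s are expanded, those outside are not. A coordinate of i outside s is idle and
   counts N times, so N^|s| on the left equalises the total to N^m. *)
have claim s : uniq s -> N%:R ^+ size s *
    (\sum_(i : {ffun 'I_m -> 'I_N}) L (Y s i) * \prod_(q <- s) X q (i q)) =
    N%:R ^+ m * L (fun q => fins N (X q)).
  elim: s => [_|p s IH /= /andP[ps us]].
    rewrite mul1r (eq_bigr (fun=> L (fun q => fins N (X q)))); last first.
      by move=> i _; rewrite big_nil mulr1.
    by rewrite sumr_const card_ffun !card_ord -[LHS]mulr_natl natrX.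
  rewrite -IH// exprSr -mulrA -(@sum_upd C m N p); congr (_ * _).
  apply: eq_bigr => i _.
  have YE k : Y (p :: s) (upd i p k) = setarg (Y s i) p (ebase k).
    apply/funext => q; rewrite /Y /setarg inE ffunE.
    by case: eqP => //= qp; case: ifP.
  transitivity (\sum_(k < N) (X p k * L (setarg (Y s i) p (ebase k))) * \prod_(q <- s) X q (i q)).
    apply: eq_bigr => k _; rewrite YE big_cons ffunE eqxx.
    rewrite mulrA [L _ * _]mulrC; congr (_ * _).
    apply: eq_big_seq => q qs; rewrite ffunE.
    by case: eqP => // qp; rewrite -qp qs in ps.
  rewrite -mulr_suml -mlin_sum.
    congr (L _ * _); apply/funext => q; rewrite /setarg /Y.
    by case: eqP => // ->; rewrite (negbTE ps).
  by move=> q; rewrite /Y; case: ifP => _; [exact: ebase_lspace|exact: fins_lspace].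
have := claim (enum 'I_m) (enum_uniq _); rewrite size_enum_ord.
move=> /(mulfI (expf_neq0 m NC)) <-; apply: eq_bigr => i _.
rewrite big_enum; congr (L _ * _); apply/funext => q.
by rewrite /Y mem_enum.
Qed.

End Expansion.

(* Kronecker substitution: at [z_k = t ^+ (B ^ k)] with [m < B] distinct
   monomials of degree [m] become distinct powers of [t]. *)
Definition expo B (s : seq nat) := (\sum_(k <- s) B ^ k)%N.

Lemma expo_bounds B k s : (size s < B.-1)%N -> sorted geq (k :: s) ->
  (B ^ k <= expo B (k :: s) < B ^ k.+1)%N.
Proof.
move=> sB ks; rewrite /expo big_cons leq_addr /=.
have B0 : (0 < B)%N by lia.
have : (\sum_(j <- s) B ^ j <= size s * B ^ k)%N.
  have gtr : transitive geq by move=> a b c /= h1 h2; exact: leq_trans h2 h1.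
  have /allP sk := order_path_min gtr ks.
  rewrite -sum1_size big_distrl /= big_seq [leqRHS]big_seq leq_sum// => j /sk /= jk.
  by rewrite mul1n leq_pexp2l.
rewrite expnS; have : (0 < B ^ k)%N by rewrite expn_gt0 B0.
move: (\sum_(j <- s) _)%N (B ^ k)%N => T Q; nia.
Qed.

(** Fewer than B summands, so no carry reaches the next power: the largest entry is the base-B
    integer logarithm of the sum, and it can be peeled off. *)
Lemma expo_inj B s1 s2 : sorted geq s1 -> sorted geq s2 -> size s1 = size s2 ->
  (size s1 < B)%N -> expo B s1 = expo B s2 -> s1 = s2.
Proof.
elim: s1 s2 => [|k1 s1 IH] [|k2 s2]// h1 h2 [ss] sB e12.
have B1 : (1 < B)%N by rewrite (leq_trans _ sB).
have sB1 : (size s1 < B.-1)%N by rewrite -ltnS prednK ?(ltnW B1).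
have sB2 : (size s2 < B.-1)%N by rewrite -ss.
have k12 : k1 = k2.
  have /(trunc_log_eq B1) <- := expo_bounds sB1 h1.
  by have /(trunc_log_eq B1) <- := expo_bounds sB2 h2; rewrite e12.
rewrite k12 (IH s2)//; [exact: path_sorted h1|exact: path_sorted h2|exact: ltnW|].
by move: e12; rewrite /expo !big_cons k12 => /addnI.
Qed.

Lemma expo_inj_leq B s1 s2 : sorted leq s1 -> sorted leq s2 -> size s1 = size s2 ->
  (size s1 < B)%N -> expo B s1 = expo B s2 -> s1 = s2.
Proof.
move=> h1 h2 ss sB e12; apply: (inv_inj revK); apply: (@expo_inj B).
- by rewrite rev_sorted.
- by rewrite rev_sorted.
- by rewrite !size_rev.
- by rewrite size_rev.
by rewrite /expo !(perm_big _ (permEl (perm_rev _))).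
Qed.

Definition tup m N (i : {ffun 'I_m -> 'I_N}) : m.-tuple nat := [tuple i q : nat | q < m].

Lemma tup_inj m N : injective (@tup m N).
Proof.
move=> i j ij; apply/ffunP => q; apply: val_inj.
by have := congr1 (fun t => tnth t q) ij; rewrite !tnth_mktuple.
Qed.

Lemma big_tup (T : Type) (idx : T) (op : Monoid.law idx) m N (i : {ffun 'I_m -> 'I_N}) (F : nat -> T) :
  \big[op/idx]_(k <- tup i) F k = \big[op/idx]_q F (i q).
Proof. by rewrite big_tuple; apply: eq_bigr => q _; rewrite tnth_mktuple. Qed.

Lemma tup_expo_sort m N (i i0 : {ffun 'I_m -> 'I_N}) : sorted leq (tup i0) ->
  expo m.+1 (tup i) = expo m.+1 (tup i0) -> perm_eq (tup i) (tup i0).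
Proof.
move=> s0 e; have -> : tup i0 = sort leq (tup i) :> seq nat; last by rewrite perm_sym perm_sort.
apply: (@expo_inj_leq m.+1) => //.
- by apply: sort_sorted; exact: leq_total.
- by rewrite size_sort !size_tuple.
- by rewrite size_tuple.
by rewrite -e /expo; apply: perm_big; rewrite perm_sym perm_sort.
Qed.

Lemma fsbig_Jset m N (f : m.-tuple nat -> C) :
  (forall j, @Jset m j -> f j != 0 -> forall q, (tnth j q < N)%N) ->
  \sum_(j \in @Jset m) f j = \sum_(i : {ffun 'I_m -> 'I_N} | sorted leq (tup i)) f (tup i).
Proof.
move=> fN.
pose s := [seq tup i | i <- enum {ffun 'I_m -> 'I_N} & sorted leq (tup i)].
rewrite (fsbigE s).
- rewrite big_mkcond big_map big_filter big_enum_cond /=.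
  apply: eq_bigr => i si; rewrite ifT//; exact/mem_set.
- by rewrite (map_inj_uniq (@tup_inj m N)) filter_uniq ?enum_uniq.
- move=> j /= js; have := js; rewrite /s.
  by move/(@mapP _ (m.-tuple nat)) => [i + ->]; rewrite mem_filter => /andP[].
move=> j Jj; apply: contraNeq => fj; have jN := fN j Jj fj.
have jE : j = tup [ffun q => Ordinal (jN q)].
  by apply: eq_from_tnth => q; rewrite tnth_mktuple ffunE.
apply/(@mapP _ (m.-tuple nat)); exists [ffun q => Ordinal (jN q)] => //.
by rewrite mem_filter mem_enum andbT -jE.
Qed.

Lemma poly_ext (p q : {poly C}) : (forall t, p.[t] = q.[t]) -> p = q.
Proof.
move=> pq; apply/eqP; rewrite -subr_eq0; apply/eqP.
apply: (@roots_geq_poly_eq0 _ _ [seq n%:R | n <- iota 0 (size (p - q))]).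
- apply/allP => _ /mapP[n _ ->]; rewrite /root hornerD hornerN pq subrr eqxx//.
- rewrite map_inj_uniq ?iota_uniq// => a b /eqP; by rewrite eqr_nat => /eqP.
by rewrite size_map size_iota.
Qed.

Lemma monomial_tup m N (z : nat -> C) (i : {ffun 'I_m -> 'I_N}) :
  monomial z (tup i) = \prod_q z (i q).
Proof. by apply: eq_bigr => q _; rewrite tnth_mktuple. Qed.

(** Equality of exponents in base m + 1 encodes that i is a rearrangement of i0. No symmetrisation
    of L and no multinomial factor is involved. *)
Lemma coef_tup m (r : \bar R) (L : ('I_m -> nat -> C) -> C) P c N (i0 : {ffun 'I_m -> 'I_N}) :
  (0 < r)%E -> (0 < N)%N ->
  multilinear_on r L -> (forall z, lspace r z -> P z = L (fun=> z)) -> is_coef P c ->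
  sorted leq (tup i0) ->
  c (tup i0) = \sum_(i : {ffun 'I_m -> 'I_N} | expo m.+1 (tup i) == expo m.+1 (tup i0))
     L (fun q => ebase (i q)).
Proof.
move=> r0 N0 Lm PL Pc s0.
pose e (i : {ffun 'I_m -> 'I_N}) := expo m.+1 (tup i).
(* Both polynomials give the value of P at z_k = t^((m+1)^k), k < N: [p1] by multilinearity, [p2] by
   the defining property of c. *)
pose p1 : {poly C} := \sum_(i : {ffun 'I_m -> 'I_N}) L (fun q => ebase (i q)) *: 'X^(e i).
pose p2 : {poly C} := \sum_(i : {ffun 'I_m -> 'I_N} | sorted leq (tup i)) c (tup i) *: 'X^(e i).
have zE (t : C) (i : {ffun 'I_m -> 'I_N}) : \prod_q (fins N (fun k => t ^+ (m.+1 ^ k)%N)) (i q) = t ^+ e i.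
  rewrite /e /expo big_tup -prodrXr; apply: eq_bigr => q _.
  by rewrite /fins ltn_ord.
have p12 : p1 = p2.
  apply: poly_ext => t; rewrite !horner_sum.
  under eq_bigr do rewrite hornerZ hornerXn.
  under [RHS]eq_bigr do rewrite hornerZ hornerXn.
  pose z : nat -> C := fun k => t ^+ (m.+1 ^ k)%N.
  have zfin : finite_set [set k | fins N z k != 0].
    apply: (@sub_finite_set _ _ `I_N); last exact: finite_II.
    by move=> k /=; rewrite /fins; case: ltnP => // _; rewrite eqxx.
  have := Pc _ zfin; rewrite PL; last exact: fins_lspace.
  rewrite (expansion r0 Lm (fun=> z) N0) (@fsbig_Jset m N); last first.
    move=> j _ + q; rewrite mulf_eq0 negb_or => /andP[_ mj].
    rewrite ltnNge; apply/negP => Nj; move: mj; rewrite /monomial (bigD1 q)//= /fins.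
    by rewrite ltnNge Nj mul0r eqxx.
  rewrite (eq_bigr (fun i : {ffun 'I_m -> 'I_N} => L (fun q => ebase (i q)) * t ^+ e i)); last first.
    move=> i _; rewrite -zE; congr (_ * _); apply: eq_bigr => q _.
    by rewrite /fins ltn_ord.
  by move=> ->; apply: eq_bigr => i _; rewrite monomial_tup zE.
have p2c : p2`_(e i0) = c (tup i0).
  rewrite coef_sum (bigD1 i0)//= coefZ coefXn eqxx mulr1 big1 ?addr0// => i /andP[si ii0].
  rewrite coefZ coefXn; case: eqP => [e0|_]; last by rewrite mulr0.
  exfalso; move/eqP: ii0; apply; apply: tup_inj; apply: val_inj => /=.
  apply: (@expo_inj_leq m.+1 _ _ si s0 _ _ (esym e0)); by rewrite !size_tuple ?card_ord.
rewrite -p2c -p12 coef_sum [RHS]big_mkcond; apply: eq_bigr => i _.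
by rewrite coefZ coefXn eq_sym -/(e i) -/(e i0); case: eqP => _; rewrite ?mulr1 ?mulr0.
Qed.

Lemma leq_max_tnth m (l : seq (m.-tuple nat)) j q : j \in l ->
  (tnth j q <= \max_(k <- l) \max_p tnth k p)%N.
Proof.
elim: l => [//|a l IH]; rewrite inE big_cons leq_max => /orP[/eqP->|/IH->].
  by apply/orP; left; exact: (@leq_bigmax _ (fun p : 'I_m => tnth a p : nat)).
by rewrite orbT.
Qed.

(** Passing from c to L costs no constant: |c_j z_j| is at most the sum over the rearrangements of
    j, and the rearrangement classes are disjoint. *)
Lemma esum_coef_lty m (r : \bar R) (L : ('I_m -> nat -> C) -> C) P c (z : nat -> C) (B : R) :
  (0 < r)%E ->
  multilinear_on r L -> (forall z, lspace r z -> P z = L (fun=> z)) -> is_coef P c ->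
  (forall N, (0 < N)%N -> \sum_(i : {ffun 'I_m -> 'I_N})
     normc (L (fun q => ebase (i q))) * \prod_q normc (z (i q)) <= B) ->
  (\esum_(j in @Jset m) (normc (c j * monomial z j))%:E < +oo)%E.
Proof.
move=> r0 Lm PL Pc LB; apply: (@le_lt_trans _ _ B%:E); last exact: ltry.
apply: ub_ereal_sup => _ [A [Afin AJ] <-].
rewrite fsbig_finite// sumEFin lee_fin.
pose s : seq (m.-tuple nat) := finmap.enum_fset (fset_set A); rewrite -/s.
have us : uniq s by exact: finmap.fset_uniq.
have sA j : j \in s -> A j.
  by rewrite -[_ \in s]/(j \in fset_set A) in_fset_set// => /set_mem.
pose N := (\max_(j <- s) \max_q tnth j q).+1.
have sN j q : j \in s -> (tnth j q < N)%N.
  by move=> js; rewrite ltnS leq_max_tnth.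
apply: le_trans (LB N _) => //.
pose f (j : m.-tuple nat) := normc (c j * monomial z j).
pose G (i : {ffun 'I_m -> 'I_N}) := normc (L (fun q => ebase (i q))) * \prod_q normc (z (i q)).
have G0 i : 0 <= G i.
  by rewrite mulr_ge0 ?normc_ge0// prodr_ge0// => q _; rewrite normc_ge0.
pose e (i : {ffun 'I_m -> 'I_N}) := expo m.+1 (tup i).
apply: (@le_trans _ _ (\sum_(i : {ffun 'I_m -> 'I_N} | sorted leq (tup i)) f (tup i))).
  pose t := [seq tup i | i <- enum {ffun 'I_m -> 'I_N} & tup i \in s].
  have st : perm_eq s t.
    apply: uniq_perm => //.
      by rewrite (map_inj_uniq (@tup_inj m N)) filter_uniq ?enum_uniq.
    move=> j; apply/idP/idP => [js|]; last first.
      by move/(@mapP _ (m.-tuple nat)) => [i + ->]; rewrite mem_filter => /andP[].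
    have jE : j = tup [ffun q => Ordinal (sN j q js)].
      by apply: eq_from_tnth => q; rewrite tnth_mktuple ffunE.
    apply/(@mapP _ (m.-tuple nat)); exists [ffun q => Ordinal (sN j q js)] => //.
    by rewrite mem_filter mem_enum andbT -jE.
  rewrite (perm_big _ st) big_map big_filter big_enum_cond /= [leLHS]big_mkcond [leRHS]big_mkcond.
  apply: ler_sum => i _; case: ifP => [/sA/AJ|_].
    by rewrite /Jset /= => ->.
  by case: ifP => // _; rewrite normc_ge0.
apply: (@le_trans _ _ (\sum_(i0 : {ffun 'I_m -> 'I_N} | sorted leq (tup i0))
    \sum_(i : {ffun 'I_m -> 'I_N} | e i == e i0) G i)).
  apply: ler_sum => i0 s0; rewrite /f (coef_tup r0 _ Lm PL Pc s0)// normcM.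
  rewrite monomial_tup normc_prod.
  apply: le_trans (ler_wpM2r _ (normc_sum _ _ _)) _.
    by rewrite prodr_ge0// => q _; rewrite normc_ge0.
  rewrite mulr_suml; apply: ler_sum => i /eqP ei; rewrite /G.
  by rewrite -!(big_tup _ _ (fun k => normc (z k))) (perm_big _ (tup_expo_sort s0 ei)).
rewrite (exchange_big_dep xpredT)//=; apply: ler_sum => i _.
have [i0 /andP[s0 e0]|none] := pickP (fun i0 : {ffun 'I_m -> 'I_N} => sorted leq (tup i0) && (e i == e i0)).
  rewrite (bigD1 i0) ?s0//= big1 ?addr0// => i1 /andP[/andP[s1 e1] i10].
  exfalso; move/eqP: i10; apply; apply: tup_inj; apply: val_inj => /=.
  apply: (@expo_inj_leq m.+1 _ _ s1 s0 _ _ (etrans (esym (eqP e1)) (eqP e0))); by rewrite !size_tuple ?card_ord.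
by rewrite big_pred0 ?G0.
Qed.

End Multilinear.

(** * Lower inclusions *)

Section LowerInclusions.
Context {R : realType}.
Local Notation C := R[i].

(** Stands in for the decreasing rearrangement on the first N indices; the form is relabelled by the
    same permutation. *)
Lemma exists_sorting N (f : 'I_N -> R) :
  exists s : {perm 'I_N}, forall j k : 'I_N, (j <= k)%N -> f (s k) <= f (s j).
Proof.
pose le := fun a b : 'I_N => f b <= f a.
have le_tot : total le by move=> a b; rewrite /le; case: (leP (f b) (f a)) => // /ltW ->.
have le_tr : transitive le by move=> a b c h1 h2; exact: le_trans h2 h1.
pose l := sort le (enum 'I_N).
have sl : size l = N by rewrite size_sort size_enum_ord.
pose g (k : 'I_N) := nth k l k.
have ginj : injective g.
  move=> j k; rewrite /g (set_nth_default j) ?sl// => /eqP.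
  by rewrite nth_uniq ?sl ?sort_uniq ?enum_uniq// => /eqP /val_inj.
exists (perm ginj) => j k jk; rewrite !permE /g.
have -> : nth k l k = nth j l k by apply: set_nth_default; rewrite sl.
have := sorted_leq_nth le_tr (fun a => lexx _) j (sort_sorted le_tot (enum 'I_N)).
by rewrite -/l => /(_ j k); rewrite !inE sl; apply.
Qed.

Definition compp m N (s : {perm 'I_N}) (i : {ffun 'I_m -> 'I_N}) : {ffun 'I_m -> 'I_N} :=
  [ffun q => s (i q)].

Lemma compp_inj m N (s : {perm 'I_N}) : injective (@compp m N s).
Proof.
move=> i j /ffunP ij; apply/ffunP => q; have := ij q; rewrite !ffunE.
exact: perm_inj.
Qed.

Lemma rearrangement_ge0 (u : nat -> C) n : (0 <= rearrangement u n)%E.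
Proof.
apply: le_ereal_inf_tmp => _ [J _ <-].
pose k := (\max_(j <- finmap.enum_fset J) j).+1.
have kJ : (~` [set` J]) k.
  move=> /= kJ; have : (k <= \max_(j <- finmap.enum_fset J) j)%N.
    by rewrite (big_rem k kJ) /= leq_max leqnn.
  by rewrite ltnn.
apply: le_trans (ereal_sup_ubound _); last by exists k.
by rewrite lee_fin normc_ge0.
Qed.

(** Pigeonhole: at most n removed indices miss one of more than n large entries. *)
Lemma rearrangement_level (u : nat -> C) n (s : seq nat) (rho : R) :
  uniq s -> (n < size s)%N -> (forall k, k \in s -> rho <= normc (u k)) ->
  (rho%:E <= rearrangement u n)%E.
Proof.
move=> us ns hs; apply: le_ereal_inf_tmp => _ [J /= Jn <-].
have /allPn[k ks kJ] : ~~ all (fun k => k \in J) s.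
  apply/negP => /allP sJ; have : (size s <= #|` J|)%N by exact: uniq_leq_size.
  by rewrite leqNgt (leq_ltn_trans Jn).
apply: le_trans (ereal_sup_ubound _); last by exists k; rewrite //=; exact/negP.
by rewrite lee_fin hs.
Qed.

Lemma weak_lspace_level (s : \bar R) (u : nat -> C) : weak_lspace s u ->
  exists2 W : R, 0 <= W & forall n (l : seq nat) rho, uniq l -> size l = n.+1 ->
    (forall k, k \in l -> rho <= normc (u k)) -> rho <= W * n.+1%:R `^ (- fine s^-1%E).
Proof.
move=> [_]; set b := fine _; set S := ereal_sup _ => Slty.
have S0 : (0 <= S)%E.
  apply: (@le_trans _ _ ((1%:R `^ b)%:E * rearrangement u 0)%E).
    by rewrite mule_ge0 ?rearrangement_ge0// lee_fin powR_ge0.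
  by apply: ereal_sup_ubound; exists 0%N.
exists (fine S); first exact: fine_ge0.
move=> n l rho ul sl hl.
have n0 : 0 < n.+1%:R `^ b :> R by rewrite powR_gt0 ?ltr0n.
rewrite powRN ler_pdivlMr// mulrC -lee_fin fineK ?ge0_fin_numE//.
apply: (@le_trans _ _ ((n.+1%:R `^ b)%:E * rearrangement u n)%E); last first.
  by apply: ereal_sup_ubound; exists n.
by rewrite EFinM lee_pmul2l// (@rearrangement_level _ _ l)// sl.
Qed.

(** [F] is an arbitrary bound by rank, so that both the weak norm and Chebyshev's inequality in l_p
    can supply it. *)
Lemma sorted_level N (u : nat -> C) (s : {perm 'I_N}) (F : nat -> R) :
  (forall n (l : seq nat) rho, uniq l -> size l = n.+1 ->
    (forall k, k \in l -> rho <= normc (u k)) -> rho <= F n) ->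
  (forall j k : 'I_N, (j <= k)%N -> normc (u (s k)) <= normc (u (s j))) ->
  forall k : 'I_N, normc (u (s k)) <= F k.
Proof.
move=> hF hs k; pose l := map (fun j : 'I_N => nat_of_ord (s j)) [seq j : 'I_N <- index_enum 'I_N | (j <= k)%N].
apply: (hF k l).
- rewrite map_inj_uniq ?filter_uniq ?index_enum_uniq// => a b /val_inj; exact: perm_inj.
- rewrite size_map size_filter -sum1_count /=.
  by rewrite -(big_ord_widen N (fun=> 1%N) (ltn_ord k)) sum1_card card_ord.
by move=> _ /mapP[j + ->]; rewrite mem_filter => /andP[jk _]; exact: hs.
Qed.

Lemma bounded_nle m (r : \bar R) (L : ('I_m -> nat -> C) -> C) : (0 < r)%E ->
  bounded_on r L -> exists2 M : R, 0 <= M & forall x (t : 'I_m -> R),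
    (forall q, 0 <= t q) -> (forall q, nle r (x q) (t q)) ->
    normc (L x) <= M * \prod_q t q.
Proof.
move=> r0 [M HM]; exists (Num.max 0 M); first by rewrite le_max lexx.
move=> x t t0 xt.
have xl q := lnorm_le r0 (t0 q) (xt q).
have f0 q : 0 <= fine (lnorm r (x q)) by have [] := nle_lnorm r0 (xl q).1.
apply: le_trans (HM x _) _ => [q|]; first exact: (xl q).1.
apply: (@le_trans _ _ (Num.max 0 M * \prod_j fine (lnorm r (x j)))).
  by rewrite ler_wpM2r ?prodr_ge0// le_max lexx orbT.
rewrite ler_wpM2l ?le_max ?lexx//; apply: ler_prod => q _.
by rewrite f0 (xl q).2.
Qed.

Lemma nle_ebase (r : \bar R) k : (0 < r)%E -> nle r (ebase k : nat -> C) 1.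
Proof.
case: r => [p|_|//]; rewrite /nle; last first.
  by move=> j; rewrite /ebase; case: eqP; rewrite ?normc1 ?normc0.
rewrite lte_fin => p0 N; rewrite powR1.
apply: (@le_trans _ _ (\sum_(j < N | (j : nat) == k) 1)).
  rewrite [leRHS]big_mkcond; apply: ler_sum => j _; rewrite /ebase; case: eqP => _.
    by rewrite normc1 powR1.
  by rewrite normc0 powR0// gt_eqF.
have [kN|kN] := ltnP k N.
  by rewrite (big_pred1 (Ordinal kN)).
by rewrite big_pred0// => j; apply/negP => /eqP jk; have := ltn_ord j; rewrite jk ltnNge kN.
Qed.

Lemma nle_mono (p r : R) (x : nat -> C) (t : R) : 0 < p -> p <= r -> 0 <= t ->
  nle p%:E x t -> nle r%:E x t.
Proof.
move=> p0 pr t0 h N; have r0 : 0 < r by lra.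
have xt k : normc (x k) <= t.
  rewrite leNgt; apply/negP => tx; have := h k.+1; rewrite big_ord_recr /=.
  have : t `^ p < normc (x k) `^ p by rewrite gt0_ltr_powR ?nnegrE ?normc_ge0.
  have : 0 <= \sum_(j < k) normc (x j) `^ p by apply: sumr_ge0 => j _; rewrite powR_ge0.
  by lra.
have powE (a : R) : a `^ r = a `^ (r - p) * a `^ p.
  by rewrite -powRD ?subrK// gt_eqF.
rewrite [leRHS]powE; apply: le_trans (ler_wpM2l (powR_ge0 _ _) (h N)).
rewrite mulr_sumr; apply: ler_sum => k _; rewrite powE ler_wpM2r ?powR_ge0//.
by rewrite ge0_ler_powR ?nnegrE ?normc_ge0//; lra.
Qed.

(** Multiplication by b in l_r maps l_oo into l_r. Absorbing b into the form gives a form bounded on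
    l_oo, with a in the weak space as the remaining sequence; this serves every r >= 1. *)
Lemma weak_mul_lspace_mon m (r : \bar R) : (1 < m)%N -> (1 <= r)%E ->
  seq_mul (weak_lspace ((2 * m)%:R / m.-1%:R)%:E) (lspace r) `<=` @mon R m r.
Proof.
move=> m1 r1 _ [a aw [b br <-]]; have r0 : (0 < r)%E by exact: lt_le_trans r1.
have [W W0 HW] := weak_lspace_level aw.
have sE : - fine (((2 * m)%:R / m.-1%:R : R)%:E)^-1%E = - (m.-1%:R / (2 * m)%:R) :> R.
  rewrite inver /= ifF ?invf_div//.
  by apply/negbTE; rewrite mulf_neq0 ?invr_neq0// pnatr_eq0; lia.
rewrite sE in HW.
have [/lspaceP - /(_ r0) [t t0 bt]] := br.
have aW k : normc (a k) <= W.
  have := HW 0%N [:: k] (normc (a k)) isT erefl; rewrite powR1 mulr1; apply => j.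
  by rewrite inE => /eqP->.
split; first by apply/lspaceP => //; exists (W * t); rewrite ?mulr_ge0//; exact: nle_mul.
move=> P [L [Lm Lb PL]] c Pc; have [M M0 HM] := bounded_nle r0 Lb.
have [K K0 HK] := @lower_infty_finite R m m1.
apply: (esum_coef_lty r0 Lm PL Pc (B := K * (M * t ^+ m) * W ^+ m)) => N N0.
have [s ss] := exists_sorting (fun k : 'I_N => normc (a k)).
pose A (i : {ffun 'I_m -> 'I_N}) : C := L (fun q => ebase (compp s i q)) * \prod_q b (compp s i q).
rewrite (reindex_inj (@compp_inj m N s)) /=.
rewrite (eq_bigr (fun i : {ffun 'I_m -> 'I_N} => normc (A i) * \prod_q normc (a (s (i q))))); last first.
  move=> i _; rewrite /A normcM -mulrA normc_prod -big_split /=; congr (_ * _).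
  by apply: eq_bigr => q _; rewrite normcM ffunE mulrC.
apply: (HK N A (M * t ^+ m) W (fun k => normc (a (s k))) W0); last first.
  by move=> k; rewrite normc_ge0 (@sorted_level N a s (fun n => W * n.+1%:R `^ (- (m.-1%:R / (2 * m)%:R)))).
(* The arguments live on sorted positions; the inverse permutation carries them back to the original
   indices, with 0 beyond N. *)
move=> x x1; pose X q k : C := if insub k is Some j then x q ((s^-1)%g j) else 0.
have X1 q k : normc (X q k) <= 1.
  by rewrite /X; case: insub => [j|]; rewrite ?normc0.
have -> : \sum_i A i * \prod_q x q (i q) = L (fun q => fins N (fun k => b k * X q k)).
  rewrite (expansion r0 Lm (fun q k => b k * X q k) N0) [RHS](reindex_inj (@compp_inj m N s)) /=.
  apply: eq_bigr => i _; rewrite /A -mulrA -big_split; congr (_ * _) => /=.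
  by apply: eq_bigr => q _; rewrite /X valK ffunE permK.
have -> : M * t ^+ m = M * \prod_(q < m) t by rewrite prodr_const card_ord.
apply: HM => // q; have -> : t = 1 * t by rewrite mul1r.
have -> : fins N (fun k => b k * X q k) = (fun k => fins N (X q) k * b k).
  by apply/funext => k; rewrite /fins; case: ifP => _; rewrite ?mul0r// mulrC.
apply: nle_mul => // k; rewrite /fins; case: ifP => _ //.
by rewrite normc0.
Qed.

(** The bound |L(e_i)| <= M is enough here, since the remaining sum is the m-th power of the l_1
    norm. *)
Lemma lspace1_mon m : mon m 1 = @lspace R 1.
Proof.
apply/seteqP; split=> [z []//|z zl]; have r0 : (0 < 1 :> \bar R)%E by [].
split=> // P [L [Lm Lb PL]] c Pc; have [M M0 HM] := bounded_nle r0 Lb.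
have /lspaceP - /(_ r0) [t t0 zt] := zl.
apply: (esum_coef_lty r0 Lm PL Pc (B := M * t ^+ m)) => N N0.
apply: (@le_trans _ _ (\sum_(i : {ffun 'I_m -> 'I_N}) M * \prod_q normc (z (i q)))).
  apply: ler_sum => i _; rewrite ler_wpM2r ?prodr_ge0//; first by move=> q _; exact: normc_ge0.
  have := HM (fun q => ebase (i q)) (fun=> 1) (fun=> ler01) (fun q => nle_ebase _ r0).
  by rewrite big1 ?mulr1.
rewrite -mulr_sumr ler_wpM2l//.
rewrite -(bigA_distr_bigA (fun (q : 'I_m) (k : 'I_N) => normc (z k))) /= prodr_const card_ord.
rewrite lerXn2r ?nnegrE//; first by apply: sumr_ge0 => k _; rewrite normc_ge0.
have : \sum_(k < N) normc (z k) `^ 1 <= t `^ 1 := zt N; rewrite (powRr1 t0).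
by apply: le_trans; apply: ler_sum => k _; rewrite powRr1 ?normc_ge0.
Qed.

Lemma lspace_mon m (r p : R) : (1 < m)%N -> 1 < r -> 0 < p ->
  1 - (1 - r^-1) / m%:R < p^-1 -> lspace p%:E `<=` @mon R m r%:E.
Proof.
move=> m1 r1 p0 pm z zp; have r0 : (0 < r%:E)%E by rewrite lte_fin; lra.
have m0' : 1 < m%:R :> R by rewrite ltr1n.
have ri : r^-1 < 1 by rewrite invf_lt1//; lra.
have p0' : (0 < p%:E)%E by rewrite lte_fin.
have /lspaceP - /(_ p0') [t t0 zt] := zp.
have im : m%:R^-1 < 1 :> R by rewrite invf_lt1//; lra.
have im0 : 0 < m%:R^-1 :> R by rewrite invr_gt0; lra.
have pr : p <= r.
  have r0' : 0 < r by lra.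
  rewrite -lef_pV2 ?posrE//; apply/ltW/(le_lt_trans _ pm).
  by rewrite -subr_ge0; have : 0 <= (1 - r^-1) * (1 - m%:R^-1) by [rewrite mulr_ge0//; lra]; lra.
split; first by apply/lspaceP => //; exists t => //; exact: nle_mono zt.
move=> P [L [Lm Lb PL]] c Pc; have [M M0 HM] := bounded_nle r0 Lb.
(* The gap left by the strict inequality is split into m equal parts: one for [tau], and one for
   each of the m - 1 copies of [sigma]. Then p^-1 + sigma = 1 + delta + delta/m. *)
pose delta := p^-1 - (1 - (1 - r^-1) / m%:R).
have d0 : 0 < delta by rewrite subr_gt0.
have dm : 0 < delta / m%:R by rewrite mulr_gt0.
have sg0 : 0 < (1 - r^-1) / m%:R by rewrite mulr_gt0//; lra.
have [//|||||K K0 HK] := @lower_finite R m r p^-1 (delta / m%:R) ((1 - r^-1) / m%:R + delta / m%:R) m1.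
- lra.
- lra.
- have -> : m.-1%:R = m%:R - 1 :> R by rewrite -{2}(prednK (ltnW m1)) -natr1 addrK.
  by rewrite /delta; field; rewrite !gt_eqF//; lra.
- by rewrite /delta in dm *; lra.
apply: (esum_coef_lty r0 Lm PL Pc (B := K * M * t ^+ m)) => N N0.
have [s ss] := exists_sorting (fun k : 'I_N => normc (z k)).
pose A (i : {ffun 'I_m -> 'I_N}) : C := L (fun q => ebase (compp s i q)).
rewrite (reindex_inj (@compp_inj m N s)) /=.
rewrite (eq_bigr (fun i : {ffun 'I_m -> 'I_N} => normc (A i) * \prod_q normc (z (s (i q))))); last first.
  by move=> i _; congr (_ * _); apply: eq_bigr => q _; rewrite ffunE.
apply: (HK N (fun i => normc (A i)) M t (fun k => normc (z (s k))) t0 M0 (fun i => normc_ge0 _)); last first.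
  move=> k; rewrite normc_ge0; apply: (@sorted_level N z s (fun n => t * n.+1%:R `^ (- p^-1))) => //.
  move=> {k} n l rho ul sl hl.
  have [rho0|rho0] := leP rho 0; first by rewrite (le_trans rho0)// mulr_ge0 ?powR_ge0.
  pose B := \max_(k <- l) k.
  (* Chebyshev: n + 1 entries of size at least rho already carry this much of the l_p sum. *)
  have nl : n.+1%:R * rho `^ p <= t `^ p.
    apply: le_trans (zt B.+1).
    apply: (@le_trans _ _ (\sum_(k < B.+1 | (k : nat) \in l) normc (z k) `^ p)); last first.
      rewrite [leRHS](bigID (fun k : 'I_B.+1 => (k : nat) \in l)) /= lerDl sumr_ge0// => k _.
      exact: powR_ge0.
    have -> : n.+1%:R = \sum_(k < B.+1 | (k : nat) \in l) 1 :> R.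
      rewrite -sl -(count_predT l) -sum1_count.
      have lB k : k \in l -> (k < B.+1)%N.
        by move=> kl; rewrite ltnS /B (big_rem k kl) /= leq_max leqnn.
      have lp : perm_eq l [seq nat_of_ord k | k <- [seq k : 'I_B.+1 <- index_enum 'I_B.+1 | (k : nat) \in l]].
        apply: uniq_perm => //.
          by rewrite (map_inj_uniq val_inj) filter_uniq ?index_enum_uniq.
        move=> k; apply/idP/mapP => [kl|[j + ->]]; last by rewrite mem_filter => /andP[].
        by exists (Ordinal (lB k kl)) => //; rewrite mem_filter kl mem_index_enum.
      by rewrite (perm_big _ lp) big_map big_filter natr_sum.
    rewrite mulr_suml; apply: ler_sum => k kl; rewrite mul1r.
    by rewrite ge0_ler_powR ?nnegrE ?normc_ge0 ?(ltW p0) ?(ltW rho0)// hl.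
  have n0 : 0 < n.+1%:R :> R by rewrite ltr0n.
  rewrite powRN ler_pdivlMr ?powR_gt0//.
  have -> : rho = (rho `^ p) `^ p^-1 by rewrite -powRrM divff ?gt_eqF// powRr1// ltW.
  have -> : t = (t `^ p) `^ p^-1 by rewrite -powRrM divff ?gt_eqF// powRr1.
  rewrite -powRM ?powR_ge0 ?(ltW n0)// ge0_ler_powR ?nnegrE ?invr_ge0 ?powR_ge0 ?mulr_ge0 ?powR_ge0 ?(ltW p0)//.
  by rewrite mulrC.
move=> pp i v v0.
pose X := fun q : 'I_m => ebase (compp s i q) : nat -> C.
have Xl q : lspace r%:E (X q) by exact: ebase_lspace.
(* Duality for the slice: the vector with moduli at most v and these phases is fed into argument pp,
   so that L takes the sum of moduli as its value. *)
pose u k := projT1 (cid2 (normc_phase (L (setarg X pp (ebase k))))).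
have [u1 uL] : (forall k, normc (u k) <= 1) /\
    (forall k, u k * L (setarg X pp (ebase k)) = (normc (L (setarg X pp (ebase k))))%:C%C).
  by split=> k; rewrite /u; case: cid2.
pose y (k : nat) : C := if insub k is Some j then u k * (v ((s^-1)%g j))%:C%C else 0.
have Lsum : L (setarg X pp (fins N y)) =
    (\sum_k normc (A (upd i pp k)) * v k)%:C%C.
  rewrite (mlin_sum r0 Lm _ _ _ Xl) rmorph_sum [LHS](reindex_inj (@perm_inj _ s)) /=.
  apply: eq_bigr => k _; rewrite /y valK permK mulrAC uL rmorphM /=; congr ((normc (L _))%:C%C * _).
  by apply/funext => q; rewrite /setarg /X /compp !ffunE; case: eqP.
have S0 : 0 <= \sum_k normc (A (upd i pp k)) * v k.
  by apply: sumr_ge0 => k _; rewrite mulr_ge0 ?normc_ge0.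
rewrite -(ger0_norm S0) -normcR -Lsum.
pose T := (\sum_k v k `^ r) `^ r^-1.
have T0 : 0 <= T by exact: powR_ge0.
have -> : M * T = M * \prod_q (if q == pp then T else 1).
  by congr (_ * _); rewrite (bigD1 pp)//= eqxx big1 ?mulr1// => q /negbTE->.
apply: HM => q; rewrite /setarg; case: eqP => // _; last exact: nle_ebase.
have rp : 0 < r by lra.
have rn0 : r != 0 by rewrite gt_eqF.
apply: nle_fins => //; rewrite /nrm_le /T -powRrM (mulVf rn0).
rewrite powRr1; last by apply: sumr_ge0 => k _; rewrite powR_ge0.
rewrite [leRHS](reindex_inj (@perm_inj _ (s^-1)%g)) /=; apply: ler_sum => k _.
rewrite /y valK ge0_ler_powR ?nnegrE ?normc_ge0 ?(ltW rp)//.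
by rewrite normcM normcR ger0_norm// -[leRHS]mul1r ler_wpM2r.
Qed.

End LowerInclusions.

(** * Upper inclusions *)

Section DyadicSeries.
Context {R : realType}.
Local Notation C := R[i].

(** For a divergent series [limn] is only a default value, so bounds and linearity are stated under
    [dyadic]. *)
Definition csum (u : nat -> C) : C :=
  (limn (series (fun l => complex.Re (u l))) +i* limn (series (fun l => complex.Im (u l))))%C.

Definition dyadic (u : nat -> C) (B : R) := forall l, normc (u l) <= B * 2^-1 ^+ l.

Lemma cvg_dyadic (u : nat -> R) (B : R) : (forall l, `|u l| <= B * 2^-1 ^+ l) ->
  cvgn (series u) /\ `|limn (series u)| <= 2 * B.
Proof.
move=> uB; have h2 : `|2^-1 : R| < 1 by rewrite ger0_norm//; lra.
have cg : cvgn (series (geometric B (2^-1 : R))) by exact: is_cvg_geometric_series.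
have cn : cvgn [normed series u].
  apply: (@series_le_cvg R (fun l => `|u l|) (geometric B 2^-1)) => // l.
  by rewrite /= (le_trans _ (uB l)).
have cu : cvgn (series u) by exact: normed_cvg.
have B0 : 0 <= B by have := uB 0%N; rewrite expr0 mulr1; apply: le_trans.
have h n : `|series u n| <= 2 * B.
  rewrite seriesEord /= (le_trans (ler_norm_sum _ _ _))//.
  apply: (@le_trans _ _ (\sum_(l < n) B * 2^-1 ^+ l)); first by apply: ler_sum => l _.
  by rewrite -mulr_sumr mulrC ler_wpM2r// sum_half_le2.
split=> //; rewrite ler_norml; apply/andP; split.
  by apply: limr_ge => //; near=> n; have := h n; rewrite ler_norml => /andP[].
by apply: limr_le => //; near=> n; have := h n; rewrite ler_norml => /andP[].
Unshelve. all: by end_near.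
Qed.

Lemma csum_cvg u B : dyadic u B ->
  cvgn (series (fun l => complex.Re (u l))) /\ cvgn (series (fun l => complex.Im (u l))).
Proof.
move=> uB; split.
  by have [] := @cvg_dyadic (fun l => complex.Re (u l)) B (fun l => le_trans (normc_geRe _) (uB l)).
by have [] := @cvg_dyadic (fun l => complex.Im (u l)) B (fun l => le_trans (normc_geIm _) (uB l)).
Qed.

Lemma csum_le u B : dyadic u B -> normc (csum u) <= 4 * B.
Proof.
move=> uB.
have [_ h1] := @cvg_dyadic (fun l => complex.Re (u l)) B (fun l => le_trans (normc_geRe _) (uB l)).
have [_ h2] := @cvg_dyadic (fun l => complex.Im (u l)) B (fun l => le_trans (normc_geIm _) (uB l)).
rewrite /csum /= (le_trans (sqrtr_add_sqr_le (sqr_ge0 _) (sqr_ge0 _)))// !sqrtr_sqr.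
by lra.
Qed.

Lemma lim_series_lin (x y : R) (f g h : nat -> R) :
  cvgn (series f) -> cvgn (series g) -> cvgn (series h) ->
  limn (series (fun l => x * f l + (y * g l + h l))) =
  x * limn (series f) + (y * limn (series g) + limn (series h)).
Proof.
move=> cf cg ch; apply: cvg_lim => //.
have -> : series (fun l => x * f l + (y * g l + h l)) =
    (fun n => x * series f n + (y * series g n + series h n)).
  by apply/funext => n; rewrite !seriesEord /= !mulr_sumr -!big_split.
apply: cvgD; first by apply: cvgM; [exact: cvg_cst|exact: cf].
by apply: cvgD; [apply: cvgM; [exact: cvg_cst|exact: cg]|exact: ch].
Qed.

Lemma csumZD (a : C) u v B B' : dyadic u B -> dyadic v B' ->
  csum (fun l => a * u l + v l) = a * csum u + csum v.
Proof.
move=> uB vB; have [c1 c2] := csum_cvg uB; have [c3 c4] := csum_cvg vB.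
rewrite {1}/csum.
have -> : (fun l => complex.Re (a * u l + v l)) = (fun l => complex.Re a * complex.Re (u l)
    + (- complex.Im a * complex.Im (u l) + complex.Re (v l))).
  apply/funext => l; case: a => x y; case: (u l) => ? ?; case: (v l) => ? ? /=; ring.
have -> : (fun l => complex.Im (a * u l + v l)) = (fun l => complex.Re a * complex.Im (u l)
    + (complex.Im a * complex.Re (u l) + complex.Im (v l))).
  apply/funext => l; case: a => x y; case: (u l) => ? ?; case: (v l) => ? ? /=; ring.
rewrite (lim_series_lin _ _ c1 c2 c3) (lim_series_lin _ _ c2 c1 c4) /csum.
case: a => x y; apply/eqP; rewrite eq_complex /=; apply/andP.
by split; apply/eqP; ring.
Qed.

(** At basis vectors the disjointness of the blocks leaves a single nonzero term, which makes the
    coefficients explicit. *)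
Lemma csum_single u l0 : (forall l, l != l0 -> u l = 0) -> csum u = u l0.
Proof.
move=> u0.
have S (f : nat -> R) : (forall l, l != l0 -> f l = 0) -> limn (series f) = f l0.
  move=> f0; apply: cvg_lim => //; apply: cvg_near_cst; near=> n.
  rewrite seriesEord /=; have ln : (l0 < n)%N by near: n; exact: nbhs_infty_gt.
  by rewrite (bigD1 (Ordinal ln))//= big1 ?addr0// => j jl; apply: f0.
rewrite /csum !S => [|l /u0->//|l /u0->//]; by case: (u l0).
Unshelve. all: by end_near.
Qed.

End DyadicSeries.

(** * Extraction of blocks of large entries *)

Section Upper.
Context {R : realType}.
Local Notation C := R[i].

(** Greedy converse of [rearrangement_level]: a list of at most n indices is an admissible J, so an
    entry above rho lies outside it. *)
Lemma large_entries (z : nat -> C) n (rho : R) : (rho%:E < rearrangement z n)%E ->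
  exists l : seq nat, [/\ uniq l, size l = n.+1 & forall k, k \in l -> rho <= normc (z k)].
Proof.
move=> zn; suff h j : (j <= n.+1)%N ->
    exists l : seq nat, [/\ uniq l, size l = j & forall k, k \in l -> rho <= normc (z k)].
  exact: h.
elim: j => [_|j IH jn]; first by exists [::].
have [l [ul sl hl]] := IH (ltnW jn).
pose J : {fset nat} := finmap.seq_fset tt l.
have Jl k : (k \in J) = (k \in l) by exact: finmap.seq_fsetE.
have : (rho%:E < ereal_sup [set (normc (z k))%:E | k in ~` [set` J]])%E.
  apply: lt_le_trans zn _; apply: ereal_inf_lbound; exists J => //=.
  rewrite (leq_trans _ (_ : (j <= n)%N))// -sl.
  apply: (@uniq_leq_size _ (finmap.enum_fset J) l); first exact: (finmap.fset_uniq J).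
  by move=> k; rewrite -[_ \in finmap.enum_fset J]/(k \in J) Jl.
move=> /ereal_sup_gt[_ [k /= kJ <-]]; rewrite lte_fin => rk.
exists (k :: l); split => /=.
- by rewrite ul andbT; apply/negP => kl; apply: kJ; rewrite Jl.
- by rewrite sl.
by move=> k'; rewrite inE => /orP[/eqP->|/hl//]; exact: ltW.
Qed.

Definition block m (z : nat -> C) (beta T : R) (b : nat) (x : nat * (nat -> nat) * R) : Prop :=
  let: (n, e, rho) := x in
  [/\ (0 < n)%N, forall j, (j < m * n)%N -> (b <= e j)%N,
      forall j k, (j < k < m * n)%N -> (e j < e k)%N,
      forall j, (j < m * n)%N -> rho <= normc (z (e j)) & T <= n%:R `^ beta * rho].

Lemma exists_block m (z : nat -> C) (beta Z T : R) (b : nat) : (0 < m)%N -> 0 <= beta ->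
  0 < T -> (forall k, normc (z k) <= Z) ->
  ereal_sup (range (fun n : nat => (n.+1%:R `^ beta)%:E * rearrangement z n)%E) = +oo%E ->
  exists x, block m z beta T b x.
Proof.
move=> m0 beta0 T0 zZ Sy.
have Z0 : 0 <= Z by apply: le_trans (zZ 0%N); exact: normc_ge0.
(* Pays for dropping the indices below b and for dividing by m: n.+1 <= (b + 2m) N. The extra Z in
   the threshold D (T + Z) forces n.+1 >= b + m, because rho <= Z. *)
pose D : R := (b + 2 * m)%:R `^ beta.
have D0 : 0 < D by rewrite powR_gt0// ltr0n; lia.
have : ((D * (T + Z))%:E < ereal_sup (range (fun n : nat => (n.+1%:R `^ beta)%:E * rearrangement z n)))%E.
  by rewrite Sy ltry.
move=> /ereal_sup_gt[_ [n _ <-] hn].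
have n0 : 0 < n.+1%:R `^ beta :> R by rewrite powR_gt0 ?ltr0n.
pose rho := D * (T + Z) / n.+1%:R `^ beta.
have rhoE : D * (T + Z) = n.+1%:R `^ beta * rho by rewrite /rho [RHS]mulrC divfK// gt_eqF.
have [|l [ul sl hl]] := @large_entries z n rho.
  by move: hn; rewrite rhoE EFinM lte_pmul2l.
have rho0 : 0 < rho by rewrite divr_gt0// mulr_gt0//; lra.
have rZ : rho <= Z.
  case: l sl hl {ul} => // k l _ hl; apply: le_trans (hl k _) (zZ k).
  by rewrite inE eqxx.
have nb : (b + m <= n.+1)%N.
  rewrite leqNgt; apply/negP => h.
  have : n.+1%:R `^ beta <= D by rewrite ge0_ler_powR ?nnegrE// ler_nat; lia.
  move=> h2; have : n.+1%:R `^ beta * rho <= D * Z by rewrite ler_pM// ltW.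
  rewrite -rhoE mulrDr; have : 0 < D * T by rewrite mulr_gt0.
  by lra.
pose l' := sort leq [seq k <- l | b <= k]%N.
have ul' : uniq l' by rewrite sort_uniq filter_uniq.
have sl' : (n.+1 - b <= size l')%N.
  rewrite size_sort size_filter; have := count_predC (fun k => b <= k)%N l; rewrite sl.
  have : (count (predC (fun k => (b <= k)%N)) l <= b)%N.
    rewrite -size_filter -[leqRHS](size_iota 0); apply: uniq_leq_size; first exact: filter_uniq.
    by move=> k; rewrite mem_filter mem_iota /= -ltnNge => /andP[].
  by lia.
have srt : sorted ltn l' by rewrite ltn_sorted_uniq_leq ul' sort_sorted//; exact: leq_total.
pose N := ((n.+1 - b) %/ m)%N.
have N0 : (0 < N)%N by rewrite divn_gt0//; lia.
have mN : (m * N <= size l')%N by rewrite (leq_trans _ sl')// mulnC leq_divM.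
have nN : (n.+1 <= (b + 2 * m) * N)%N.
  have := ltn_ceil (n.+1 - b) m0; rewrite -/N.
  by move: N N0 {mN} => N N0; nia.
exists (N, (fun j => nth 0%N l' j), rho); split => //.
- move=> j jN; have : nth 0%N l' j \in l' by apply: mem_nth; exact: leq_trans mN.
  by rewrite mem_sort mem_filter => /andP[].
- move=> j k /andP[jk kN].
  have kl := leq_trans kN mN.
  by rewrite (sorted_ltn_nth ltn_trans) ?inE// (ltn_trans jk).
- move=> j jN; have : nth 0%N l' j \in l' by apply: mem_nth; exact: leq_trans mN.
  by rewrite mem_sort mem_filter => /andP[_ /hl].
have h1 : n.+1%:R `^ beta <= D * N%:R `^ beta.
  by rewrite /D -powRM// -natrM ge0_ler_powR ?nnegrE// ler_nat.
have h2 : D * (T + Z) <= D * N%:R `^ beta * rho by rewrite rhoE ler_wpM2r// ltW.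
rewrite -(ler_pM2l D0) mulrA (le_trans _ h2)// ler_wpM2l ?(ltW D0)//; lra.
Qed.

End Upper.

(** * The polynomial with divergent monomial series *)

Section UpperInclusion.
Context {R : realType}.
Local Notation C := R[i].

Lemma nle_sup (r : \bar R) (x : nat -> C) (t : R) : (0 < r)%E -> 0 <= t ->
  nle r x t -> forall k, normc (x k) <= t.
Proof.
case: r => [p|_|//]; last by move=> t0 h k; exact: h.
rewrite lte_fin => p0 t0 h k; rewrite leNgt; apply/negP => tx.
have := h k.+1; rewrite big_ord_recr /=.
have : t `^ p < normc (x k) `^ p by rewrite gt0_ltr_powR ?nnegrE ?normc_ge0.
have : 0 <= \sum_(j < k) normc (x j) `^ p by apply: sumr_ge0 => j _; rewrite powR_ge0.
by lra.
Qed.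

(** With a positive exponent the bound on the rearrangement tends to 0, so convergence of the
    sequence to 0 is automatic. *)
Lemma weak_lspace_intro (s : \bar R) (z : nat -> C) : 0 < fine s^-1%E ->
  (ereal_sup (range (fun n : nat => (n.+1%:R `^ fine s^-1%E)%:E * rearrangement z n)) < +oo)%E ->
  weak_lspace s z.
Proof.
move=> b0 Slty; split=> //; set b := fine _ in b0 Slty.
set S := ereal_sup _ in Slty.
have S0 : (0 <= S)%E.
  apply: (@le_trans _ _ ((1%:R `^ b)%:E * rearrangement z 0)%E).
    by rewrite mule_ge0 ?rearrangement_ge0// lee_fin powR_ge0.
  by apply: ereal_sup_ubound; exists 0%N.
have SE : S = (fine S)%:E by rewrite fineK// ge0_fin_numE.
have f0 : 0 <= fine S by exact: fine_ge0.
apply/cvgrPdist_le => eps eps0.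
pose n := Num.truncn ((fine S / eps) `^ b^-1).
have nb : fine S < eps * n.+1%:R `^ b.
  rewrite mulrC -ltr_pdivrMr//.
  have X0 : 0 <= fine S / eps by rewrite divr_ge0// ltW.
  have -> : fine S / eps = ((fine S / eps) `^ b^-1) `^ b by rewrite -powRrM mulVf ?gt_eqF// powRr1.
  by rewrite gt0_ltr_powR ?nnegrE ?powR_ge0// truncnS_gt.
have : (rearrangement z n < eps%:E)%E.
  have n0 : 0 < n.+1%:R `^ b :> R by rewrite powR_gt0 ?ltr0n.
  rewrite -(@lte_pmul2l _ (n.+1%:R `^ b)%:E)// -EFinM mulrC.
  apply: le_lt_trans (_ : (S < _)%E); first by apply: ereal_sup_ubound; exists n.
  by rewrite SE lte_fin.
move=> /ereal_inf_lt[_ [J _ <-] Jeps].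
near=> k; rewrite sub0r normrN ger0_norm ?normc_ge0//.
rewrite -lee_fin; apply: le_trans (ltW Jeps); apply: ereal_sup_ubound; exists k => //=.
move=> kJ; have : (\max_(j <- finmap.enum_fset J) j < k)%N by near: k; exact: nbhs_infty_gt.
by rewrite (big_rem k kJ) /= ltnNge leq_maxl.
Unshelve. all: by end_near.
Qed.

Lemma mon_upper m (r s : \bar R) (kappa beta : R) : (0 < m)%N -> (0 < r)%E ->
  ksz r m kappa -> kappa = m%:R - m%:R * beta -> 0 < beta -> fine s^-1%E = beta ->
  @mon R m r `<=` weak_lspace s.
Proof.
move=> m0 r0 [K K0 HK] kE b0 sE z [zl zmon].
apply: weak_lspace_intro; rewrite sE// ltey; apply/eqP => Sy.
have /lspaceP - /(_ r0) [Z Z0 zZ] := zl.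
have {}zZ := nle_sup r0 Z0 zZ.
have T0 l : 0 < 4 ^+ l :> R by rewrite exprn_gt0.
(* The thresholds 4^l beat the weights 2^-l put on the forms below. *)
pose G l b := projT1 (cid (exists_block b m0 (ltW b0) (T0 l) zZ Sy)).
have GP l b : block m z beta (4 ^+ l) b (G l b) by rewrite /G; case: cid.
pose nxt l b := (\max_(j < m * (G l b).1.1) (G l b).1.2 j).+1.
(* Each block starts past the last index of the previous one; this makes the blocks disjoint. *)
pose bnd := fix bnd l : nat := if l is l'.+1 then nxt l' (bnd l') else 0%N.
pose nn l := (G l (bnd l)).1.1; pose ee l := (G l (bnd l)).1.2; pose rho l := (G l (bnd l)).2.
have BP l : [/\ (0 < nn l)%N, forall j, (j < m * nn l)%N -> (bnd l <= ee l j)%N,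
      forall j k, (j < k < m * nn l)%N -> (ee l j < ee l k)%N,
      forall j, (j < m * nn l)%N -> rho l <= normc (z (ee l j)) & 4 ^+ l <= (nn l)%:R `^ beta * rho l].
  by have := GP l (bnd l); rewrite /nn /ee /rho; case: (G l (bnd l)) => [[a e] c].
have ee_lt l j : (j < m * nn l)%N -> (ee l j < bnd l.+1)%N.
  move=> jn; rewrite ltnS -/(ee l).
  exact: (@leq_bigmax _ (fun j : 'I_(m * nn l) => ee l j) (Ordinal jn)).
have bndS l : (bnd l <= bnd l.+1)%N.
  have [n0 h _ _ _] := BP l; have j0 : (0 < m * nn l)%N by rewrite muln_gt0 m0.
  by rewrite (leq_trans (h _ j0))// ltnW// ee_lt.
have bnd_mono l l' : (l <= l')%N -> (bnd l <= bnd l')%N.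
  by move=> /subnK <-; elim: (l' - l)%N => // d IH; rewrite addSn (leq_trans IH).
have disj l l' j k : (j < m * nn l)%N -> (k < m * nn l')%N -> ee l j = ee l' k -> l = l'.
  move=> jl kl' e; have [_ h _ _ _] := BP l; have [_ h' _ _ _] := BP l'.
  case: (ltngtP l l') => // ll; exfalso.
    have := leq_trans (bnd_mono _ _ ll) (h' k kl').
    by rewrite -e leqNgt ee_lt.
  have := leq_trans (bnd_mono _ _ ll) (h j jl).
  by rewrite e leqNgt ee_lt.
have nn0 l : (0 < nn l)%N by have [] := BP l.
pose eps l := projT1 (cid (HK (nn l) (nn0 l))).
have epsP l : forall x (t : 'I_m -> R),
    (forall q, 0 <= t q) -> (forall q, nrm_le r (x q) (t q)) ->
    normc (tform (eps l) x) <= K * (nn l)%:R `^ kappa * \prod_q t q.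
  by rewrite /eps; case: cid.
pose idx l (q : 'I_m) (i : 'I_(nn l)) := ee l (q * nn l + i)%N.
have pos_lt l (q : 'I_m) (i : 'I_(nn l)) : (q * nn l + i < m * nn l)%N.
  rewrite (@leq_trans (q.+1 * nn l))//; last by rewrite leq_mul2r ltn_ord orbT.
  by rewrite mulSn [X in (_ < X)%N]addnC ltn_add2l ltn_ord.
have ee_inj l j k : (j < m * nn l)%N -> (k < m * nn l)%N -> ee l j = ee l k -> j = k.
  have [_ _ h _ _] := BP l; move=> jl kl e.
  case: (ltngtP j k) => // jk.
    by have := h j k; rewrite jk kl e ltnn => /(_ isT).
  by have := h k j; rewrite jk jl e ltnn => /(_ isT).
have idx_inj l q : injective (@idx l q).
  move=> a b /ee_inj - /(_ (pos_lt _ _ _) (pos_lt _ _ _)) /addnI; exact: val_inj.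
have N0 l : 0 < (nn l)%:R `^ kappa :> R by rewrite powR_gt0 ?ltr0n.
(* The l-th form then has norm at most 2^-l on l_r, whatever the block length. *)
pose cl l : R := (2^-1) ^+ l / (K * (nn l)%:R `^ kappa).
have cl0 l : 0 < cl l by rewrite divr_gt0 ?mulr_gt0 ?exprn_gt0 ?invr_gt0.
pose F l (x : 'I_m -> nat -> C) : C :=
  (cl l)%:C%C * tform (eps l) (fun q j => x q (@idx l q j)).
have Fdy (x : 'I_m -> nat -> C) (t : 'I_m -> R) : (forall q, 0 <= t q) -> (forall q, nle r (x q) (t q)) ->
    dyadic (fun l => F l x) (\prod_q t q).
  move=> t0 xt l; rewrite normcM normcR (ger0_norm (ltW (cl0 l))).
  have h := epsP l (fun q j => x q (@idx l q j)) t t0 (fun q => nle_restrict r0 (@idx_inj l q) (xt q)).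
  apply: le_trans (ler_wpM2l (ltW (cl0 l)) h) _.
  rewrite le_eqVlt; apply/orP; left; apply/eqP; rewrite /cl; field.
  by rewrite !gt_eqF.
have Flin l x p (a : C) u v :
    F l (setarg x p (fun k => a * u k + v k)) = a * F l (setarg x p u) + F l (setarg x p v).
  rewrite /F mulrCA -mulrDr; congr (_ * _); rewrite /tform mulr_sumr -big_split /=.
  apply: eq_bigr => i _; rewrite mulrCA -mulrDr; congr (_ * _).
  rewrite (bigD1 p)//= [in X in _ = X + _](bigD1 p)//= [in X in _ = _ + X](bigD1 p)//=.
  rewrite /setarg eqxx mulrDl mulrA.
  by congr (_ * _ * _ + _ * _); apply: eq_bigr => q /negbTE->.
pose L x := csum (fun l => F l x).
have dyl x : (forall q, lspace r (x q)) ->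
    dyadic (fun l => F l x) (\prod_q fine (lnorm r (x q))).
  by move=> xl; apply: Fdy => q; have [] := nle_lnorm r0 (xl q).
have setl (x : 'I_m -> nat -> C) p u : (forall q, lspace r (x q)) -> lspace r u -> forall q, lspace r (setarg x p u q).
  by move=> xl ul q; rewrite /setarg; case: ifP.
have Lm : multilinear_on r L.
  move=> x p a u v xl ul vl.
  rewrite -[LHS]/(csum (fun l => F l (setarg x p (fun k => a * u k + v k)))).
  rewrite -[RHS]/(a * csum (fun l => F l (setarg x p u)) + csum (fun l => F l (setarg x p v))).
  rewrite -(csumZD a (dyl _ (setl x p u xl ul)) (dyl _ (setl x p v xl vl))).
  by congr csum; apply/funext => l; exact: Flin.
have Lb : bounded_on r L by exists 4 => x xl; exact: csum_le (dyl x xl).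
have Fbase l (j : 'I_m -> nat) : F l (fun q => ebase (j q)) != 0 ->
    exists i : {ffun 'I_m -> 'I_(nn l)}, forall q, j q = @idx l q (i q).
  apply: contraNP => none; rewrite /F /tform big1 ?mulr0// => i _.
  have [/forallP h|/forallPn[q jq]] := boolP [forall q, j q == @idx l q (i q)].
    by exfalso; apply: none; exists i => q; apply/eqP.
  by rewrite (bigD1 q)//= /ebase eq_sym (negbTE jq) mul0r mulr0.
have Fval l (i : {ffun 'I_m -> 'I_(nn l)}) :
    normc (F l (fun q => ebase (@idx l q (i q)))) = cl l.
  rewrite /F /tform (bigD1 i)//= [X in X + _](_ : _ = (sgn (eps l i))%:C%C); last first.
    by rewrite big1 ?mulr1// => q _; rewrite /ebase eqxx.
  rewrite big1 => [|i' ii']; last first.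
    have [q iq] : exists q, i' q != i q.
      by apply/existsP; rewrite -negb_forall; apply: contra ii' => /forallP h; apply/eqP/ffunP => q; apply/eqP.
    by rewrite (bigD1 q)//= /ebase (inj_eq (@idx_inj l q)) (negbTE iq) mul0r mulr0.
  by rewrite addr0 normcM !normcR sgn_norm mulr1 (ger0_norm (ltW (cl0 l))).
have Lval l (i : {ffun 'I_m -> 'I_(nn l)}) :
    normc (L (fun q => ebase (@idx l q (i q)))) = cl l.
  rewrite -(Fval l i); congr normc; apply: csum_single => l' ll'.
  apply/eqP; apply: contraNT ll' => /Fbase[i' /(_ (Ordinal m0)) e].
  by apply/eqP; exact: disj (pos_lt _ _ _) (pos_lt _ _ _) (esym e).
(* Argument q only sees the q-th piece of a block, and the pieces follow one another. So at most one
   rearrangement of an index contributes, namely the increasing one, and L(e_j) is the coefficient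
   itself. *)
have Lsorted (j : 'I_m -> nat) : L (fun q => ebase (j q)) != 0 -> {homo j : q q' / (q < q')%N}.
  move=> Lj; have [l Fl] : exists l, F l (fun q => ebase (j q)) != 0.
    apply: contrapT => none; move/eqP: Lj; apply.
    have F0 l : F l (fun q => ebase (j q)) = 0.
      by apply/eqP; apply: contrapT => h; apply: none; exists l; apply/negP.
    by rewrite /L (@csum_single _ _ 0%N) ?F0// => l _; rewrite F0.
  have [i ji] := Fbase l j Fl; move=> q q' qq'; rewrite !ji.
  have [_ _ h _ _] := BP l; apply: h; rewrite pos_lt andbT.
  by have := ltn_ord (i q); nia.
have tsorted N (i : {ffun 'I_m -> 'I_N}) : L (fun q => ebase (i q)) != 0 -> sorted leq (tup i).
  move=> /Lsorted h; apply/(sortedP 0%N) => k; rewrite size_tuple => km.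
  have k'm := ltnW km.
  rewrite -(tnth_nth 0%N (tup i) (Ordinal k'm)) -(tnth_nth 0%N (tup i) (Ordinal km)).
  by rewrite !tnth_mktuple ltnW// h.
pose P (z : nat -> C) := L (fun=> z).
pose c (j : m.-tuple nat) := L (fun q => ebase (tnth j q)).
have ctup N (i : {ffun 'I_m -> 'I_N}) : c (tup i) = L (fun q => ebase (i q)).
  by rewrite /c; congr L; apply/funext => q; rewrite tnth_mktuple.
have Pc : is_coef P c.
  move=> y yfin; pose s0 : seq nat := finmap.enum_fset (fset_set [set k | y k != 0]).
  pose N := (\max_(k <- s0) k).+1.
  have yN k : (N <= k)%N -> y k = 0.
    move=> Nk; apply/eqP; apply: contraTT Nk => yk; rewrite -ltnNge ltnS.
    have ks : k \in s0 by rewrite -[_ \in _]/(k \in fset_set _) in_fset_set//; exact/mem_set.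
    by rewrite (big_rem k ks) /= leq_maxl.
  have yE : y = fins N y.
    by apply/funext => k; rewrite /fins; case: ltnP => // /yN.
  rewrite /P [in LHS]yE (expansion r0 Lm (fun=> y) (ltn0Sn _)).
  rewrite (@fsbig_Jset _ m N); last first.
    move=> j _ + q; rewrite mulf_eq0 negb_or => /andP[_ mj].
    rewrite ltnNge; apply/negP => Nj; move: mj; rewrite /monomial (bigD1 q)//=.
    by rewrite (yN _ Nj) mul0r eqxx.
  rewrite [RHS]big_mkcond; apply: eq_bigr => i _; rewrite ctup monomial_tup.
  case: ifPn => // si; have [->|/tsorted] := eqVneq (L (fun q => ebase (i q))) 0.
    by rewrite mul0r.
  by rewrite (negbTE si).
have hP : hpoly m r P by exists L; split.
have := zmon P hP c Pc; set E := esum _ _ => Elty.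
have key l : ((K^-1 * 2 ^+ l)%:E <= E)%E.
  pose T (i : {ffun 'I_m -> 'I_(nn l)}) : m.-tuple nat := [tuple @idx l q (i q) | q < m].
  have Tinj : injective T.
    move=> i j ij; apply/ffunP => q; apply: (@idx_inj l q).
    by have := congr1 (fun t => tnth t q) ij; rewrite !tnth_mktuple.
  have cT i : normc (c (T i)) = cl l.
    rewrite -(Lval l i) /c; congr (normc (L _)); apply/funext => q.
    by rewrite tnth_mktuple.
  have TJ i : Jset (T i).
    have /Lsorted h : L (fun q => ebase (@idx l q (i q))) != 0.
      by apply/eqP => L0; have := Lval l i; rewrite L0 normc0 => c0; have := cl0 l; rewrite -c0 ltxx.
    apply/(sortedP 0%N) => k; rewrite size_tuple => km; have k'm := ltnW km.
    rewrite -(tnth_nth 0%N (T i) (Ordinal k'm)) -(tnth_nth 0%N (T i) (Ordinal km)).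
    by rewrite !tnth_mktuple ltnW// (h (Ordinal k'm) (Ordinal km)).
  pose s1 := [seq T i | i <- index_enum {ffun 'I_m -> 'I_(nn l)}].
  have us1 : uniq s1 by rewrite (map_inj_uniq Tinj) index_enum_uniq.
  have sJ j : j \in s1 -> Jset j by move=> /(@mapP _ (m.-tuple nat))[i _ ->].
  apply: (@le_trans _ _ (\sum_(j \in [set` s1]) (normc (c j * monomial z j))%:E)%E); last first.
    by apply: ereal_sup_ubound; exists [set` s1] => //; split; [exact: finite_seq|exact: sJ].
  rewrite -fsbig_seq// sumEFin lee_fin big_map.
  have [n0 _ _ hz hT] := BP l.
  have nb : 0 < (nn l)%:R `^ beta :> R by rewrite powR_gt0 ?ltr0n.
  have rho0 : 0 <= rho l.
    by rewrite -(pmulr_rge0 _ nb) (le_trans _ hT)// ltW.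
  apply: (@le_trans _ _ (\sum_(i : {ffun 'I_m -> 'I_(nn l)}) cl l * rho l ^+ m)); last first.
    apply: ler_sum => i _; rewrite normcM cT ler_wpM2l ?(ltW (cl0 l))//.
    rewrite /monomial normc_prod -[m in _ ^+ m]card_ord -prodr_const.
    by apply: ler_prod => q _; rewrite rho0 tnth_mktuple hz.
  rewrite sumr_const card_ffun !card_ord -[leRHS]mulr_natl natrX.
  (* Here kappa = m - m beta is used: the number of monomials cancels the normalisation n^kappa and
     leaves (n^beta)^m. *)
  have e1 : (nn l)%:R ^+ m = (nn l)%:R `^ kappa * ((nn l)%:R `^ beta) ^+ m :> R.
    rewrite -[in RHS]powR_mulrn ?powR_ge0// -powRrM -powRD; last first.
      by rewrite pnatr_eq0 (gtn_eqF n0) implybT.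
    by rewrite -powR_mulrn// kE; congr (_ `^ _); ring.
  have e2 : (nn l)%:R ^+ m * (cl l * rho l ^+ m) = K^-1 * ((2^-1) ^+ l * ((nn l)%:R `^ beta * rho l) ^+ m).
    by rewrite e1 /cl exprMn; field; rewrite !gt_eqF.
  rewrite e2 ler_wpM2l ?invr_ge0 ?(ltW K0)//.
  have e3 : 2 ^+ l = (2^-1) ^+ l * 4 ^+ l :> R by rewrite -exprMn; congr (_ ^+ _); lra.
  rewrite e3 ler_wpM2l ?exprn_ge0//.
  apply: (@le_trans _ _ ((4 ^+ l) ^+ m)).
    by rewrite -[leLHS]expr1; apply: ler_weXn2l => //; rewrite exprn_ege1// ler1n.
  by apply: lerXn2r; rewrite ?nnegrE ?(ltW (T0 l))// (le_trans _ hT)// ltW.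
have E0 : (0 <= E)%E.
  by apply: le_trans (key 0%N); rewrite lee_fin mulr_ge0// invr_ge0 ltW.
have EE : E = (fine E)%:E by rewrite fineK// ge0_fin_numE.
(* At this l one has 2^l > l > K E, against the bound. *)
have := key (Num.truncn (K * fine E)).+1; rewrite EE lee_fin ler_pdivrMl//.
apply/negP; rewrite -ltNge (lt_trans (truncnS_gt _))// -natrX ltr_nat.
exact: ltn_expl.
Qed.

End UpperInclusion.

(** * The exponents in the four cases *)

Lemma fine_inve_EFin (R : realType) (x : R) : fine (x%:E)^-1%E = x^-1.
Proof. by rewrite inver; case: eqP => [->|_] //=; rewrite invr0. Qed.

Local Open Scope ereal_scope.

Theorem theorem5p1 (R : realType) (r : \bar R) (m : nat)
    (hr : 1 <= r) (hm : (2 <= m)%N) :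
  [/\ r = +oo ->
        mon m r = weak_lspace (((2 * m)%:R / m.-1%:R)%R%:E),
      r = 1 ->
        mon m r = lspace 1,
      2%:E <= r -> r < +oo ->
        seq_mul (weak_lspace (((2 * m)%:R / m.-1%:R)%R%:E)) (lspace r)
          `<=` mon m r /\
        mon m r `<=` weak_lspace ((m.-1%:R / (2 * m)%:R)%R%:E + r^-1)^-1
    & 1 < r -> r < 2%:E ->
        let q := hoelder_conjugate (m%:R%:E * hoelder_conjugate r) in
        (forall eps : R, (0 < eps)%R -> 0 < q - eps%:E ->
           lspace (q - eps%:E) `<=` mon m r) /\
        mon m r `<=` weak_lspace q].
Proof.
have m0 : (0 < m)%N by exact: ltnW.
have m0' : (0 < m%:R :> R)%R by rewrite ltr0n.
have m1' : (1 < m%:R :> R)%R by rewrite ltr1n.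
have mE : (m.-1%:R = m%:R - 1 :> R)%R by rewrite -{2}(prednK m0) -natr1 addrK.
have b0 : (0 < m.-1%:R / (2 * m)%:R :> R)%R.
  by rewrite divr_gt0// ?ltr0n; lia.
have r0 : 0 < r by exact: lt_le_trans hr.
split.
- move=> ry; apply/seteqP; split.
    apply: (mon_upper m0 r0 (kappa := ((m%:R + 1) / 2)%R) (beta := (m.-1%:R / (2 * m)%:R)%R)) => //.
    + by rewrite ry; exact: ksz_infty.
    + by rewrite natrM mE; field; rewrite gt_eqF.
    + by rewrite fine_inve_EFin invf_div.
  (* For r = oo the constant sequence 1 serves as the factor in l_r. *)
  move=> a aw; apply: (weak_mul_lspace_mon hm hr); exists a => //.
  exists (fun=> 1%R); last by apply/funext => k; rewrite mulr1.
  by apply/lspaceP => //; exists 1%R => //; rewrite ry => k; rewrite normc1.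
- by move=> ->; exact: lspace1_mon.
- move=> r2 ry; split; first exact: weak_mul_lspace_mon.
  case: r hr r0 r2 ry => [p| |]// hr r0 r2 _.
  rewrite lee_fin in r2; have p0 : (0 < p)%R by lra.
  apply: (mon_upper m0 r0 (kappa := ((m%:R + 1) / 2 - m%:R / p)%R)
    (beta := (m.-1%:R / (2 * m)%:R + p^-1)%R)).
  + exact: ksz_ge2.
  + by rewrite natrM mE; field; rewrite !gt_eqF.
  + by rewrite addr_gt0// invr_gt0.
  have bp : (0 < m.-1%:R / (2 * m)%:R + p^-1 :> R)%R by rewrite addr_gt0// invr_gt0.
  rewrite [(p%:E)^-1]inver gt_eqF// -EFinD.
  by rewrite [(_%:E)^-1]inver (gt_eqF bp) fine_inve_EFin invrK.
case: r hr r0 => [p| |]// hr r0 p1 p2 q.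
rewrite lte_fin in p1; rewrite lte_fin in p2.
have p0 : (0 < p)%R by lra.
have ip1 : (p^-1 < 1)%R by rewrite invf_lt1.
(* The reciprocal of (mr')'. It satisfies m - m b = 1 - 1/p, the growth exponent of [ksz_lt2]. *)
pose b := (1 - (1 - p^-1) / m%:R)%R.
have im : (m%:R^-1 < 1 :> R)%R by rewrite invf_lt1.
have im0 : (0 < m%:R^-1 :> R)%R by rewrite invr_gt0.
have ip0 : (0 < p^-1)%R by rewrite invr_gt0.
have hb : (0 < b)%R.
  have : ((1 - p^-1) / m%:R < 1)%R by rewrite ltr_pdivrMr//; lra.
  by rewrite /b; lra.
have hE (x : R) : (1 < x)%R -> hoelder_conjugate x%:E = ((1 - x^-1)^-1)%:E.
  move=> x1; have x0 : (0 < x)%R by lra.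
  have ix : (0 < 1 - x^-1)%R by rewrite subr_gt0 invf_lt1.
  rewrite /hoelder_conjugate /= eqe gt_eqF//.
  rewrite -EFinB inver gt_eqF ?subr_gt0// -EFinM; congr EFin; field.
  by rewrite !gt_eqF// subr_gt0.
have qE : q = (b^-1)%:E.
  rewrite /q (hE _ p1) -EFinM hE.
    by rewrite invf_div; congr (_%:E); rewrite /b invrM ?unitfE ?gt_eqF ?invr_gt0 ?subr_gt0// invrK.
  rewrite ltr_pdivlMr ?subr_gt0//; lra.
split.
  move=> eps eps0; rewrite qE -EFinB lte_fin => q0.
  apply: lspace_mon => //; rewrite -/b -[ltLHS]invrK ltf_pV2 ?posrE ?invr_gt0//.
  by rewrite gtrBl.
rewrite qE; apply: (mon_upper m0 r0 (kappa := (1 - p^-1)%R) (beta := b)) => //.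
- by apply: ksz_lt2 => //; rewrite p1 p2.
- by rewrite /b; field; rewrite !gt_eqF.
by rewrite fine_inve_EFin invrK.
Qed.
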